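(* For all integers $n\geq 5$ and $q\geq 3$, there is a canonical isomorphism of graded Lie rings, in degrees at least one, $$\mathcal L(GL_n(q\mathbb Z))\;\cong\;\mathfrak{sl}_n(\mathbb Z/q)[t],$$ where the degree of $t$ is $1$ and the Lie bracket of $Mt^i$ and $Nt^j$ is $[M,N]t^{i+j}$ (with $[M,N]=MN-NM$).
   Context: $GL_n(q\mathbb Z)$ denotes the congruence group $\ker(GL_n(\mathbb Z)\to GL_n(\mathbb Z/q))$. For a group $G$ with lower central series $\Gamma_1(G)=G$, $\Gamma_{k+1}(G)=[G,\Gamma_k(G)]$, $\mathcal L(G)=\bigoplus_{k\geq1}\Gamma_k(G)/\Gamma_{k+1}(G)$ is the graded Lie ring whose bracket is induced by the commutator map $(x,y)\mapsto xyx^{-1}y^{-1}$. $\mathfrak{sl}_n(\mathbb Z/q)$ is the Lie ring of trace-zero $n\times n$ matrices over $\mathbb Z/q$. ''In degrees at least one'' means that only the part $\bigoplus_{i\geq1}\mathfrak{sl}_n(\mathbb Z/q)t^i$ of the right-hand side is considered. *)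

(* Defs.v *)
From HB Require Import structures.
From mathcomp Require Import all_boot all_order all_algebra.
From mathcomp Require Import generic_quotient.
From mathcomp Require Import ssrAC boolp classical_sets.

Set Implicit Arguments.
Unset Strict Implicit.
Unset Printing Implicit Defensive.

Import GRing.Theory.

Local Open Scope ring_scope.

HB.mixin Record isLieRing V of GRing.Zmodule V := {
  lie : V -> V -> V;
  lieDl : forall x y z, lie (x + y) z = lie x z + lie y z;
  lieDr : forall x y z, lie x (y + z) = lie x y + lie x z;
  liexx : forall x, lie x x = 0;
  lie_jacobi : forall x y z,
    lie (lie x y) z + lie (lie y z) x + lie (lie z x) y = 0
}.

#[short(type="lieRingType")]
HB.structure Definition LieRing := {V of isLieRing V & GRing.Zmodule V}.

(* [homog d x] means that x lies in the degree d summand; the last two axioms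
   say that V is the internal direct sum of its homogeneous summands. *)
HB.mixin Record isGradedLie V of LieRing V := {
  homog : nat -> V -> Prop;
  homog0 : forall d, homog d 0;
  homogB : forall d x y, homog d x -> homog d y -> homog d (x - y);
  homog_lie : forall d e x y,
    homog d x -> homog e y -> homog (d + e)%N (lie x y);
  homog_span : forall x, exists (N : nat) (c : nat -> V),
    (forall i, homog i (c i)) /\ x = \sum_(i < N) c i;
  homog_indep : forall (N : nat) (c : nat -> V),
    (forall i, homog i (c i)) -> \sum_(i < N) c i = 0 ->
    forall i, (i < N)%N -> c i = 0
}.

#[short(type="gradedLieRingType")]
HB.structure Definition GradedLieRing := {V of isGradedLie V & LieRing V}.

Record graded_lie_iso (V W : gradedLieRingType) (phi : V -> W) : Prop := {
  graded_lie_iso_bij : bijective phi;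
  graded_lie_isoD : {morph phi : x y / x + y};
  graded_lie_iso_lie : {morph phi : x y / lie x y};
  graded_lie_iso_homog : forall d x, homog d (phi x) <-> homog d x
}.

Section DirectSum.
Variable V : nat -> zmodType.

Definition finsupp (f : forall k, V k) : bool :=
  `[< exists N, forall k, (N <= k)%N -> f k = 0 >].

Record dsum := DSum { dsum_val :> forall k, V k; _ : finsupp dsum_val }.

HB.instance Definition _ := [isSub for dsum_val].
HB.instance Definition _ := [Choice of dsum by <:].

Lemma finsuppP (f : dsum) : exists N, forall k, (N <= k)%N -> f k = 0.
Proof. by case: f => f /= /asboolP. Qed.

Lemma dsumP (f g : dsum) : (forall k, f k = g k) -> f = g.
Proof. by move=> fg; apply/val_inj/functional_extensionality_dep. Qed.

Fact dsum_zero_subproof : finsupp (fun k => 0).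
Proof. by apply/asboolP; exists 0. Qed.
Definition dsum_zero := DSum dsum_zero_subproof.

Fact dsum_opp_subproof (f : dsum) : finsupp (fun k => - f k).
Proof.
by apply/asboolP; have [N fN] := finsuppP f; exists N => k /fN ->; rewrite oppr0.
Qed.
Definition dsum_opp f := DSum (dsum_opp_subproof f).

Fact dsum_add_subproof (f g : dsum) : finsupp (fun k => f k + g k).
Proof.
apply/asboolP; have [[N fN] [M gM]] := (finsuppP f, finsuppP g).
exists (maxn N M) => k; rewrite geq_max => /andP[/fN -> /gM ->].
by rewrite addr0.
Qed.
Definition dsum_add f g := DSum (dsum_add_subproof f g).

Fact dsum_addA : associative dsum_add.
Proof. by move=> f g h; apply: dsumP => k /=; rewrite addrA. Qed.
Fact dsum_addC : commutative dsum_add.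
Proof. by move=> f g; apply: dsumP => k /=; rewrite addrC. Qed.
Fact dsum_add0 : left_id dsum_zero dsum_add.
Proof. by move=> f; apply: dsumP => k /=; rewrite add0r. Qed.
Fact dsum_addN : left_inverse dsum_zero dsum_opp dsum_add.
Proof. by move=> f; apply: dsumP => k /=; rewrite addNr. Qed.

HB.instance Definition _ :=
  GRing.isZmodule.Build dsum dsum_addA dsum_addC dsum_add0 dsum_addN.

Lemma dsum0E k : (0 : dsum) k = 0. Proof. by []. Qed.
Lemma dsumDE (f g : dsum) k : (f + g) k = f k + g k. Proof. by []. Qed.
Lemma dsumNE (f : dsum) k : (- f) k = - f k. Proof. by []. Qed.
Lemma dsum_sumE (I : Type) (r : seq I) (P : pred I) (F : I -> dsum) k :
  (\sum_(i <- r | P i) F i) k = \sum_(i <- r | P i) F i k.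
Proof. by apply: (big_morph (fun f : dsum => f k)). Qed.

Definition inj_fun i (a : V i) k : V k :=
  if i =P k is ReflectT e then ecast k (V k) e a else 0.

Lemma inj_fun_eq i (a : V i) : inj_fun a i = a.
Proof. by rewrite /inj_fun; case: eqP => // e; rewrite eq_axiomK. Qed.

Lemma inj_fun_neq i (a : V i) k : i != k -> inj_fun a k = 0.
Proof. by rewrite /inj_fun; case: eqP. Qed.

Fact dsum_inj_subproof i (a : V i) : finsupp (inj_fun a).
Proof.
apply/asboolP; exists i.+1 => k ik; apply: inj_fun_neq.
by rewrite neq_ltn ik.
Qed.
Definition dsum_inj i (a : V i) := DSum (dsum_inj_subproof a).

Definition dsum_homog d (f : dsum) : Prop := forall k, k != d -> f k = 0.

Lemma dsum_inj_homog i (a : V i) : dsum_homog i (dsum_inj a).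
Proof. by move=> k ki; apply: inj_fun_neq; rewrite eq_sym. Qed.

Lemma dsum_decomp (f : dsum) :
  exists N, f = \sum_(i < N) dsum_inj (f i).
Proof.
have [N fN] := finsuppP f; exists N; apply: dsumP => k; rewrite dsum_sumE.
have [kN|/fN fk] := ltnP k N.
  rewrite (bigD1 (Ordinal kN)) //= inj_fun_eq big1 ?addr0 // => i.
  by rewrite -val_eqE /= => ik; rewrite inj_fun_neq.
rewrite fk big1 // => i _ /=; have [e|] := eqVneq (i : nat) k.
  by rewrite e inj_fun_eq.
exact: inj_fun_neq.
Qed.

Lemma dsum_ind_add (P : dsum -> Prop) : P 0 ->
  (forall i (a : V i) f, P f -> P (dsum_inj a + f)) -> forall f, P f.
Proof.
move=> P0 PD f; have [N ->] := dsum_decomp f.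
apply: (big_rec P) => // i g _; exact: PD.
Qed.

Lemma dsum_homog0 d : dsum_homog d 0. Proof. by []. Qed.
Lemma dsum_homogB d f g :
  dsum_homog d f -> dsum_homog d g -> dsum_homog d (f - g).
Proof.
by move=> hf hg k kd; rewrite dsumDE dsumNE hf // hg // subr0.
Qed.
Lemma dsum_homog_span f : exists (N : nat) (c : nat -> dsum),
  (forall i, dsum_homog i (c i)) /\ f = \sum_(i < N) c i.
Proof.
have [N ->] := dsum_decomp f; exists N, (fun i => dsum_inj (f i)).
by split=> // i; apply: dsum_inj_homog.
Qed.
Lemma dsum_homog_indep (N : nat) (c : nat -> dsum) :
    (forall i, dsum_homog i (c i)) -> \sum_(i < N) c i = 0 ->
  forall i, (i < N)%N -> c i = 0.
Proof.
move=> hc s0 i iN; apply: dsumP => k.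
have [->|ki] := eqVneq k i; last exact: hc.
have := congr1 (fun f : dsum => f i) s0.
rewrite dsum_sumE (bigD1 (Ordinal iN)) //= big1 ?addr0 // => j.
by rewrite -val_eqE /= eq_sym => ji; apply: hc.
Qed.

(* A family of pairings V i -> V j -> V k, of which only those with
   i + j = k matter, extended bilinearly to the direct sum. *)
Variable br : forall i j k, V i -> V j -> V k.
Hypothesis brDl : forall i j k, (i + j = k)%N -> forall x y z,
  @br i j k (x + y) z = br k x z + br k y z.
Hypothesis brDr : forall i j k, (i + j = k)%N -> forall x y z,
  @br i j k x (y + z) = br k x y + br k x z.

Definition dsum_lie_fun (f g : dsum) k : V k :=
  \sum_(i < k.+1) br k (f i) (g (k - i)%N).

Lemma br0l i j k y : (i + j = k)%N -> @br i j k 0 y = 0.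
Proof. by move=> e; apply: (addrI (@br i j k 0 y)); rewrite -(brDl e) !addr0. Qed.
Lemma br0r i j k x : (i + j = k)%N -> @br i j k x 0 = 0.
Proof. by move=> e; apply: (addrI (@br i j k x 0)); rewrite -(brDr e) !addr0. Qed.

Lemma dsum_lie_subproof f g : finsupp (dsum_lie_fun f g).
Proof.
apply/asboolP; have [[N fN] [M gM]] := (finsuppP f, finsuppP g).
exists (N + M)%N => k NMk; apply: big1 => i _.
have e : (i + (k - i) = k)%N by rewrite subnKC // -ltnS.
have [/fN ->|iN] := leqP N i; first exact: br0l.
rewrite gM ?br0r // -(leq_add2l i) e (leq_trans _ NMk) // leq_add2r.
exact: ltnW.
Qed.
Definition dsum_lie f g := DSum (dsum_lie_subproof f g).

Lemma dsum_lieDl f g h : dsum_lie (f + g) h = dsum_lie f h + dsum_lie g h.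
Proof.
apply: dsumP => k; rewrite dsumDE /= /dsum_lie_fun -big_split /=.
by apply: eq_bigr => i _; rewrite brDl // subnKC // -ltnS.
Qed.
Lemma dsum_lieDr f g h : dsum_lie f (g + h) = dsum_lie f g + dsum_lie f h.
Proof.
apply: dsumP => k; rewrite dsumDE /= /dsum_lie_fun -big_split /=.
by apply: eq_bigr => i _; rewrite brDr // subnKC // -ltnS.
Qed.
Lemma dsum_lie0l f : dsum_lie 0 f = 0.
Proof. by apply: (addrI (dsum_lie 0 f)); rewrite -dsum_lieDl !addr0. Qed.
Lemma dsum_lie0r f : dsum_lie f 0 = 0.
Proof. by apply: (addrI (dsum_lie f 0)); rewrite -dsum_lieDr !addr0. Qed.

Lemma dsum_lie_homog d e f g :
  dsum_homog d f -> dsum_homog e g -> dsum_homog (d + e)%N (dsum_lie f g).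
Proof.
move=> hf hg k kde; apply: big1 => i _.
have ik : (i + (k - i) = k)%N by rewrite subnKC // -ltnS.
have [id|/hf ->] := eqVneq (i : nat) d; last exact: br0l.
rewrite hg ?br0r //; apply: contra kde => /eqP <-.
by rewrite -id ik.
Qed.

Lemma dsum_lie_inj i j k (a : V i) (b : V j) : (i + j = k)%N ->
  dsum_lie (dsum_inj a) (dsum_inj b) = dsum_inj (br k a b).
Proof.
move=> ijk; apply: dsumP => l; have [e|ne] := eqVneq l k; last first.
  rewrite (dsum_inj_homog (br k a b)) //.
  by rewrite (dsum_lie_homog (@dsum_inj_homog i a) (@dsum_inj_homog j b)) ?ijk.
subst l; rewrite /= inj_fun_eq /dsum_lie_fun.
have ik : (i < k.+1)%N by rewrite ltnS -ijk leq_addr.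
rewrite (bigD1 (Ordinal ik)) //= big1 => [|l].
  rewrite addr0 inj_fun_eq; have : (k - i = j)%N by rewrite -ijk addKn.
  by move: (k - i)%N => m e; subst m; rewrite inj_fun_eq.
rewrite -val_eqE /= eq_sym => il; rewrite (inj_fun_neq a il) br0l //.
by rewrite subnKC // -ltnS.
Qed.

Hypothesis brxx : forall i k, (i + i = k)%N -> forall x, @br i i k x x = 0.
Hypothesis brC : forall i j k, (i + j = k)%N -> forall x y,
  @br i j k x y = - br k y x.
Hypothesis brJ : forall i j l k, (i + j + l = k)%N -> forall x y z,
  br k (@br i j (i + j)%N x y) z + br k (@br j l (j + l)%N y z) x
  + br k (@br l i (l + i)%N z x) y = 0.

Lemma dsum_lieC f g : dsum_lie f g = - dsum_lie g f.
Proof.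
elim/dsum_ind_add: f g => [|i a f IHf] g.
  by rewrite dsum_lie0l dsum_lie0r oppr0.
rewrite dsum_lieDl dsum_lieDr opprD IHf; congr (_ + _).
elim/dsum_ind_add: g => [|j b g IHg].
  by rewrite dsum_lie0l dsum_lie0r oppr0.
rewrite dsum_lieDl dsum_lieDr opprD IHg; congr (_ + _).
rewrite (@dsum_lie_inj i j _ _ _ erefl) (@dsum_lie_inj j i _ _ _ (addnC j i)).
apply: dsumP => k; rewrite dsumNE; have [e|ne] := eqVneq k (i + j)%N.
  by subst k; rewrite /= !inj_fun_eq brC.
by rewrite !(@dsum_inj_homog (i + j)%N _) // oppr0.
Qed.

Lemma dsum_liexx f : dsum_lie f f = 0.
Proof.
elim/dsum_ind_add: f => [|i a f IHf]; first exact: dsum_lie0l.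
rewrite dsum_lieDl !dsum_lieDr IHf addr0 [X in _ + X]dsum_lieC addrK.
rewrite (@dsum_lie_inj i i (i + i)) // brxx //; apply: dsumP => k.
have [e|ne] := eqVneq k (i + i)%N; first by subst k; rewrite /= inj_fun_eq.
by rewrite (@dsum_inj_homog (i + i)%N _).
Qed.

Lemma dsum_jacobi f g h :
  dsum_lie (dsum_lie f g) h + dsum_lie (dsum_lie g h) f
  + dsum_lie (dsum_lie h f) g = 0.
Proof.
have E : forall s t u v w z : dsum,
    s + t + u = 0 -> v + w + z = 0 -> (s + v) + (t + w) + (u + z) = 0.
  by move=> s t u v w z e1 e2; rewrite (addrACA s) (addrACA (s + t)) e1 e2 addr0.
elim/dsum_ind_add: f g h => [|i a f IHf] g h.
  by rewrite !(dsum_lie0l, dsum_lie0r, addr0).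
rewrite !(dsum_lieDl, dsum_lieDr); apply: (E); last exact: IHf.
elim/dsum_ind_add: g h => [|j b g IHg] h.
  by rewrite !(dsum_lie0l, dsum_lie0r, addr0).
rewrite !(dsum_lieDl, dsum_lieDr); apply: (E); last exact: IHg.
elim/dsum_ind_add: h => [|l c h IHh].
  by rewrite !(dsum_lie0l, dsum_lie0r, addr0).
rewrite !(dsum_lieDl, dsum_lieDr); apply: (E); last exact: IHh.
have e1 : (i + j + l = i + j + l)%N by [].
have e2 : (j + l + i = i + j + l)%N by rewrite addnC addnA.
have e3 : (l + i + j = i + j + l)%N by rewrite -addnA addnC.
rewrite (@dsum_lie_inj i j _ a b erefl) (@dsum_lie_inj j l _ b c erefl).
rewrite (@dsum_lie_inj l i _ c a erefl).
rewrite (dsum_lie_inj _ _ e1) (dsum_lie_inj _ _ e2) (dsum_lie_inj _ _ e3).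
apply: dsumP => k; rewrite !dsumDE; have [e|ne] := eqVneq k (i + j + l)%N.
  by subst k; rewrite /= !inj_fun_eq brJ.
by rewrite !(@dsum_inj_homog (i + j + l)%N _) // !addr0.
Qed.

End DirectSum.

Section LowerCentralSeries.
Variable G : groupType.
Local Open Scope group_scope.
Local Open Scope classical_set_scope.
Local Open Scope quotient_scope.

Definition is_subgroup (H : set G) : Prop :=
  H 1 /\ forall x y, H x -> H y -> H (x / y).

(* Unlike [~ x, y] = x^-1 * y^-1 * x * y. *)
Definition comm (x y : G) : G := x * y * x^-1 * y^-1.

Definition comm_subgroup (A B : set G) : set G :=
  smallest is_subgroup [set comm x y | x in A & y in B].

(* By convention Gamma_0 = Gamma_1 = G, so that the degree 0 quotient
   Gamma_0 / Gamma_1 is trivial. *)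
Fixpoint lcs (k : nat) : set G :=
  match k with
  | 0 | 1 => setT
  | k'.+1 => comm_subgroup setT (lcs k')
  end.

Let gsimp := (@invgM G, @invgK G, @mulgA G, @mulgK G, @mulgVK G, @mulgV G,
  @mulVg G, @mul1g G, @mulg1 G, @invg1 G).

Lemma is_subgroupM H x y : is_subgroup H -> H x -> H y -> H (x * y).
Proof.
move=> [H1 HB] Hx Hy; rewrite -[y]invgK; apply: (HB) => //.
by rewrite -[y^-1]mul1g; apply: HB.
Qed.
Lemma is_subgroupV H x : is_subgroup H -> H x -> H x^-1.
Proof. by move=> [H1 HB] Hx; rewrite -[x^-1]mul1g; apply: HB. Qed.

Lemma comm_subgroupP A B : is_subgroup (comm_subgroup A B).
Proof.
split=> [|x y hx hy]; first by move=> H [[]].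
move=> H hH; have [[_ HB] _] := hH.
by apply: HB; [apply: hx | apply: hy].
Qed.

Lemma mem_comm_subgroup (A B : set G) x y :
  A x -> B y -> comm_subgroup A B (comm x y).
Proof. by move=> Ax By; apply: sub_gen_smallest; exists x => //; exists y. Qed.

Lemma comm_subgroup_sub (A B H : set G) : is_subgroup H ->
  (forall x y, A x -> B y -> H (comm x y)) -> comm_subgroup A B `<=` H.
Proof.
move=> HH AB; apply: smallest_sub => // _ [x Ax [y By <-]]; exact: AB.
Qed.

Lemma lcsP k : is_subgroup (lcs k).
Proof. by case: k => [|[|k]]; [split|split|exact: comm_subgroupP]. Qed.

Lemma lcs1 k : lcs k 1. Proof. by have [] := lcsP k. Qed.
Lemma lcsM k x y : lcs k x -> lcs k y -> lcs k (x * y).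
Proof. exact: is_subgroupM (lcsP k). Qed.
Lemma lcsV k x : lcs k x -> lcs k x^-1.
Proof. exact: is_subgroupV (lcsP k). Qed.

Lemma lcs_conj k x g : lcs k x -> lcs k (g * x * g^-1).
Proof.
elim: k => [|[|k] IHk] // in x g *; move: x.
suff H : lcs k.+2 `<=` [set x | lcs k.+2 (g * x * g^-1)] by exact: H.
apply: comm_subgroup_sub => [|x y _ ky].
  split=> [|x y hx hy] /=; first by rewrite !gsimp; apply: (lcs1 k.+2).
  have := lcsM (k := k.+2) hx (lcsV (k := k.+2) hy).
  by rewrite /comm !gsimp.
change (lcs k.+2 (g * comm x y * g^-1)).
have -> : g * comm x y * g^-1 = comm (g * x * g^-1) (g * y * g^-1).
  by rewrite /comm !gsimp.
by apply: mem_comm_subgroup => //; apply: IHk.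
Qed.

Lemma lcs_comm1 k x y : lcs k y -> lcs k.+1 (comm x y).
Proof. by case: k => [|k] //=; apply: mem_comm_subgroup. Qed.

Lemma lcsS k : lcs k.+1 `<=` lcs k.
Proof.
case: k => [|k] //; apply: comm_subgroup_sub; first exact: lcsP.
by move=> x y _ ky; apply: lcsM; [apply: lcs_conj | apply: lcsV].
Qed.

Lemma commV x y : (comm x y)^-1 = comm y x.
Proof. by rewrite /comm !gsimp. Qed.

Lemma commMl x y z : comm (x * y) z = (x * comm y z * x^-1) * comm x z.
Proof. by rewrite /comm !gsimp. Qed.

Lemma comm_conj g y z :
  comm y (g * z * g^-1) = g * comm (g^-1 * y * g) z * g^-1.
Proof. by rewrite /comm !gsimp. Qed.

Lemma Hall_Witt x y z :
  comm (comm x y) (y * z * y^-1) * comm (comm y z) (z * x * z^-1)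
  * comm (comm z x) (x * y * x^-1) = 1.
Proof. by rewrite /comm !gsimp. Qed.

Lemma lcs_comm i j x y : lcs i x -> lcs j y -> lcs (i + j) (comm x y).
Proof.
elim: i j x y => [|i IHi] j x y ix jy; first exact/lcsS/lcs_comm1.
case: i => [|i] in IHi ix *; first exact: lcs_comm1.
suff H : lcs i.+2 `<=` [set x | forall y, lcs j y -> lcs (i.+2 + j) (comm x y)].
  exact: H.
apply: comm_subgroup_sub => [|{ix jy x y}x y _ iy].
  split=> [z _|a b ha hb z jz]; first by rewrite /comm !gsimp; apply: lcs1.
  rewrite commMl; apply: lcsM; last exact: ha.
  apply: lcs_conj.
  have -> : comm b^-1 z = b^-1 * comm z b * b^-1^-1 by rewrite /comm !gsimp.
  by apply: lcs_conj; rewrite -commV; apply: lcsV; exact: hb.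
move=> z jz; pose z' := y^-1 * z * y^-1^-1.
have jz' : lcs j z' by apply: lcs_conj.
have e : z = y * z' * y^-1 by rewrite /z' !gsimp.
have hw := Hall_Witt x y z'; rewrite -e in hw.
have -> : comm (comm x y) z = (comm (comm z' x) (x * y * x^-1))^-1 *
                              (comm (comm y z') (z' * x * z'^-1))^-1.
  by apply: (@mulIg G (comm (comm y z') (z' * x * z'^-1)));
    apply: (@mulIg G (comm (comm z' x) (x * y * x^-1))); rewrite hw !gsimp.
apply: lcsM; rewrite commV.
  rewrite (_ : (i.+2 + j = i.+1 + j.+1)%N); last by rewrite addnS.
  apply: IHi; first exact: lcs_conj.
  by rewrite -commV; apply: lcsV; apply: lcs_comm1.
by apply: lcs_comm1; apply: IHi.
Qed.

(* The subgroup Gamma_k as a type, and the relation of being congruent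
   modulo Gamma_(k+1) on it. *)
Definition lcs_type k := {x : G | x \in lcs k}.
Definition lcs_rel k (x y : lcs_type k) : bool := (val x)^-1 * val y \in lcs k.+1.

Lemma lcs_val k (x : lcs_type k) : lcs k (val x).
Proof. by have := valP x; rewrite inE. Qed.

Fact lcs_rel_refl k : reflexive (@lcs_rel k).
Proof. by move=> x; rewrite /lcs_rel mulVg inE; apply: lcs1. Qed.
Fact lcs_rel_sym k : symmetric (@lcs_rel k).
Proof.
have sym x y : @lcs_rel k x y -> lcs_rel y x.
  by rewrite /lcs_rel !inE => /lcsV; rewrite !gsimp.
by move=> x y; apply/idP/idP; apply: sym.
Qed.
Fact lcs_rel_trans k : transitive (@lcs_rel k).
Proof.
move=> y x z; rewrite /lcs_rel !inE => xy yz.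
by have := lcsM xy yz; rewrite !gsimp.
Qed.
Canonical lcs_equiv k :=
  EquivRel (@lcs_rel k) (@lcs_rel_refl k) (@lcs_rel_sym k) (@lcs_rel_trans k).

Definition gr k := {eq_quot (@lcs_equiv k)}.
HB.instance Definition _ k := Choice.on (gr k).
HB.instance Definition _ k := EqQuotient.on (gr k).

Fact lcs_one_subproof k : (1 : G) \in lcs k.
Proof. by rewrite inE; apply: lcs1. Qed.
Definition lcs_one k : lcs_type k := exist _ 1 (lcs_one_subproof k).

(* The class of x in Gamma_k / Gamma_(k+1); junk value: the class of 1 when x
   is not in Gamma_k. *)
Definition to_gr k (x : G) : gr k := \pi_(gr k) (insubd (lcs_one k) x).

Definition of_gr k (u : gr k) : G := val (repr u).

Lemma of_grP k (u : gr k) : lcs k (of_gr u).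
Proof. exact: lcs_val. Qed.

Lemma of_grK k (u : gr k) : to_gr k (of_gr u) = u.
Proof. by rewrite /to_gr /of_gr valKd reprK. Qed.

Lemma gr_ex k (u : gr k) : exists2 x, lcs k x & u = to_gr k x.
Proof. by exists (of_gr u); [apply: of_grP | rewrite of_grK]. Qed.

Lemma to_gr_eq k x y : lcs k x -> lcs k y ->
  to_gr k x = to_gr k y <-> lcs k.+1 (x^-1 * y).
Proof.
move=> kx ky; rewrite /to_gr; set u := insubd _ x; set v := insubd _ y.
have [<- <-] : val u = x /\ val v = y.
  by rewrite /u /v !insubdK // inE.
rewrite -[lcs _ _]in_setE -[_ \in _]/(@lcs_equiv k u v); split=> [/eqmodP|e] //.
exact/eqmodP.
Qed.

Lemma of_to_gr k x : lcs k x ->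
  exists2 d, lcs k.+1 d & of_gr (to_gr k x) = x * d.
Proof.
move=> kx; exists (x^-1 * of_gr (to_gr k x)); last by rewrite mulVKg.
by apply/to_gr_eq => //; [exact: of_grP | rewrite of_grK].
Qed.

Definition gr_zero k : gr k := to_gr k 1.
Definition gr_add k (u v : gr k) : gr k := to_gr k (of_gr u * of_gr v).
Definition gr_opp k (u : gr k) : gr k := to_gr k (of_gr u)^-1.

Fact to_gr_mul k x y : lcs k x -> lcs k y ->
  to_gr k (x * y) = gr_add (to_gr k x) (to_gr k y).
Proof.
move=> kx ky; have [d kd ed] := of_to_gr kx; have [e ke ee] := of_to_gr ky.
rewrite /gr_add ed ee; apply/to_gr_eq; first exact: lcsM.
  by do !apply: lcsM => //; apply: lcsS.
have -> : (x * y)^-1 * (x * d * (y * e)) = y^-1 * d * y^-1^-1 * e.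
  by rewrite !gsimp.
by apply: lcsM => //; apply: lcs_conj.
Qed.

Fact gr_addA k : associative (@gr_add k).
Proof.
move=> u v w; have [x kx ->] := gr_ex u; have [y ky ->] := gr_ex v.
have [z kz ->] := gr_ex w.
by rewrite -!to_gr_mul ?mulgA //; apply: lcsM.
Qed.
Fact gr_addC k : commutative (@gr_add k).
Proof.
move=> u v; have [x kx ->] := gr_ex u; have [y ky ->] := gr_ex v.
rewrite -!to_gr_mul //; apply/to_gr_eq; try exact: lcsM.
have -> : (x * y)^-1 * (y * x) = comm y^-1 x^-1 by rewrite /comm !gsimp.
by apply: lcs_comm1; apply: lcsV.
Qed.
Fact gr_add0 k : left_id (gr_zero k) (@gr_add k).
Proof.
move=> u; have [x kx ->] := gr_ex u.
by rewrite -to_gr_mul ?mul1g //; apply: lcs1.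
Qed.
Fact gr_addN k : left_inverse (gr_zero k) (@gr_opp k) (@gr_add k).
Proof.
move=> u; rewrite -{2}[u]of_grK -to_gr_mul ?mulVg //; last exact: of_grP.
exact/lcsV/of_grP.
Qed.
HB.instance Definition _ k := GRing.isZmodule.Build (gr k)
  (@gr_addA k) (@gr_addC k) (@gr_add0 k) (@gr_addN k).

Lemma to_gr1 k : to_gr k 1 = 0%R. Proof. by []. Qed.
Lemma to_grM k x y : lcs k x -> lcs k y ->
  to_gr k (x * y) = (to_gr k x + to_gr k y)%R.
Proof. exact: to_gr_mul. Qed.
Lemma to_grV k x : lcs k x -> to_gr k x^-1 = (- to_gr k x)%R.
Proof.
move=> kx; apply: (addIr (to_gr k x)).
by rewrite addNr -to_grM ?mulVg //; apply: lcsV.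
Qed.
Lemma to_gr_lcsS k x : lcs k.+1 x -> to_gr k x = 0%R.
Proof.
move=> kx; rewrite -to_gr1; apply/esym/to_gr_eq; first exact: lcs1.
  exact: lcsS.
by rewrite invg1 mul1g.
Qed.
Lemma to_gr_conj k g x : lcs k x -> to_gr k (g * x * g^-1) = to_gr k x.
Proof.
move=> kx; have -> : g * x * g^-1 = comm g x * x by rewrite /comm !gsimp.
have kc := lcs_comm1 g kx.
by rewrite to_grM // ?(to_gr_lcsS kc) ?add0r //; apply: lcsS.
Qed.

Lemma gr0_trivial (u : gr 0) : u = 0%R.
Proof. by have [x _ ->] := gr_ex u; apply: to_gr_lcsS. Qed.

Definition gr_lie i j k (u : gr i) (v : gr j) : gr k :=
  to_gr k (comm (of_gr u) (of_gr v)).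

Lemma to_gr_comm_eq i j k x y d : (i + j = k)%N ->
  lcs i x -> lcs j y -> lcs i.+1 d ->
  to_gr k (comm (x * d) y) = to_gr k (comm x y).
Proof.
move=> <- ix jy id; rewrite commMl.
have h := lcs_comm id jy.
rewrite to_grM ?to_gr_conj ?(to_gr_lcsS h) ?add0r //.
- exact: lcsS.
- by apply: lcs_conj; apply: lcsS.
- exact: lcs_comm.
Qed.

Lemma to_gr_commC i j k x y : (i + j = k)%N -> lcs i x -> lcs j y ->
  to_gr k (comm x y) = (- to_gr k (comm y x))%R.
Proof. by move=> <- ix jy; rewrite -to_grV ?commV // addnC; apply: lcs_comm. Qed.

(* The bracket is induced by the commutator map. *)
Lemma gr_lieE i j k x y : (i + j = k)%N -> lcs i x -> lcs j y ->
  gr_lie k (to_gr i x) (to_gr j y) = to_gr k (comm x y).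
Proof.
move=> ijk ix jy; rewrite /gr_lie.
have [d jd ed] := of_to_gr ix; have [e je ee] := of_to_gr jy.
have jye : lcs j (y * e) by apply: lcsM => //; apply: lcsS.
have jik : (j + i = k)%N by rewrite addnC.
rewrite ed ee (to_gr_comm_eq ijk) // (to_gr_commC ijk) //.
by rewrite (to_gr_comm_eq jik) // -(to_gr_commC ijk).
Qed.

Fact gr_lieDl i j k : (i + j = k)%N -> forall (x y : gr i) (z : gr j),
  gr_lie k (x + y)%R z = (gr_lie k x z + gr_lie k y z)%R.
Proof.
move=> ijk u v w; have [x ix ->] := gr_ex u; have [y iy ->] := gr_ex v.
have [z jz ->] := gr_ex w; have ixy := lcsM ix iy.
rewrite -to_grM // !gr_lieE // commMl; subst k.
rewrite to_grM ?to_gr_conj 1?addrC //; try exact: lcs_comm.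
by apply: lcs_conj; apply: lcs_comm.
Qed.
Fact gr_lieC i j k : (i + j = k)%N -> forall (x : gr i) (y : gr j),
  gr_lie k x y = (- gr_lie k y x)%R.
Proof.
move=> ijk u v; have [x ix ->] := gr_ex u; have [y jy ->] := gr_ex v.
rewrite !gr_lieE //; first exact: to_gr_commC ijk _ _.
by rewrite addnC.
Qed.
Fact gr_lieDr i j k : (i + j = k)%N -> forall (x : gr i) (y z : gr j),
  gr_lie k x (y + z)%R = (gr_lie k x y + gr_lie k x z)%R.
Proof.
move=> ijk x y z; have jik : (j + i = k)%N by rewrite addnC.
by rewrite !(gr_lieC ijk x) gr_lieDl // opprD.
Qed.
Fact gr_liexx i k : (i + i = k)%N -> forall x : gr i, gr_lie k x x = 0%R.
Proof.
by move=> iik u; rewrite /gr_lie /comm mulgK mulgV.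
Qed.
Fact gr_lieJ i j l k : (i + j + l = k)%N ->
  forall (x : gr i) (y : gr j) (z : gr l),
  (gr_lie k (gr_lie (i + j)%N x y) z + gr_lie k (gr_lie (j + l)%N y z) x
   + gr_lie k (gr_lie (l + i)%N z x) y = 0)%R.
Proof.
move=> e1 u v w; have [x ix ->] := gr_ex u; have [y jy ->] := gr_ex v.
have [z lz ->] := gr_ex w.
have e2 : (j + l + i = k)%N by rewrite -e1 addnC addnA.
have e3 : (l + i + j = k)%N by rewrite -e1 -addnA addnC.
rewrite !(@gr_lieE _ _ _ _ _ erefl) //.
rewrite -(to_gr_conj y lz) -(to_gr_conj z ix) -(to_gr_conj x jy).
have [ix' jy' lz'] :=
  And3 (lcs_conj z ix) (lcs_conj x jy) (lcs_conj y lz).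
have [cxy cyz czx] :=
  And3 (lcs_comm ix jy) (lcs_comm jy lz) (lcs_comm lz ix).
rewrite !gr_lieE // -!to_grM ?Hall_Witt //.
- by apply: lcsM; [rewrite -e1|rewrite -e2]; apply: lcs_comm.
- by rewrite -e3; apply: lcs_comm.
- by rewrite -e1; apply: lcs_comm.
- by rewrite -e2; apply: lcs_comm.
Qed.

Definition lcs_lie := dsum gr.
HB.instance Definition _ := GRing.Zmodule.on lcs_lie.
HB.instance Definition _ := isLieRing.Build lcs_lie
  (dsum_lieDl gr_lieDl gr_lieDr) (dsum_lieDr gr_lieDl gr_lieDr)
  (dsum_liexx gr_lieDl gr_lieDr gr_liexx gr_lieC)
  (dsum_jacobi gr_lieDl gr_lieDr gr_lieJ).
HB.instance Definition _ := isGradedLie.Build lcs_lie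
  (@dsum_homog0 gr) (@dsum_homogB gr)
  (dsum_lie_homog gr_lieDl gr_lieDr)
  (@dsum_homog_span gr) (@dsum_homog_indep gr).

Definition lcs_class k (x : G) : lcs_lie := dsum_inj (to_gr k x).

End LowerCentralSeries.

Section GeneralLinear.
Variables (R : comUnitRingType) (n : nat).

Record GL := MkGL { GL_mx :> 'M[R]_n; _ : GL_mx \in unitmx }.
HB.instance Definition _ := [isSub for GL_mx].
HB.instance Definition _ := [Choice of GL by <:].

Lemma GL_unit (A : GL) : (A : 'M[R]_n) \in unitmx. Proof. exact: valP. Qed.

Fact GL_one_subproof : (1%:M : 'M[R]_n) \in unitmx.
Proof. exact: unitmx1. Qed.
Fact GL_inv_subproof (A : GL) : invmx A \in unitmx.
Proof. by rewrite unitmx_inv GL_unit. Qed.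
Fact GL_mul_subproof (A B : GL) : A *m B \in unitmx.
Proof. by rewrite unitmx_mul !GL_unit. Qed.
Definition GL_one := MkGL GL_one_subproof.
Definition GL_inv A := MkGL (GL_inv_subproof A).
Definition GL_mul A B := MkGL (GL_mul_subproof A B).

Fact GL_mulA : associative GL_mul.
Proof. by move=> A B C; apply/val_inj/mulmxA. Qed.
Fact GL_mul1 : left_id GL_one GL_mul.
Proof. by move=> A; apply/val_inj/mul1mx. Qed.
Fact GL_mul1r : right_id GL_one GL_mul.
Proof. by move=> A; apply/val_inj/mulmx1. Qed.
Fact GL_mulV : left_inverse GL_one GL_inv GL_mul.
Proof. by move=> A; apply/val_inj/mulVmx/GL_unit. Qed.
Fact GL_mulVr : right_inverse GL_one GL_inv GL_mul.
Proof. by move=> A; apply/val_inj/mulmxV/GL_unit. Qed.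
HB.instance Definition _ :=
  isGroup.Build GL GL_mulA GL_mul1 GL_mul1r GL_mulV GL_mulVr.

End GeneralLinear.

Section Congruence.
Variables (n q : nat).

Definition red_mod (A : 'M[int]_n) : 'M['Z_q]_n := map_mx intr A.

(* GL_n(qZ), the kernel of reduction modulo q on GL_n(Z). *)
Definition in_congr : {pred GL int n} := fun A => red_mod A == 1%:M.
Record congr_GL := MkCongr { congr_val :> GL int n; _ : in_congr congr_val }.
HB.instance Definition _ := [isSub for congr_val].
HB.instance Definition _ := [Choice of congr_GL by <:].

Fact in_congr_group_closed : group_closed in_congr.
Proof.
split=> [|A B]; rewrite !unfold_in /red_mod; first by rewrite map_mx1.
move=> /eqP A1 /eqP B1; rewrite map_mxM A1 mul1mx -[X in X == _]mul1mx -{1}B1.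
by rewrite -map_mxM mulmxV ?GL_unit // map_mx1.
Qed.
HB.instance Definition _ :=
  SubChoice_isSubGroup.Build (GL int n) in_congr congr_GL in_congr_group_closed.

End Congruence.

Section SlPoly.
Variables (n q : nat).
Local Notation M := 'M['Z_q]_n.+1.

(* Elements of positive degree of sl_(n.+1)(Z/q)[t]; the matrices have size n.+1
   because {poly _} requires a nontrivial coefficient ring. *)
Definition in_sl_poly_pos : {pred {poly M}} :=
  fun p => `[< (forall i, \tr (p`_i) = 0) /\ p`_0 = 0 >].

Record sl_poly_pos :=
  MkSlPoly { sl_poly_val :> {poly M}; _ : in_sl_poly_pos sl_poly_val }.
HB.instance Definition _ := [isSub for sl_poly_val].
HB.instance Definition _ := [Choice of sl_poly_pos by <:].

Lemma sl_polyP (p : sl_poly_pos) :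
  (forall i, \tr ((p : {poly M})`_i) = 0) /\ (p : {poly M})`_0 = 0.
Proof. by apply/asboolP; exact: (valP p). Qed.

Fact in_sl_poly_zmod_closed : zmod_closed in_sl_poly_pos.
Proof.
split; first by apply/asboolP; split=> [i|]; rewrite coef0 ?mxtrace0.
move=> p r /asboolP[pt p0] /asboolP[rt r0]; apply/asboolP; split=> [i|].
  by rewrite coefB linearB /= pt rt subr0.
by rewrite coefB p0 r0 subr0.
Qed.
HB.instance Definition _ := GRing.SubChoice_isSubZmodule.Build
  {poly M} in_sl_poly_pos sl_poly_pos in_sl_poly_zmod_closed.

(* As 'X is central in {poly M}, the bracket of M t^i and N t^j is
   (M N - N M) t^(i + j). *)
Fact sl_lie_subproof (p r : sl_poly_pos) :
  in_sl_poly_pos (sl_poly_val p * sl_poly_val r - sl_poly_val r * sl_poly_val p).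
Proof.
have [[_ p0] [_ r0]] := (sl_polyP p, sl_polyP r).
apply/asboolP; split=> [i|]; last first.
  by rewrite coefB !coef0M p0 r0 mulr0 subr0.
rewrite coefB coefM coefMr -sumrB linear_sum big1 //= => j _.
by rewrite linearB /= mxtrace_mulC subrr.
Qed.
Definition sl_lie p r := MkSlPoly (sl_lie_subproof p r).

Fact sl_lieDl p r s : sl_lie (p + r) s = sl_lie p s + sl_lie r s.
Proof. by apply: val_inj; rewrite /= mulrDl mulrDr opprD addrACA. Qed.
Fact sl_lieDr p r s : sl_lie p (r + s) = sl_lie p r + sl_lie p s.
Proof. by apply: val_inj; rewrite /= mulrDl mulrDr opprD addrACA. Qed.
Fact sl_liexx p : sl_lie p p = 0.
Proof. by apply: val_inj; rewrite /= subrr. Qed.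
Fact sl_jacobi p r s :
  sl_lie (sl_lie p r) s + sl_lie (sl_lie r s) p + sl_lie (sl_lie s p) r = 0.
Proof.
apply: val_inj => /=; move: (val p) (val r) (val s) => a b c.
rewrite !mulrBl !mulrBr !mulrA !opprB.
move: (a * b * c) (b * a * c) (c * a * b) (c * b * a) (b * c * a) (a * c * b).
move=> u v w x y z.
rewrite [LHS](AC ((2*2)*(2*2)*(2*2))
  ((1*8)*(2*11)*(3*6)*(4*9)*(5*12)*(7*10)))%AC /=.
by rewrite !(subrr, addNr, addr0).
Qed.
HB.instance Definition _ :=
  isLieRing.Build sl_poly_pos sl_lieDl sl_lieDr sl_liexx sl_jacobi.

Definition sl_homog d (p : sl_poly_pos) : Prop :=
  forall k, k != d -> (p : {poly M})`_k = 0.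

Fact sl_homog0 d : sl_homog d 0.
Proof. by move=> k _; rewrite coef0. Qed.
Fact sl_homogB d p r : sl_homog d p -> sl_homog d r -> sl_homog d (p - r).
Proof. by move=> hp hr k kd; rewrite coefB hp // hr // subr0. Qed.
Fact sl_homog_lie d e p r :
  sl_homog d p -> sl_homog e r -> sl_homog (d + e)%N (lie p r).
Proof.
move=> hp hr k kde; rewrite coefB.
have E (a b : sl_poly_pos) f g : sl_homog f a -> sl_homog g b ->
    (f + g)%N != k -> (sl_poly_val a * sl_poly_val b)`_k = 0.
  move=> ha hb fg; rewrite coefM big1 // => i _.
  have [ie|/ha ->] := eqVneq (i : nat) f; last by rewrite mul0r.
  rewrite hb ?mulr0 //; apply: contra fg => /eqP <-.
  by rewrite -ie subnKC // -ltnS.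
rewrite (E p r d e) 1?eq_sym // (E r p e d) ?subrr //.
by rewrite addnC eq_sym.
Qed.

Fact sl_mono_subproof (p : sl_poly_pos) i :
  in_sl_poly_pos (p`_i *: 'X^i).
Proof.
have [pt p0] := sl_polyP p; apply/asboolP; split=> [k|].
  rewrite coefZ coefXn; case: eqP => _; last by rewrite mulr0 mxtrace0.
  by rewrite mulr1 pt.
by rewrite coefZ coefXn; case: i => [|i]; rewrite ?p0 ?mul0r ?mulr0.
Qed.
Fact sl_homog_span p : exists (N : nat) (c : nat -> sl_poly_pos),
  (forall i, sl_homog i (c i)) /\ p = \sum_(i < N) c i.
Proof.
exists (size p), (fun i => MkSlPoly (sl_mono_subproof p i)); split=> [i k ki|].
  by rewrite /= coefZ coefXn (negPf ki) mulr0.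
by apply: val_inj; rewrite raddf_sum /= -[LHS]coefK poly_def.
Qed.
Fact sl_homog_indep (N : nat) (c : nat -> sl_poly_pos) :
    (forall i, sl_homog i (c i)) -> \sum_(i < N) c i = 0 ->
  forall i, (i < N)%N -> c i = 0.
Proof.
move=> hc s0 i iN; apply/val_inj/polyP => k; rewrite /= coef0.
have [->|ki] := eqVneq k i; last exact: hc.
have := congr1 (fun p : sl_poly_pos => (val p)`_i) s0.
rewrite raddf_sum /= coef_sum coef0 (bigD1 (Ordinal iN)) //= big1 ?addr0 // => j.
by rewrite -val_eqE /= eq_sym => ji; apply: hc.
Qed.
HB.instance Definition _ := isGradedLie.Build sl_poly_pos
  sl_homog0 sl_homogB sl_homog_lie sl_homog_span sl_homog_indep.

End SlPoly.

(* Main.v *)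
(* Write H_k for the group of matrices congruent to 1 modulo q^k; since q >= 3
   they have determinant 1.  A commutator of 1 + q^i X and 1 + q^j Y is
   1 + q^(i+j) (XY - YX) modulo q^(i+j+1), so Gamma_k is contained in H_k, and
   1 + q^k M |-> M mod q identifies H_k / H_(k+1) with trace-zero matrices.  The
   point is the reverse inclusion.  Gamma_k is normal in GL_N(Z) and contains
   the elementary matrices x_ij(q^k), so it suffices to show that a normal
   subgroup K of GL_N(Z) containing all x_ij(m) contains every matrix that is 1
   modulo m (the congruence subgroup theorem).

   Modulo K such a matrix can be moved into a 2 x 2 block, and hence is a word
   in x_12 and x_21.  In GL_3(Z) / K the elementary matrices satisfy the
   Steinberg relations over Z/m, which decomposes by the Chinese remainder
   theorem into commuting families over the local rings Z/p^e.  Over a local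
   ring a Bruhat normal form reduces the claim to the triviality of the
   symbols {u, v}, that is, to the generation of K_2(Z/m) by {-1, -1}.  For
   odd p this follows from the cyclicity of the units and {u, 1 - u} = 1; for
   p = 2 a further relation gives {5, -1} = 1, while {-1, -1} = 1 because the
   Weyl element of SL_2(Z) has order 4. *)
From HB Require Import structures.
Require Import Defs.
From mathcomp Require Import all_boot all_order all_algebra.
From mathcomp Require Import all_fingroup all_solvable.
From mathcomp Require Import generic_quotient boolp classical_sets.
From mathcomp Require Import ring zify.

Set Implicit Arguments.
Unset Strict Implicit.
Unset Printing Implicit Defensive.

Import GRing.Theory.
Local Open Scope ring_scope.

(** The third index is essential. For SL_2(Z) the analogous statement about normal subgroups is
    false, and the Steinberg relations say nothing directly about the opposite pair x_12, x_21; what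
    is known about such a pair comes from writing one of the two as a commutator through the third
    index. So the words have 2 x 2 matrices but are evaluated in GL_3(Z) / K. A lift of the diagonal
    matrices is multiplicative only up to symbols, which are central because diagonal matrices
    commute. Once the symbols vanish, a word depends only on its matrix, provided that every
    unimodular pair contains a unit: hence the passage to local rings. The obstacle is {-1, -1}. It
    is nontrivial in K_2(Z/4), so for e >= 2 no computation with the Steinberg relations over Z/2^e
    removes it. The relation w^4 = 1 has to be imported from GL_3(Z) and to survive the
    decomposition into local factors. It does, because the odd part already satisfies it. *)

Section CommutatorIdentities.
Variable gT : groupType.
Local Open Scope group_scope.
Implicit Types a b c z : gT.

Lemma comm_cenl z a b : commute z a -> commute z b -> comm (z * a) b = comm a b.
Proof.
move=> za zb; rewrite commMl (_ : comm z b = 1) ?mulg1; last first.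
  by rewrite /comm zb !gnorm.
have zab : commute z (comm a b).
  by apply: commuteM; [apply: commuteM; [apply: commuteM | apply: commuteV] | apply: commuteV].
by rewrite zab mulgK.
Qed.
End CommutatorIdentities.

(** * Steinberg relations and symbols *)

(* The relations of the elementary 3 x 3 matrices, stated with the right
   conjugation x ^ y = y^-1 * x * y. *)
Record steinberg (gT : groupType) (R : comUnitRingType)
    (x : 'I_3 -> 'I_3 -> R -> gT) : Prop := Steinberg {
  stD : forall i j a b, i != j -> x i j (a + b) = (x i j a * x i j b)%g;
  stC : forall i j k l a b, i != j -> k != l -> j != k -> i != l ->
    (x i j a ^ x k l b = x i j a)%g;
  stS : forall i j k a b, i != j -> j != k -> i != k ->
    (x i j a ^ x j k b = x i j a * x i k (a * b)%R)%g
}.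

Section SteinbergTheory.
Variables (gT : groupType) (R : comUnitRingType) (x : 'I_3 -> 'I_3 -> R -> gT).
Hypothesis st : steinberg x.
Implicit Types (i j k l : 'I_3) (a b c : R).

Lemma st0 i j : i != j -> x i j 0 = 1%g.
Proof. by move=> ij; apply: (mulgI (x i j 0)); rewrite -stD // addr0 mulg1. Qed.

Lemma stN i j a : i != j -> x i j (- a) = (x i j a)^-1%g.
Proof.
by move=> ij; apply: (mulgI (x i j a)); rewrite -stD // subrr st0 // mulgV.
Qed.

(** The mirror image of [stS]: x_ij and x_jk both commute with x_ik, so the commutation rule can be
    solved for the other conjugate. *)
Lemma stS' i j k a b : i != j -> j != k -> i != k ->
  (x j k b ^ x i j a = x j k b * x i k (- (a * b))%R)%g.
Proof.
move=> ij jk ik; have := stS st a b ij jk ik; rewrite !conjgE => e.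
have cik : (x i j a * x i k (a * b)%R = x i k (a * b)%R * x i j a)%g.
  have := stC st a (a * b) ij ik; rewrite eq_sym => /(_ ij ik).
  by rewrite conjgE => {2}<-; rewrite mulVKg.
have cjk : (x j k b * x i k (a * b)%R = x i k (a * b)%R * x j k b)%g.
  have := stC st b (a * b) jk ik; rewrite eq_sym => /(_ ik jk).
  by rewrite conjgE => {2}<-; rewrite mulVKg.
apply: (mulgI (x i j a)); rewrite mulVKg stN //.
have {}e : (x i j a * x j k b = x j k b * x i j a * x i k (a * b)%R)%g.
  by rewrite -(mulgA (x j k b)) -e mulVKg.
apply: (mulIg (x i k (a * b)%R)); by rewrite !mulgA mulgVK e.
Qed.


Lemma stCC i j k l a b : i != j -> k != l -> j != k -> i != l ->
  commute (x i j a) (x k l b).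
Proof. by move=> ij kl jk il; apply/commgP/conjg_fixP; rewrite stC. Qed.

(* [locked] keeps [mulgA] and the like from seeing through the product. *)
Definition weyl i j (u : R) : gT :=
  locked (x i j u * x j i (- u^-1)%R * x i j u)%g.

Lemma weylE i j u : weyl i j u = (x i j u * x j i (- u^-1)%R * x i j u)%g.
Proof. by rewrite /weyl -lock. Qed.

Lemma weylV i j u : i != j -> (weyl i j u)^-1%g = weyl i j (- u).
Proof.
move=> ij; rewrite !weylE !invgM invrN -!stN ?opprK ?mulgA //.
by rewrite eq_sym.
Qed.

Section Distinct.
Variables (i j k : 'I_3).
Hypotheses (ij : i != j) (ik : i != k) (jk : j != k).
Let ji : j != i. Proof. by rewrite eq_sym. Qed.
Let ki : k != i. Proof. by rewrite eq_sym. Qed.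
Let kj : k != j. Proof. by rewrite eq_sym. Qed.
Variable u : R.
Hypothesis uU : u \is a GRing.unit.

Let uV : u * u^-1 = 1. Proof. exact: divrr. Qed.
Let uaV a : u * (u^-1 * a) = a. Proof. exact: mulVKr. Qed.
Let uVa a : u^-1 * (u * a) = a. Proof. exact: mulKr. Qed.

(** [weyl i j u] lifts the monomial matrix [0, u; -1/u, 0] in rows i and j, and these four rules are
    conjugation by that matrix. On the way through its three factors two opposite terms in one
    position cancel. *)
Lemma weyl_ik a : (x i k a ^ weyl i j u = x j k (u^-1 * a)%R)%g.
Proof.
rewrite weylE !conjgM stC // stS' // mulNr opprK conjMg stC // stS' // uaV.
rewrite (stCC _ _ jk ik) 1?eq_sym // mulgA -stD //.
by rewrite subrr st0 // mul1g.
Qed.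

Lemma weyl_jk a : (x j k a ^ weyl i j u = x i k (- (u * a))%R)%g.
Proof.
rewrite weylE conjgM conjgM stS' // conjMg stC // stS' // mulrNN uVa.
rewrite (stCC _ _ ik jk) 1?eq_sym // mulgA -stD // subrr st0 // mul1g.
by rewrite stC.
Qed.

Lemma weyl_ki a : (x k i a ^ weyl i j u = x k j (u * a)%R)%g.
Proof.
rewrite weylE conjgM conjgM stS // conjMg stC // stS //.
rewrite mulrN mulrK // (mulrC a).
rewrite (stCC _ _ kj ki) // mulgA -stD // subrr st0 // mul1g.
by rewrite stC.
Qed.

Lemma weyl_kj a : (x k j a ^ weyl i j u = x k i (- (u^-1 * a))%R)%g.
Proof.
rewrite weylE !conjgM stC // stS // conjMg stC // stS //.
rewrite mulrN mulNr (mulrC _ u) (mulrC a) uaV.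
rewrite (stCC _ _ ki kj) // mulgA -stD // subrr st0 // mul1g.
by [].
Qed.

End Distinct.

Lemma ord3_third (i j : 'I_3) : exists k, (i != k) && (j != k).
Proof.
by case: i j => [[|[|[|//]]] ?] [[|[|[|//]]] ?];
  first [by exists ord0 | by exists (lift ord0 ord0) | by exists ord_max].
Qed.

(** No Steinberg relation conjugates x_ij by x_ji. Hence x_ij(a) is written as a commutator of
    x_ik(a) and x_kj(1), whose conjugates are known. *)
Lemma weyl_ij i j u a : i != j -> u \is a GRing.unit ->
  (x i j a ^ weyl i j u = x j i (- (u ^- 2 * a))%R)%g.
Proof.
move=> ij uU; have [k /andP[ik jk]] := ord3_third i j.
have [ji ki kj] : [/\ j != i, k != i & k != j] by split; rewrite eq_sym.
have e : (x i j a = (x i k a)^-1 * x i k a ^ x k j 1%R)%g.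
  by rewrite stS // mulr1 mulKg.
rewrite {1}e conjMg conjVg conjJg (weyl_ik ij) // (weyl_kj ij) // stS // mulKg.
by congr (x _ _ _); rewrite -exprVn; ring.
Qed.

Lemma weyl_ji i j u a : i != j -> u \is a GRing.unit ->
  (x j i a ^ weyl i j u = x i j (- (u ^+ 2 * a))%R)%g.
Proof.
move=> ij uU; have [k /andP[ik jk]] := ord3_third i j.
have [ji ki kj] : [/\ j != i, k != i & k != j] by split; rewrite eq_sym.
have e : (x j i a = (x j k a)^-1 * x j k a ^ x k i 1%R)%g.
  by rewrite stS // mulr1 mulKg.
rewrite {1}e conjMg conjVg conjJg (weyl_jk ij) // (weyl_ki ij) // stS // mulKg.
by congr (x _ _ _); rewrite mulr1; ring.
Qed.

(** A Weyl element is fixed by conjugation by itself, while [weyl_ij] and [weyl_ji] compute that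
    conjugate with i and j exchanged. *)
Lemma weyl_sym i j u : i != j -> u \is a GRing.unit ->
  weyl j i u = weyl i j (- u^-1).
Proof.
move=> ij uU; have ji : j != i by rewrite eq_sym.
have e : weyl i j (- u^-1) = (weyl i j (- u^-1) ^ weyl i j (- u^-1))%g.
  by rewrite conjgE mulKg.
rewrite e [X in (X ^ _)%g]weylE !conjMg weyl_ij ?weyl_ji ?unitrN ?unitrV //.
have uV := divrr uU.
rewrite weylE; congr (x _ _ _ * x _ _ _ * x _ _ _)%g;
  by rewrite ?invrN -?exprVn ?invrN ?invrK; ring: uV.
Qed.

Lemma st_weyl i j u : i != j -> u \is a GRing.unit ->
  x i j u = (x j i u^-1 * weyl i j u * x j i u^-1)%g.
Proof.
move=> ij uU; have ji : j != i by rewrite eq_sym.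
have <- : weyl j i (- u^-1) = weyl i j u.
  by rewrite weyl_sym ?unitrN ?unitrV // invrN invrK opprK.
by rewrite weylE invrN opprK invrK !stN // !mulgA mulgV mul1g mulgVK.
Qed.

Lemma st_weyl_opp i j u : i != j -> u \is a GRing.unit ->
  x j i u = (x i j u^-1 * weyl i j (- u^-1)%R * x i j u^-1)%g.
Proof.
move=> ij uU.
by rewrite weylE invrN opprK invrK !stN // !mulgA mulgV mul1g mulgVK.
Qed.

Lemma st_weylC i j u a : i != j -> u \is a GRing.unit ->
  (x i j a * weyl i j u = weyl i j u * x j i (- (u ^- 2 * a))%R)%g.
Proof. by move=> ij uU; rewrite conjgC weyl_ij. Qed.

Lemma st_weylC' i j u a : i != j -> u \is a GRing.unit ->
  (x j i a * weyl i j u = weyl i j u * x i j (- (u ^+ 2 * a))%R)%g.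
Proof. by move=> ij uU; rewrite conjgC weyl_ji. Qed.

(* In terms of matrices, [1, 0; d, 1] [1, c; 0, 1] is upper * diagonal * lower
   as soon as its entry P = 1 + d c is a unit. *)
Lemma exchange_r i j d c P : i != j -> P = 1 + d * c ->
  P \is a GRing.unit -> c \is a GRing.unit ->
  (x j i d * x i j c)%g =
  (x i j (c / P)%R * (weyl i j (- (c / P)) * weyl i j c) * x j i (d / P)%R)%g.
Proof.
move=> ij eP PU cU; have ji : j != i by rewrite eq_sym.
have [PV cV] := (divrr PU, divrr cU).
have dc : d * c = P - 1 by rewrite eP; ring.
(* Trading x_ij(c) for a Weyl element puts x_ji(1/c) next to x_ji(d); the merged argument is a unit,
   so it can be traded in turn. *)
have e : d + c^-1 = P / c.
  by apply: (mulIr cU); rewrite divrK // mulrDl mulVr // dc subrK.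
rewrite {1}(st_weyl ij cU) !mulgA -stD // e (st_weyl_opp ij); last first.
  by rewrite unitrM PU unitrV.
rewrite invrM ?unitrV // invrK.
rewrite -!mulgA; congr (_ * (_ * _))%g; rewrite mulgA st_weylC // -mulgA.
congr (_ * _)%g; rewrite -stD //; congr (x _ _ _).
rewrite -exprVn; have -> : d = (P - 1) / c by rewrite -dc mulrK.
ring: cV PV.
Qed.

Lemma exchange_l i j d c P : i != j -> P = 1 + d * c ->
  P \is a GRing.unit -> d \is a GRing.unit ->
  (x j i d * x i j c)%g =
  (x i j (c / P)%R * (weyl i j (- d^-1) * weyl i j (P / d)) * x j i (d / P)%R)%g.
Proof.
move=> ij eP PU dU; have ji : j != i by rewrite eq_sym.
have [PV dV] := (divrr PU, divrr dU).
have dc : d * c = P - 1 by rewrite eP; ring.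
have PdU : P / d \is a GRing.unit by rewrite unitrM PU unitrV.
have e : d^-1 + c = P / d.
  by apply: (mulIr dU); rewrite divrK // mulrDl mulVr // (mulrC c) dc addrC subrK.
rewrite {1}(st_weyl_opp ij dU) -!mulgA -stD // e (st_weyl ij PdU) !mulgA.
have Pd : (P / d)^-1 = d / P by rewrite invrM ?unitrV // invrK.
have f : d / P = - ((- d^-1) ^- 2 * (- (d^-1 / P))).
  by rewrite -exprVn invrN invrK; ring: dV.
rewrite -(mulgA _ (weyl i j (- d^-1)%R)) Pd {1}f -st_weylC ?unitrN ?unitrV // !mulgA -stD //.
congr (x _ _ _ * _ * _ * _)%g.
have -> : c = (P - 1) / d by rewrite -dc mulrC mulKr.
ring: PV.
Qed.

(** A lift of the diagonal matrix with u at i and 1/u at j; [wt] gives its diagonal entries. *)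
Definition tor i j u := locked (weyl i j u * weyl i j (- 1))%g.

Lemma torE i j u : tor i j u = (weyl i j u * weyl i j (- 1))%g.
Proof. by rewrite /tor -lock. Qed.

Definition wt i j u k : R := if k == i then u else if k == j then u^-1 else 1.


Lemma weylJ i j u v : i != j -> u \is a GRing.unit -> v \is a GRing.unit ->
  (weyl i j v ^ weyl i j u)%g = weyl j i (- (u ^- 2 * v)).
Proof.
move=> ij uU vU; have ji : j != i by rewrite eq_sym.
have [uV vV] := (divrr uU, divrr vU).
rewrite [in LHS]weylE !conjMg weyl_ij ?weyl_ji ?unitrN ?unitrV //.
rewrite !weylE; congr (x _ _ _ * x _ _ _ * x _ _ _)%g.
by rewrite !invrN invrM ?unitrV ?unitrX // invrK; ring.
Qed.

Lemma torJ i j u k l a : i != j -> u \is a GRing.unit -> k != l ->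
  (x k l a ^ tor i j u = x k l ((wt i j u k)^-1 * wt i j u l * a)%R)%g.
Proof.
move=> ij uU kl; rewrite torE conjgM /wt.
have [m /andP[im jm]] := ord3_third i j.
have [mi mj ji] : [/\ m != i, m != j & j != i] by split; rewrite eq_sym.
have N1U : (-1 : R) \is a GRing.unit by rewrite unitrN1.
have m3 l' : [|| l' == i, l' == j | l' == m].
  by move: i j m l' ij im jm {kl mi mj ji k l}; do 4 case=> [[|[|[|//]]] ?].
case/or3P: (m3 k) kl => /eqP ->; case/or3P: (m3 l) => /eqP -> //; rewrite ?eqxx //.
all: rewrite ?(negPf mi) ?(negPf mj) ?(negPf ji) ?eqxx ?(negPf ij) ?(negPf im) ?(negPf jm) //.
all: rewrite ?(weyl_ij, weyl_ji, weyl_ik ij im jm, weyl_jk ij im jm, weyl_ki ij im jm, weyl_kj ij im jm) //.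
all: move=> _; congr (x _ _ _).
all: by rewrite -?exprVn ?invrN ?invr1 ?invrK; ring.
Qed.

Lemma wt_unit i j u k : u \is a GRing.unit -> wt i j u k \is a GRing.unit.
Proof. by move=> uU; rewrite /wt; case: ifP => // _; case: ifP; rewrite ?unitrV ?unitr1. Qed.

Lemma torVJ i j u k l a : i != j -> u \is a GRing.unit -> k != l ->
  (x k l a ^ (tor i j u)^-1 = x k l (wt i j u k * (wt i j u l)^-1 * a)%R)%g.
Proof.
move=> ij uU kl; apply: (conjg_inj (tor i j u)); rewrite conjgKV torJ //.
have [kV lV] := (divrr (wt_unit i j k uU), divrr (wt_unit i j l uU)).
by congr (x _ _ _); ring: kV lV.
Qed.

Definition cen (z : gT) := forall k l a, k != l -> commute z (x k l a).

Lemma cen_weyl z i j u : cen z -> i != j -> commute z (weyl i j u).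
Proof. by move=> zC ij; rewrite weylE; do !apply: commuteM; apply: zC; rewrite // eq_sym. Qed.

Lemma cen_tor z i j u : cen z -> i != j -> commute z (tor i j u).
Proof. by move=> zC ij; rewrite torE; apply: commuteM; apply: cen_weyl. Qed.

Lemma cen_comm z i j k u v : cen z -> i != j -> i != k ->
  commute z (comm (tor i j u) (tor i k v)).
Proof.
move=> zC ij ik; have [zu zv] := (cen_tor u zC ij, cen_tor v zC ik).
exact: commuteM (commuteM (commuteM zu zv) (commuteV zu)) (commuteV zv).
Qed.

(** Conjugation by either factor scales the argument of x_mn by a ratio of diagonal entries;
    scalings commute, so the commutator scales by 1. *)
Lemma cen_comm_tor i j k l u v : i != j -> k != l ->
  u \is a GRing.unit -> v \is a GRing.unit -> cen (comm (tor i j u) (tor k l v)).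
Proof.
move=> ij kl uU vU m n a mn; apply/commute_sym/commgP/conjg_fixP.
rewrite /comm 3!conjgM torJ // torJ // torVJ // torVJ //.
have [muV nuV] := (divrr (wt_unit i j m uU), divrr (wt_unit i j n uU)).
have [mvV nvV] := (divrr (wt_unit k l m vU), divrr (wt_unit k l n vU)).
by congr (x _ _ _); ring: muV nuV mvV nvV.
Qed.


Lemma tor_divg i j u v : i != j ->
  (tor i j u * (tor i j v)^-1)%g = (weyl i j u * weyl i j (- v)%R)%g.
Proof.
by move=> ij; rewrite !torE invgM mulgA mulgK weylV.
Qed.

Lemma weyl_torVJ i j k l u v : i != j -> k != l ->
  u \is a GRing.unit -> v \is a GRing.unit ->
  (weyl k l v ^ (tor i j u)^-1)%g = weyl k l (wt i j u k * (wt i j u l)^-1 * v).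
Proof.
move=> ij kl uU vU; have lk : l != k by rewrite eq_sym.
rewrite !weylE !conjMg !torVJ //; congr (x _ _ _ * x _ _ _ * x _ _ _)%g.
have [wk wl] := (wt_unit i j k uU, wt_unit i j l uU).
by rewrite !invrM ?unitrM ?unitrV ?wk ?wl // invrK; ring.
Qed.

(** Conjugation multiplies the arguments of both Weyl elements in [tor k l v] by t. If the pairs
    share only their first index, then t = u and this leads to the symbol; if they are equal, then t
    = u^2 and this leads to its antisymmetry. *)
Lemma tor_torVJ i j k l u v : i != j -> k != l ->
  u \is a GRing.unit -> v \is a GRing.unit ->
  let t := wt i j u k * (wt i j u l)^-1 in
  (tor k l v ^ (tor i j u)^-1 = tor k l (t * v)%R * (tor k l t)^-1)%g.
Proof.
move=> ij kl uU vU t; rewrite tor_divg // {1}torE conjMg !weyl_torVJ ?unitrN1 //.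
by rewrite mulrN1.
Qed.

(** * Symbols: bimultiplicativity, antisymmetry, {-u, u} = 1 and {u, 1 - u} = 1 *)

Section Symbol.
Variables (i j k : 'I_3).
Hypotheses (ij : i != j) (ik : i != k) (jk : j != k).

(* The symbol {u, v}: by [torM_ik] it measures the failure of [tor] to be
   multiplicative. *)
Definition sym u v := locked (comm (tor i j u) (tor i k v)).

Lemma symE u v : sym u v = comm (tor i j u) (tor i k v).
Proof. by rewrite /sym -lock. Qed.

Lemma cen_sym u v : u \is a GRing.unit -> v \is a GRing.unit -> cen (sym u v).
Proof. by move=> uU vU; rewrite symE; apply: cen_comm_tor. Qed.

Lemma sym_commute u v u' v' : u \is a GRing.unit -> v \is a GRing.unit ->
  commute (sym u v) (sym u' v').
Proof. by move=> uU vU; rewrite [sym u' v']symE; apply: cen_comm => //; apply: cen_sym. Qed.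

Lemma torM_ik u v : u \is a GRing.unit -> v \is a GRing.unit ->
  tor i k (u * v) = (sym u v * tor i k v * tor i k u)%g.
Proof.
move=> uU vU; have [ki kj] : k != i /\ k != j by split; rewrite eq_sym.
have := tor_torVJ ij ik uU vU; rewrite /= /wt eqxx (negPf ki) (negPf kj).
rewrite invr1 mulr1 => e; rewrite symE /comm.
have -> : (tor i j u * tor i k v * (tor i j u)^-1 =
           tor i k v ^ (tor i j u)^-1)%g by rewrite conjgE invgK !mulgA.
by rewrite e !gnorm.
Qed.

End Symbol.

Section SymbolTheory.
Variables (i j k : 'I_3).
Hypotheses (ij : i != j) (ik : i != k) (jk : j != k).
Local Notation S := (sym i j k).
Implicit Types u v w : R.

(** Exchanging j and k along with the arguments carries statements about one argument of the symbol
    over to the other. *)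
Lemma symV u v : (S u v)^-1%g = sym i k j v u.
Proof. by rewrite !symE commV. Qed.

Lemma torM_ij u v : u \is a GRing.unit -> v \is a GRing.unit ->
  tor i j (u * v) = ((S v u)^-1 * tor i j v * tor i j u)%g.
Proof. by move=> uU vU; rewrite symV (@torM_ik i k j) // eq_sym. Qed.


(** [tor i j (u * v)] differs from a product by a central symbol, which a commutator does not see;
    what remains is [commMl] with a central inner commutator. *)
Lemma symMl u v w : u \is a GRing.unit -> v \is a GRing.unit ->
  w \is a GRing.unit -> S (u * v) w = (S u w * S v w)%g.
Proof.
move=> uU vU wU; rewrite [LHS]symE torM_ij //.
have zC := cen_sym ij ik vU uU.
have z p q r : p != q -> commute (S v u)^-1%g (tor p q r).
  by move=> pq; apply/commute_sym/commuteV/commute_sym/cen_tor.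
rewrite -mulgA comm_cenl; [|by apply: commuteM; apply: z|exact: z].
rewrite commMl -!symE.
by rewrite -(cen_tor v (cen_sym ij ik uU wU) ij) mulgK.
Qed.

End SymbolTheory.

Section SymbolCalculus.
Variables (i j k : 'I_3).
Hypotheses (ij : i != j) (ik : i != k) (jk : j != k).
Local Notation S := (sym i j k).
Implicit Types u v w : R.

Lemma symMr u v w : u \is a GRing.unit -> v \is a GRing.unit ->
  w \is a GRing.unit -> S w (u * v) = (S w u * S w v)%g.
Proof.
move=> uU vU wU; have kj : k != j by rewrite eq_sym.
apply: invg_inj; rewrite [RHS]invgM !symV (symMl ik ij kj) //.
exact: sym_commute.
Qed.

Lemma sym1l u : u \is a GRing.unit -> S 1 u = 1%g.
Proof. by move=> uU; apply: (mulgI (S 1 u)); rewrite -symMl ?unitr1 // !mulr1 mulg1. Qed.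

Lemma sym1r u : u \is a GRing.unit -> S u 1 = 1%g.
Proof. by move=> uU; apply: (mulgI (S u 1)); rewrite -symMr ?unitr1 // !mulr1 mulg1. Qed.

Lemma symVl u v : u \is a GRing.unit -> v \is a GRing.unit ->
  S u^-1 v = (S u v)^-1%g.
Proof.
move=> uU vU; apply: (mulgI (S u v)).
by rewrite -symMl ?unitrV // divrr // sym1l // mulgV.
Qed.

Lemma symVr u v : u \is a GRing.unit -> v \is a GRing.unit ->
  S u v^-1 = (S u v)^-1%g.
Proof.
move=> uU vU; apply: (mulgI (S u v)).
by rewrite -symMr ?unitrV // divrr // sym1r // mulgV.
Qed.

(** Conjugating [tor i k v] by [tor i k u] scales its argument by u^2 and so contributes {u, v}
    twice; expanding [tor i k] at u v = v u in both orders compares this with {u, v} and {v, u}. *)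
Lemma symC u v : u \is a GRing.unit -> v \is a GRing.unit ->
  S v u = (S u v)^-1%g.
Proof.
move=> uU vU; have [ki kj] : k != i /\ k != j by split; rewrite eq_sym.
have := tor_torVJ ik ik uU vU; rewrite /= /wt eqxx (negPf ki) eqxx invrK.
rewrite (torM_ik ij ik jk) ?unitrM ?uU // mulgK symMl // => e.
have c : (tor i k u * tor i k v = S u v * S u v * tor i k v * tor i k u)%g.
  by rewrite -e conjgCV.
have := torM_ik ij ik jk uU vU; rewrite mulrC (torM_ik ij ik jk vU uU).
move: (S v u) (S u v) (tor i k u) (tor i k v) c => a b t t' c.
rewrite -mulgA c !mulgA => /mulIg/mulIg; rewrite -[RHS]mul1g => /mulIg e1.
by apply: (mulIg b); rewrite e1 mulVg.
Qed.

(** Conjugating one Weyl element by another gives w(-u^2) = w(u) w(-1) w(-u), so [tor] is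
    multiplicative on the pair (-u, u). *)
Lemma sym_opp u : u \is a GRing.unit -> S (- u) u = 1%g.
Proof.
move=> uU; have ki : k != i by rewrite eq_sym.
have e : weyl i k (- u ^+ 2) = (weyl i k u * weyl i k (- 1) * weyl i k (- u))%g.
  have := weylJ (u := - u) ik; rewrite unitrN => /(_ (- 1) uU).
  rewrite unitrN1 => /(_ isT); rewrite conjgE weylV // opprK mulgA => ->.
  have tU : - ((- u) ^- 2 * -1) \is a GRing.unit.
    by rewrite unitrN unitrM unitrV unitrX unitrN ?uU ?unitr1.
  rewrite [RHS]weyl_sym //; congr (weyl _ _ _).
  by rewrite mulrN1 opprK invrK sqrrN.
have := torM_ik ij ik jk (u := - u); rewrite unitrN => /(_ u uU uU).
have -> : tor i k (- u * u) = (tor i k u * tor i k (- u))%g.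
  by rewrite !torE mulNr -expr2 e !mulgA.
move: (sym _ _ _ _ _) (tor _ _ _) (tor _ _ _) => a t t'; rewrite -mulgA.
by rewrite -[LHS]mul1g => /mulIg.
Qed.


Lemma symxx u : u \is a GRing.unit -> S u u = S u (- 1).
Proof.
move=> uU; have := sym_opp uU; rewrite -[- u]mulN1r symMl ?unitrN1 // => e.
by apply: (mulgI (S (-1) u)); rewrite e (symC (unitrN1 R) uU) mulgV.
Qed.

Lemma symN1 u : u \is a GRing.unit -> (S u (- 1) * S u (- 1))%g = 1%g.
Proof.
by move=> uU; rewrite -symMr ?unitrN1 // mulrNN mulr1 sym1r.
Qed.

Lemma sym_exch d c P : P = 1 + d * c -> P \is a GRing.unit -> c \is a GRing.unit ->
  (x j i d * x i j c)%g =
  (x i j (c / P)%R * (S P (- c) * tor i j P^-1) * x j i (d / P)%R)%g.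
Proof.
move=> eP PU cU; rewrite (exchange_r ij eP) //; congr (_ * _ * _)%g.
have PV : P^-1 \is a GRing.unit by rewrite unitrV.
have cN : - c \is a GRing.unit by rewrite unitrN.
have -> : (weyl i j (- (c / P)) * weyl i j c = tor i j (- (c / P))%R * (tor i j (- c)%R)^-1)%g.
  by rewrite tor_divg // opprK.
rewrite -mulNr (torM_ij ij ik jk cN PV) mulgK symVl // invgK.
by [].
Qed.

Lemma torM_inv A B : A \is a GRing.unit -> B \is a GRing.unit ->
  (tor i j A^-1 * tor i j B^-1 = S A B * tor i j (A * B)^-1)%g.
Proof.
move=> AU BU; rewrite invrM // (torM_ij ij ik jk) ?unitrV //.
rewrite symVl ?unitrV // symVr ?unitrV // invgK !mulgA.
by rewrite mulgV mul1g.
Qed.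

Lemma tor_x u a : u \is a GRing.unit ->
  (tor i j u^-1 * x i j a = x i j (u ^- 2 * a)%R * tor i j u^-1)%g.
Proof.
move=> uU; have uV : u^-1 \is a GRing.unit by rewrite unitrV.
rewrite conjgCV torVJ // /wt !eqxx eq_sym (negPf ij) invrK -exprVn expr2.
by [].
Qed.

(** [sym_exch] is applied to c and then to c', the second time with lower argument d / A and pivot
    B. This reaches sums c + c' that are not units. *)
Lemma exchange2 d c c' A B P : A = 1 + d * c -> P = 1 + d * (c + c') -> P = A * B ->
  A \is a GRing.unit -> B \is a GRing.unit ->
  c \is a GRing.unit -> c' \is a GRing.unit ->
  (x j i d * x i j (c + c'))%g =
  (x i j ((c + c') / P)%R * (S A (- c) * S B (- c') * S A B * tor i j P^-1) *
   x j i (d / P)%R)%g.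
Proof.
move=> eA eP eAB AU BU cU c'U.
have [AV BV] := (divrr AU, divrr BU).
rewrite stD // mulgA (sym_exch eA) // -mulgA.
have dc : d * c = A - 1 by rewrite eA; ring.
have eB : B = 1 + d / A * c'.
  by apply: (mulrI AU); rewrite -eAB eP; ring: AV dc.
rewrite (sym_exch eB) // -!mulgA (mulgA (tor i j A^-1)) tor_x //.
rewrite !mulgA -(mulgA (x i j (c / A))).
have [zA zB] : cen (S A (- c)) /\ cen (S B (- c')) by split; apply: cen_sym; rewrite ?unitrN.
rewrite (zA i j _ ij) mulgA -stD // -!mulgA; congr (_ * _)%g.
  congr (x _ _ _); have e : c * A * B = c + (A - 1) * (c + c').
    by rewrite -mulrA -eAB eP; ring: dc.
  have AABU : A * A * B \is a GRing.unit by rewrite !unitrM AU.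
  apply: (mulIr AABU) => /=; transitivity (c * A * B + c').
    by rewrite -exprVn; ring: AV BV.
  by rewrite e eAB invrM //; ring: AV BV.
rewrite (mulgA (tor i j A^-1) (S B _)) -(cen_tor _ zB ij) -!mulgA.
rewrite (mulgA (tor i j A^-1)) torM_inv //.
by rewrite eAB invrM // !mulgA (mulrC B^-1 A^-1) mulrA.
Qed.

(* Compares [exchange2] for two ways of writing the same sum. *)
Lemma sym_split d c c' c1 c1' A B A1 B1 P :
  c + c' = c1 + c1' -> A = 1 + d * c -> A1 = 1 + d * c1 ->
  P = 1 + d * (c + c') -> P = A * B -> P = A1 * B1 ->
  [/\ A \is a GRing.unit, B \is a GRing.unit, c \is a GRing.unit
     & c' \is a GRing.unit] ->
  [/\ A1 \is a GRing.unit, B1 \is a GRing.unit, c1 \is a GRing.unit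
     & c1' \is a GRing.unit] ->
  (S A (- c) * S B (- c') * S A B)%g = (S A1 (- c1) * S B1 (- c1') * S A1 B1)%g.
Proof.
move=> ec eA eA1 eP eAB eAB1 [AU BU cU c'U] [A1U B1U c1U c1'U].
have := exchange2 eA eP eAB AU BU cU c'U.
rewrite {}ec in eP *; rewrite (exchange2 eA1 eP eAB1) //.
by move/mulIg/mulgI/mulIg.
Qed.

Lemma tor1 : tor i j 1 = 1%g.
Proof. by rewrite torE -weylV // mulgV. Qed.

Lemma weyl1_tor u : u \is a GRing.unit ->
  (weyl i j 1 * tor i j u = tor i j u^-1 * weyl i j 1)%g.
Proof.
move=> uU; have w1 : (weyl i j (-1))^-1%g = weyl i j 1 by rewrite weylV // opprK.
have : (tor i j u ^ weyl i j (- 1) = tor i j u^-1)%g.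
  have N1 := unitrN1 R.
  have N1J v : v \is a GRing.unit ->
      (weyl i j v ^ weyl i j (- 1))%g = weyl i j v^-1.
    move=> vU; rewrite weylJ // weyl_sym ?unitrN ?unitrM ?unitrV ?unitrX //.
    by rewrite sqrrN expr1n invr1 mul1r invrN opprK.
  by rewrite !torE conjMg !N1J // invrN invr1.
by rewrite conjgE w1 -w1 => <-; rewrite !mulgA mulgK.
Qed.

Lemma weyl_tor u : u \is a GRing.unit ->
  (weyl i j u * tor i j u = S u (- 1)%R * weyl i j 1)%g.
Proof.
move=> uU; have uVU : u^-1 \is a GRing.unit by rewrite unitrV.
have w1 : (weyl i j (-1))^-1%g = weyl i j 1 by rewrite weylV // opprK.
have eu : weyl i j u = (tor i j u * weyl i j 1)%g by rewrite torE -w1 mulgK.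
rewrite {1}eu -mulgA weyl1_tor // mulgA; congr (_ * _)%g.
have := torM_inv uVU uU; rewrite invrK mulVr // invr1 tor1 mulg1 => ->.
by rewrite symVl // symxx //; apply: (mulIg (S u (-1))); rewrite symN1 // mulVg.
Qed.

(* Expand x_ji(-1/u) x_ij(u + v) in two ways. *)
Lemma sym_steinberg u v : u + v = 1 -> u \is a GRing.unit -> v \is a GRing.unit ->
  S u v = 1%g.
Proof.
move=> uv uU vU; have ji : j != i by rewrite eq_sym.
have [uV vV] := (divrr uU, divrr vU).
have ev : v = 1 - u by rewrite -uv; ring.
have iuU : u^-1 \is a GRing.unit by rewrite unitrV.
have ivU : v^-1 \is a GRing.unit by rewrite unitrV.
have e1 : (x j i (- u^-1) * x i j u = weyl i j u * x j i u^-1)%g.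
  by rewrite {1}(st_weyl ij uU) stN // !mulgA mulVg mul1g.
have PU : - (v / u) \is a GRing.unit by rewrite unitrN unitrM vU.
have eP : - (v / u) = 1 + - u^-1 * 1.
  by rewrite ev; ring: uV.
have := sym_exch eP PU (unitr1 R).
have eQ : u^-1 = 1 + u^-1 * v by rewrite ev; ring: uV.
rewrite -{1}uv stD // mulgA e1 -mulgA (sym_exch eQ) //.
set P := - (v / u) in eP PU *; set q := - (u / v).
have qU : q \is a GRing.unit by rewrite unitrN unitrM uU.
have Pq : P^-1 = q by rewrite /P invrN invrM // invrK.
have -> : v / u^-1 = - (u ^+ 2 * P) by rewrite invrK /P; ring: uV.
have -> : - u^-1 / P = u / v + 1.
  by rewrite Pq /q mulrNN mulKr // -vV -mulrDl uv mul1r.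
have ePq : x j i P = (x j i (- P))^-1%g by rewrite stN // invgK.
rewrite Pq mul1r invrK mulVr // stD // !mulgA => /mulIg.
rewrite -st_weylC' // ePq.
have c2 : (tor i j q * x j i (u / v) = x j i (- P) * tor i j q)%g.
  rewrite conjgCV torVJ // /wt !eqxx (negPf ji); congr (x _ _ _ * _)%g.
  by rewrite -Pq invrK /P; ring: uV vV.
clearbody P q; move=> /(congr1 (fun g => x j i (- P) * g)%g) /=; rewrite -!mulgA mulVKg c2.
have z1 : cen (S u^-1 (- v)) by apply: cen_sym; rewrite ?unitrN.
have z2 : cen (S P (- 1)) by apply: cen_sym; rewrite ?unitrN1.
rewrite (mulgA (weyl i j u)) -(cen_weyl _ z1 ij) -mulgA weyl_tor //.
rewrite (mulgA (x i j q)) -(z2 i j _ ij) !mulgA -(z2 j i _ ji).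
have -> : (S P (-1) * x j i (- P) * x i j q * x j i (- P) = S P (- 1) * weyl i j q)%g.
  have -> : weyl i j q = weyl j i (- P).
    by rewrite [RHS]weyl_sym ?unitrN // invrN opprK Pq.
  by rewrite weylE invrN opprK Pq !mulgA.
rewrite -(mulgA (S P _)) weyl_tor // !mulgA => /mulIg.
(* As q = 1 / P these symbols cancel, and the comparison shrinks to {1/u, -v} {u, -1} = 1, which is
   {u, v} = 1 by bimultiplicativity. *)
have -> : (S P (-1) * S q (-1) = 1)%g.
  by rewrite -symMl ?unitrN1 // -Pq divrr // sym1l ?unitrN1.
rewrite symVl ?unitrN // -[- v]mulN1r symMr ?unitrN1 // => e.
have : (S u (-1) * S u v = S u (-1))%g by rewrite -[LHS]mulg1 -e mulVKg.
by rewrite -[RHS]mulg1 => /mulgI.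
Qed.

End SymbolCalculus.
End SteinbergTheory.

(** * Normal form over a local ring *)

(* The matrix (p, q, r, t) = [p, q; r, t] of a word, where [Some a] stands for
   [1, a; 0, 1] and [None] for [0, 1; -1, 0]. *)
Fixpoint word_mx (R : pzRingType) (s : seq (option R)) : R * R * R * R :=
  if s is l :: s' then
    let: (p, q, r, t) := word_mx s' in
    if l is Some a then (p + a * r, q + a * t, r, t) else (r, t, - p, - q)
  else (1, 0, 0, 1).

Section NormalForm.
Variables (gT : groupType) (R : comUnitRingType) (x : 'I_3 -> 'I_3 -> R -> gT).
Hypothesis st : steinberg x.
Variables (i j k : 'I_3).
Hypotheses (ij : i != j) (ik : i != k) (jk : j != k).
Hypothesis sym_trivial : forall u v, u \is a GRing.unit -> v \is a GRing.unit ->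
  sym x i j k u v = 1%g.
Hypothesis local : forall a b : R, a \isn't a GRing.unit -> 1 + a * b \is a GRing.unit.
Local Notation T := (tor x i j).
Local Notation W := (weyl x i j).
Implicit Types (a b c d u v : R).

Let ji : j != i. Proof. by rewrite eq_sym. Qed.

Lemma torM u v : u \is a GRing.unit -> v \is a GRing.unit -> (T u * T v)%g = T (u * v).
Proof.
by move=> uU vU; rewrite mulrC (torM_ij st ij ik jk) // sym_trivial // invg1 mul1g.
Qed.

Lemma torV u : u \is a GRing.unit -> (T u)^-1%g = T u^-1.
Proof.
move=> uU; apply: (mulgI (T u)).
by rewrite mulgV torM ?unitrV // divrr // (tor1 st).
Qed.

Lemma weylM u v : u \is a GRing.unit -> v \is a GRing.unit ->
  (W u * W v)%g = T (- (u / v)).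
Proof.
move=> uU vU; have nvU : - v \is a GRing.unit by rewrite unitrN.
rewrite -{1}[v]opprK -(tor_divg st) // torV // torM ?unitrV //.
by rewrite invrN mulrN.
Qed.

Lemma tor_upper u a : u \is a GRing.unit -> (T u * x i j a = x i j (u ^+ 2 * a)%R * T u)%g.
Proof.
move=> uU; rewrite -[u in LHS]invrK (tor_x st) ?unitrV // invrK -exprVn invrK.
by [].
Qed.

Lemma tor_lower u a : u \is a GRing.unit -> (T u * x j i a = x j i (u ^- 2 * a)%R * T u)%g.
Proof.
move=> uU; rewrite conjgCV (torVJ st) // /wt !eqxx (negPf ji) -exprVn expr2.
by [].
Qed.

Lemma weyl1_upper a : (W 1 * x i j a = x j i (- a) * W 1)%g.
Proof. by rewrite (st_weylC' st) ?unitr1 // expr1n mul1r opprK. Qed.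

Lemma weyl1_lower a : (W 1 * x j i a = x i j (- a) * W 1)%g.
Proof. by rewrite (st_weylC st) ?unitr1 // expr1n invr1 mul1r opprK. Qed.

Lemma exchange d c P : P = 1 + d * c -> P \is a GRing.unit ->
  (x j i d * x i j c)%g = (x i j (c / P)%R * T P^-1 * x j i (d / P)%R)%g.
Proof.
move=> eP PU; have [PV PVU] : P / P = 1 /\ P^-1 \is a GRing.unit by rewrite divrr // unitrV.
have [cU|cN] := boolP (c \is a GRing.unit).
  have cV := divrr cU.
  rewrite (exchange_r st ij eP) // weylM ?unitrN ?unitrM ?cU //.
  by congr (_ * tor _ _ _ _ * _)%g; ring: cV.
have [dU|dN] := boolP (d \is a GRing.unit).
  have dV := divrr dU; have dVU : d^-1 \is a GRing.unit by rewrite unitrV.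
  rewrite (exchange_l st ij eP) // weylM ?unitrN ?unitrM ?PU //.
  by congr (_ * tor _ _ _ _ * _)%g; rewrite invrM // invrK; ring: dV.
(* Neither c nor d is a unit. By locality c - 1 and 1 + d then are, so [exchange2] applies to c = 1
   + (c - 1) with first pivot 1 + d. *)
have c1U : c - 1 \is a GRing.unit.
  by have := local (-1) cN; rewrite mulrN1 -unitrN opprB.
have AU : 1 + d \is a GRing.unit by have := local 1 dN; rewrite mulr1.
have BU : P / (1 + d) \is a GRing.unit by rewrite unitrM PU unitrV.
have ec : c = 1 + (c - 1) by rewrite addrC subrK.
rewrite {1}ec (exchange2 st ij ik jk (A := 1 + d) (B := P / (1 + d)) (P := P)) ?unitr1 //.
- by rewrite !sym_trivial ?unitrN ?unitr1 // !mul1g -ec.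
- by rewrite mulr1.
- by rewrite -ec.
- by rewrite mulrC divrK.
Qed.

(* The two Bruhat cells; if t is not a unit then r is one. *)
Definition normal_form (m : R * R * R * R) : gT :=
  let: (p, q, r, t) := m in
  if t \is a GRing.unit then (x i j (q / t)%R * T t^-1 * x j i (r / t)%R)%g
  else (x i j (p / r)%R * T (- r^-1) * W 1 * x i j (t / r)%R)%g.

Definition det22 (m : R * R * R * R) : R :=
  let: (p, q, r, t) := m in p * t - q * r.

Lemma normal_form_upper a p q r t : det22 (p, q, r, t) = 1 ->
  normal_form (p + a * r, q + a * t, r, t) = (x i j a * normal_form (p, q, r, t))%g.
Proof.
rewrite /normal_form /det22 => det1; case: ifPn => [tU|tN]; rewrite !mulgA -(stD st) //.
  by rewrite mulrDl mulrK // addrC.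
have rU : r \is a GRing.unit.
  have := local (- p) tN; rewrite -det1 mulrN (mulrC t) addrAC subrr sub0r.
  by rewrite unitrN unitrM => /andP[].
by rewrite mulrDl mulrK // addrC.
Qed.

(** The Weyl element replaces t by -q, so the cells depend on which of t and q are units. If t is
    not, then q and r are; if t is and q is not, then p t = 1 + r q makes p one. In both cases
    [exchange] reorders the factors. If t and q are both units, [st_weyl] on the upper factor
    suffices. *)
Lemma normal_form_weyl p q r t : det22 (p, q, r, t) = 1 ->
  normal_form (r, t, - p, - q) = (W 1 * normal_form (p, q, r, t))%g.
Proof.
rewrite /normal_form /det22 => det1; have pt : p * t = 1 + r * q by rewrite -det1; ring.
have W1T := weyl1_tor st ij; have Nq : (- q \is a GRing.unit) = (q \is a GRing.unit) by rewrite unitrN.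
have [tU|tN] := boolP (t \is a GRing.unit); rewrite Nq; last first.
  have : q * r \is a GRing.unit.
    by have := local (- p) tN; rewrite -unitrN; congr (_ \is a _); rewrite -det1; ring.
  rewrite unitrM => /andP[qU rU]; rewrite qU.
  have [qV rV] := (divrr qU, divrr rU).
  have rVN : - r^-1 \is a GRing.unit by rewrite unitrN unitrV.
  have -> : (W 1 * (x i j (p / r) * T (- r^-1) * W 1 * x i j (t / r)) =
      x j i (- (p / r)) * x i j (r * t) * T r)%g.
    rewrite !mulgA weyl1_upper -!mulgA; congr (_ * _)%g.
    rewrite !mulgA W1T // -(mulgA (T _)) weylM ?unitr1 // divr1 torM ?unitrV ?unitrN1 //.
    by rewrite invrN invrK mulrNN mulr1 tor_upper // expr2; congr (x _ _ _ * _)%g; ring: rV.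
  rewrite (exchange (P := - (q * r))) ?unitrN ?unitrM ?qU //; last first.
    transitivity (1 - p * t); first by rewrite pt; ring.
    by ring: rV.
  rewrite -!mulgA -(_ : T r * x j i (- (p / - q)) = x j i (- (p / r) / - (q * r)) * T r)%g; last first.
    rewrite tor_lower //; congr (x _ _ _ * _)%g.
    by rewrite -exprVn !invrN invrM //; ring.
  rewrite !mulgA -(mulgA _ (T _) (T r)) torM ?unitrV ?unitrN ?unitrM ?qU //.
  congr (_ * _ * _)%g; [congr (x _ _ _)|congr (tor _ _ _ _)|congr (x _ _ _)].
  - by rewrite !invrN invrM //; ring: rV.
  - by rewrite !invrN invrM //; ring: rV.
  - by rewrite !invrN; ring.
have tV := divrr tU; have tVU : t^-1 \is a GRing.unit by rewrite unitrV.
have [qU|qN] := boolP (q \is a GRing.unit).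
  have qV := divrr qU; have qtU : q / t \is a GRing.unit by rewrite unitrM qU.
  have iqt : (q / t)^-1 = t / q by rewrite invrM // invrK.
  rewrite [in RHS](st_weyl st ij qtU) iqt !mulgA weyl1_lower -(mulgA _ (W 1)).
  rewrite weylM ?unitr1 // div1r iqt.
  have -> : (x j i (t / q) = x j i (t^-1 ^- 2 * (t^-1 / q)))%g.
    by congr (x _ _ _); rewrite -exprVn invrK; ring: tV.
  rewrite -!mulgA (mulgA (x j i _)) -tor_lower // -!mulgA -(stD st) // mulgA.
  rewrite (mulgA (T _)) torM ?unitrN ?unitrM ?tU ?unitrV //.
  rewrite mulgA; congr (_ * _ * _)%g; [congr (x _ _ _)|congr (tor _ _ _ _)|congr (x _ _ _)].
  - by rewrite invrN mulrN.
  - transitivity (- q^-1); [exact: invrN | ring: tV].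
  - rewrite invrN mulrNN -[p](mulrK tU) pt.
    by ring: qV.
have pU : p \is a GRing.unit.
  have := local r qN; rewrite (mulrC q) -pt unitrM => /andP[//].
have pV := divrr pU; have pVU : p^-1 \is a GRing.unit by rewrite unitrV.
have -> : (x i j (r / - p) * T (- (- p)^-1) * W 1 * x i j (- q / - p))%g =
    (W 1 * (x j i (r / p) * x i j (p * q) * T p))%g.
  rewrite !mulgA weyl1_lower -!mulgA; congr (_ * _)%g; first by rewrite invrN mulrN.
  have -> : (x i j (p * q) * T p = T p * x i j (q / p))%g.
    by rewrite tor_upper //; congr (x _ _ _ * _)%g; ring: pV.
  rewrite (mulgA (W 1)) W1T // invrN opprK mulgA; congr (_ * _ * x _ _ _)%g.
  by rewrite mulrNN.
rewrite (exchange (P := p * t)) ?unitrM ?pU //; last by rewrite pt; ring: pV.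
congr (_ * _)%g; rewrite -!mulgA.
have -> : (x j i (r / p / (p * t)) * T p = T p * x j i (r / t))%g.
  by rewrite tor_lower //; congr (x _ _ _ * _)%g; rewrite invrM // -exprVn; ring.
rewrite (mulgA (T _)) torM ?unitrV ?unitrM ?pU //.
congr (_ * (_ * _))%g; [congr (x _ _ _)|congr (tor _ _ _ _)].
- by rewrite invrM //; ring: pV.
- by rewrite invrM //; ring: pV.
Qed.


Definition word_val (s : seq (option R)) : gT :=
  foldr (fun l g => (if l is Some a then x i j a else W 1) * g)%g 1%g s.

(** By induction on the word, its value is the normal form of its matrix; the two preceding lemmas
    absorb a new first letter. *)
Theorem word_val_eq1 s : word_mx s = (1, 0, 0, 1) -> word_val s = 1%g.
Proof.
have H : det22 (word_mx s) = 1 /\ word_val s = normal_form (word_mx s).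
  elim: s => [|l s [IHd IHv]] /=.
    split; first by rewrite /det22 mul0r subr0 mulr1.
    by rewrite /normal_form unitr1 invr1 !mul0r !(st0 st) // (tor1 st) // !mulg1.
  case: (word_mx s) IHd IHv => [[[p q] r] t] IHd ->; case: l => [a|].
    by rewrite normal_form_upper //; split=> //; rewrite /det22 in IHd *; rewrite -IHd; ring.
  by rewrite normal_form_weyl //; split=> //; rewrite /det22 in IHd *; rewrite -IHd; ring.
case: H => _ -> ->.
by rewrite /normal_form unitr1 invr1 !mul0r !(st0 st) // (tor1 st) // !mulg1.
Qed.

End NormalForm.

(** * Triviality of the symbols over Z/p^e *)

Section UnitsZq.
Variables (p e : nat).
Hypotheses (p_pr : prime p) (e_gt0 : (0 < e)%N).
Local Notation q := (p ^ e)%N.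

Lemma pfactor_gt1 : (1 < q)%N.
Proof. by rewrite -(exp1n e) ltn_exp2r // prime_gt1. Qed.

Lemma unitZq (m : nat) : (m%:R : 'Z_q) \is a GRing.unit = ~~ (p %| m)%N.
Proof. by rewrite unitZpE ?pfactor_gt1 // coprime_pexpl // prime_coprime. Qed.

Lemma local_Zq (a b : 'Z_q) : a \isn't a GRing.unit -> 1 + a * b \is a GRing.unit.
Proof.
rewrite -[a]natr_Zp -[b]natr_Zp unitZq negbK => pa.
rewrite -natrM -(natrD _ 1) unitZq dvdn_addl ?dvdn_mulr //.
by rewrite dvdn1 gtn_eqF ?prime_gt1.
Qed.

(** The units of Z/p^e are the automorphisms of its cyclic additive group, and the automorphism
    group of a cyclic p-group has known structure. *)
Lemma Zq_unit_generators :
  (odd p -> exists2 g : 'Z_q, g \is a GRing.unit &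
     forall u : 'Z_q, u \is a GRing.unit -> exists k, u = g ^+ k) /\
  (p = 2%N -> forall u : 'Z_q, u \is a GRing.unit ->
     exists i j, u = 5%:R ^+ i * (-1) ^+ j).
Proof.
have cyc : cyclic [set: 'Z_q] by apply/cyclicP; exists Zp1; apply: Zp_cycle.
have card_q : #|[set: 'Z_q]| = q by rewrite cardsT card_ord Zp_cast ?pfactor_gt1.
have pG : (p.-group [set: 'Z_q])%g by rewrite /pgroup card_q pnatX pnat_id.
have nt : ([set: 'Z_q] != 1)%g by rewrite -cardG_gt1 card_q pfactor_gt1.
have := cyclic_pgroup_Aut_structure pG cyc nt.
rewrite card_q /= pfactorK //; set A := Aut _.
case=> m [[_ [m1 mM] [_ imm] mX _] [_ cycF cardF _] H].
have A1 : 1%g \in A by apply: group1.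
have ex u : u \is a GRing.unit -> exists2 a, a \in A & u = m a.
  by rewrite -imm => /fintype.imageP[a aA ->]; exists a.
have unit_m a : a \in A -> m a \is a GRing.unit.
  by move=> aA; rewrite -imm; apply/fintype.imageP; exists a.
split=> [p_odd|p2].
  have [g Ag] : exists g, A = <[g]>%g.
    case: ifP H => [_ ->|_ [t [_ _ _]]]; first exact/cyclicP.
    by rewrite p_odd => -[[/cyclicP]].
  have gA : g \in A by rewrite Ag cycle_id.
  exists (m g) => [|u /ex[a aA ->]]; first exact: unit_m.
  by move: aA; rewrite Ag => /cycleP[k ->]; exists k; rewrite mX.
move=> u /ex[a aA ->]; case: ifP H => [/eqP e1 AF|_ [t [tA _ mt]]].
  have : a \in [set 1%g].
    suff <- : A = [set 1%g] by [].
    by apply/esym/eqP; rewrite eqEcard finset.sub1set A1 cards1 AF cardF p2.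
  by rewrite inE => /eqP ->; exists 0%N, 0%N; rewrite m1 mul1r.
have -> : odd p = false by rewrite p2.
case: ifP => [_ At|_ [s [sA _ ms st _]]].
  by move: aA; rewrite At => /cycleP[k ->]; exists 0%N, k; rewrite mX // mt mul1r.
have : a \in (<[s]> * <[t]>)%g by rewrite (dprodW st).
case/mulsgP=> _ _ /cycleP[k ->] /cycleP[l ->] ->.
by exists k, l; rewrite mM ?groupX // !mX // ms mt.
Qed.

(** Each p-th power gains a factor p: y^p - 1 is y - 1 times a sum of p powers of y, each 1 modulo
    p. For odd p the exponent is odd, which kills a symbol of order two. *)
Lemma unitZq_odd_exp (m : nat) : (m %% p = 1)%N ->
  (m%:R : 'Z_q) ^+ (p ^ e.-1) = 1.
Proof.
move=> mp; have m_gt0 : (0 < m)%N by case: m mp; rewrite ?mod0n.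
have H f : (p ^ f.+1 %| (m ^ (p ^ f)).-1)%N.
  elim: f => [|f IHf].
    by rewrite expn1 -subn1 -eqn_mod_dvd // mp modn_small ?prime_gt1.
  rewrite [X in (m ^ X)%N]expnSr expnM predn_exp expnSr dvdn_mul //.
  set y := (m ^ _)%N; have y1 : (y %% p = 1)%N.
    by rewrite -modnXm mp exp1n modn_small ?prime_gt1.
  rewrite /dvdn -modn_summ (eq_bigr (fun=> 1%N)) => [|l _].
    by rewrite sum1_card card_ord modnn.
  by rewrite -modnXm y1 exp1n modn_small ?prime_gt1.
apply: ord_inj; rewrite -natrX -[1 in RHS]/(1%:R) !val_Zp_nat ?pfactor_gt1 //.
have := H e.-1; rewrite prednK // -subn1 -eqn_mod_dvd ?expn_gt0 ?m_gt0 //.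
by move/eqP.
Qed.
End UnitsZq.

Section TrivialSymbol.
Variables (p e : nat).
Hypotheses (p_pr : prime p) (e_gt0 : (0 < e)%N).
Local Notation q := (p ^ e)%N.
Variables (gT : groupType) (x : 'I_3 -> 'I_3 -> 'Z_q -> gT).
Hypothesis st : steinberg x.
Variables (i j k : 'I_3).
Hypotheses (ij : i != j) (ik : i != k) (jk : j != k).
Local Notation S := (sym x i j k).

Lemma symXl u v n : u \is a GRing.unit -> v \is a GRing.unit ->
  S (u ^+ n) v = (S u v ^+ n)%g.
Proof.
move=> uU vU; elim: n => [|n IHn]; first by rewrite expr0 (sym1l st).
by rewrite exprS (symMl st) ?unitrX // IHn expgS.
Qed.

Lemma symXr u v n : u \is a GRing.unit -> v \is a GRing.unit ->
  S u (v ^+ n) = (S u v ^+ n)%g.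
Proof.
move=> uU vU; elim: n => [|n IHn]; first by rewrite expr0 (sym1r st).
by rewrite exprS (symMr st) ?unitrX // IHn expgS.
Qed.

(* If {g, g} <> 1 for a generator g, take the least n that is an odd power of g:
   then {n - 1, n} = 1, whereas {(n - 1)/n, 1/n} = 1 gives {n - 1, n} = {n, n}. *)
Lemma sym_odd u v : odd p -> u \is a GRing.unit -> v \is a GRing.unit -> S u v = 1%g.
Proof.
move=> p_odd; have [/(_ p_odd)[g gU gen] _] := Zq_unit_generators p_pr e_gt0.
have gg2 : (S g g ^+ 2 = 1)%g.
  rewrite (symxx st ij ik jk) // expgS expg1 (symN1 st) //.
have par a : (S g g ^+ a = if odd a then S g g else 1)%g.
  rewrite -{1}(odd_double_half a) expgnDr -mul2n expgnA gg2 expg1n mulg1.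
  by case: (odd a).
have main n : (n%:R : 'Z_q) \is a GRing.unit -> S n%:R g = 1%g.
  elim/ltn_ind: n => [[|[|n]]] IHn nU.
  - by move: nU; rewrite unitr0.
  - by rewrite (sym1l st).
  have [a na] := gen _ nU.
  have e1 : S n.+2%:R g = (S g g ^+ a)%g by rewrite na symXl.
  have [n1U|] := boolP ((n.+1%:R : 'Z_q) \is a GRing.unit); last first.
    (* Here the current integer [n.+2] is 1 modulo p, so its symbol with g is killed by the odd
       number p^(e-1) as well as by 2. *)
    rewrite unitZq // negbK => /dvdnP[c nc].
    have : (S n.+2%:R g ^+ (p ^ e.-1) = 1)%g.
      rewrite -symXl // unitZq_odd_exp ?(sym1l st) // -addn1 nc modnMDl.
      by rewrite modn_small ?prime_gt1.
    by rewrite e1 -expgnA (par (a * _)%N) oddM oddX p_odd orbT andbT -par.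
  have nV := divrr nU.
  have := sym_steinberg st ij ik jk (u := n.+1%:R / n.+2%:R) (v := n.+2%:R^-1).
  rewrite -[X in _ + X]mul1r -mulrDl natr1 nV unitrM n1U unitrV => /(_ erefl nU nU).
  rewrite (symMl st) ?unitrV // (symVl st) ?unitrV // !(symVr st) //.
  have -> : S n.+1%:R n.+2%:R = 1%g.
    by rewrite na symXr // IHn // expg1n.
  rewrite invg1 mul1g invgK na symXl ?unitrX // symXr // -expgnA (par (a * _)%N) oddM andbb -par.
  by rewrite -symXl.
have g1 : S g g = 1%g by rewrite -{1}[g]natr_Zp main // natr_Zp.
by move=> /gen[a ->] /gen[b ->]; rewrite symXl ?unitrX // symXr // g1 !expg1n.
Qed.

Lemma sym_two u v : p = 2%N -> S (-1) (-1) = 1%g ->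
  u \is a GRing.unit -> v \is a GRing.unit -> S u v = 1%g.
Proof.
move=> p2 S11.
have N1 : (-1 : 'Z_q) \is a GRing.unit by rewrite unitrN1.
have U5 : (5 : 'Z_q) \is a GRing.unit by rewrite unitZq // p2.
have U3 : (3 : 'Z_q) \is a GRing.unit by rewrite unitZq // p2.
have [_ /(_ p2) gen] := Zq_unit_generators p_pr e_gt0.
have [a [b e3]] := gen _ U3.
have N5 : (-5 : 'Z_q) \is a GRing.unit by rewrite unitrN.
have N3 : (-3 : 'Z_q) \is a GRing.unit by rewrite unitrN.
have e9 : 3 ^+ 2 = 5 ^+ (a * 2) :> 'Z_q.
  by rewrite e3 exprMn -!exprM [(b * 2)%N]mulnC [X in _ * X]exprM sqrrN expr1n expr1n mulr1.
have U35 : (3 / 5 : 'Z_q) \is a GRing.unit by rewrite unitrM U3 unitrV.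
have s51 : S 5 (-1) = 1%g.
  (* The exchange relation at d = -2, with 1 + 1 = 3 - 1. *)
  have := sym_split st ij ik jk (d := -2) (c := 1) (c' := 1) (c1 := 3) (c1' := -1)
    (A := -1) (B := 3) (A1 := -5) (B1 := 3 / 5) (P := -3).
  have e35 : -3 = -5 * (3 / 5) :> 'Z_q by rewrite mulNr mulrC divrK.
  have s55 : S (-5) 5 = 1%g by apply: sym_opp.
  (* Squaring removes the sign in 3 = 5^a (-1)^b, so {-5, 3}^2 is a power of {-5, 5} = 1. *)
  have s53 : (S (-5) 3 * S (-5) 3 = 1)%g.
    by rewrite -(symMr st) // -expr2 e9 symXr // s55 expg1n.
  rewrite !opprK (symMr st) ?unitrV // (symVr st) // s55 invg1 mulg1.
  rewrite (sym1r st) // mulg1 S11 mul1g (symC st ij ik jk N1 U3) mulVg.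
  rewrite -[- (3)]mulN1r (symMr st) // -mulgA s53 mulg1.
  rewrite -[- (5)]mulN1r (symMl st) // S11 mul1g => <- //; rewrite ?mulN1r //.
  - by ring.
  - by ring.
  - by ring.
  - by ring.
  - by split; rewrite ?unitr1.
have s15 : S (-1) 5 = 1%g by rewrite (symC st ij ik jk U5 N1) s51 invg1.
have s55 : S 5 5 = 1%g by rewrite (symxx st ij ik jk U5).
move=> /gen[a1 [b1 ->]] /gen[a2 [b2 ->]].
rewrite (symMl st) ?unitrM ?unitrX // !(symMr st) ?unitrX // !symXl ?unitrX //.
by rewrite !symXr // s51 s15 s55 S11 !expg1n !mulg1.
Qed.

End TrivialSymbol.

(** * Chinese remainder decomposition *)

Definition eq1_mod (M : nat) (m : int * int * int * int) : bool :=
  let: (p, q, r, t) := m in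
  [&& (M %| p - 1)%Z, (M %| q)%Z, (M %| r)%Z & (M %| t - 1)%Z].

Lemma eq1_mod_dvd M M' m : (M' %| M)%N -> eq1_mod M m -> eq1_mod M' m.
Proof.
case: m => [[[p q] r] t] M'M /and4P[h1 h2 h3 h4].
have dv a : (M %| a)%Z -> (M' %| a)%Z by apply: dvdz_trans.
by apply/and4P; split; apply: dv.
Qed.

Section PeriodicSteinberg.
Variables (gT : groupType) (M : nat) (x : 'I_3 -> 'I_3 -> int -> gT).
Hypothesis st : steinberg x.
Hypothesis stM : forall i j, i != j -> x i j M%:Z = 1%g.
Implicit Types (i j k l : 'I_3) (a b : int).

Lemma st_dvd i j a : i != j -> (M %| a)%Z -> x i j a = 1%g.
Proof.
move=> ij /dvdzP[c ->]; have posM n : x i j (n%:Z * M%:Z) = 1%g.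
  elim: n => [|n IHn]; first by rewrite mul0r (st0 st).
  by rewrite intS mulrDl mul1r (stD st) // stM // IHn mulg1.
by case: c => n //; rewrite NegzE mulNr (stN st) // posM invg1.
Qed.

Lemma st_cong i j a b : i != j -> (M %| a - b)%Z -> x i j a = x i j b.
Proof.
by move=> ij ab; rewrite -[a](subrK b) (stD st) // st_dvd // mul1g.
Qed.

Lemma weyl1E i j : weyl x i j 1 = (x i j 1 * x j i (- 1)%R * x i j 1)%g.
Proof. by rewrite weylE invr1. Qed.

End PeriodicSteinberg.

Section PrimePower.
Variables (p e : nat).
Hypotheses (p_pr : prime p) (e_gt0 : (0 < e)%N).
Local Notation q := (p ^ e)%N.
Variables (gT : groupType) (x : 'I_3 -> 'I_3 -> int -> gT).
Hypothesis st : steinberg x.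
Hypothesis stM : forall i j, i != j -> x i j q%:Z = 1%g.

Let xq i j (a : 'Z_q) : gT := x i j (a : nat)%:Z.

Lemma intr_eq_Zp (M : nat) (a b : int) : (1 < M)%N ->
  ((a%:~R : 'Z_M) == b%:~R) = (M %| a - b)%Z.
Proof.
move=> M1; rewrite -subr_eq0 -rmorphB /=; move: (a - b) => c.
have natP n : ((n%:R : 'Z_M) == 0) = (M %| n)%N.
  by rewrite -val_eqE /= val_Zp_nat.
case: c => n; first by rewrite natP.
by rewrite NegzE mulrNz oppr_eq0 natP dvdzE abszN.
Qed.

Lemma xq_intr i j a : i != j -> xq i j a%:~R = x i j a.
Proof.
move=> ij; apply: (st_cong st stM ij).
by rewrite -intr_eq_Zp ?pfactor_gt1 // -pmulrn natr_Zp.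
Qed.

Lemma steinberg_xq : steinberg xq.
Proof.
have E i j a : xq i j a = x i j (a : nat)%:Z by [].
have N (a : 'Z_q) : a = ((a : nat)%:Z)%:~R by rewrite -pmulrn natr_Zp.
split=> [i j a b ij|i j k l a b ij kl jk il|i j k a b ij jk ik].
- have -> : a + b = ((a : nat)%:Z + (b : nat)%:Z)%:~R by rewrite rmorphD /= -!N.
  by rewrite xq_intr // (stD st).
- by rewrite (stC st).
- have -> : a * b = ((a : nat)%:Z * (b : nat)%:Z)%:~R by rewrite rmorphM /= -!N.
  by rewrite xq_intr // -(stS st).
Qed.

Theorem word_val_prime_power i j k s : i != j -> i != k -> j != k ->
  (p = 2%N -> weyl x i j 1 ^+ 4 = 1)%g ->
  eq1_mod q (word_mx s) -> word_val x i j s = 1%g.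
Proof.
move=> ij ik jk w4 s1.
have ji : j != i by rewrite eq_sym.
have wq : weyl xq i j 1 = weyl x i j 1.
  rewrite (weyl1E x) weylE invr1 -[1]/(1%:~R) -[- (1%:~R)]/((-1)%:~R).
  by rewrite !xq_intr.
pose s' := map (omap (fun a : int => a%:~R : 'Z_q)) s.
have -> : word_val x i j s = word_val xq i j s'.
  rewrite /word_val /s' {s1 s'}; elim: s => //= l s ->; congr (_ * _)%g.
  by case: l => [a|] /=; rewrite ?xq_intr.
have mxE : word_mx s' = let: (p, q, r, t) := word_mx s in
    (p%:~R, q%:~R, r%:~R, t%:~R).
  rewrite /s' {s1 s'}; elim: s => [|l s IHs] //=; rewrite IHs.
  case: (word_mx s) => [[[a b] c] d]; case: l => [u|] /=.
    by rewrite !rmorphD !rmorphM.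
  by rewrite !rmorphN.
apply: (word_val_eq1 steinberg_xq ij ik jk).
- move=> u v uU vU; have [p2|p_odd] := even_prime p_pr.
    apply: (sym_two p_pr e_gt0 steinberg_xq) => //.
    (* At u = v = -1 the left side is [tor] at 1, hence 1, and [tor] at -1 is w(1)^-2; thus {-1, -1}
       = w(1)^-4. *)
    have := torM_ij steinberg_xq ij ik jk (unitrN1 _) (unitrN1 _).
    rewrite mulrNN mulr1 (tor1 steinberg_xq) //.
    have t2 : (tor xq i j (-1) * tor xq i j (-1) = 1)%g.
      apply: invg_inj; rewrite torE -(weylV steinberg_xq) // wq !invgM !invgK invg1.
      by rewrite -[RHS](w4 p2) !expgS expg0 mulg1 !mulgA.
    by rewrite -mulgA t2 mulg1 => /(congr1 (fun g => g^-1)%g); rewrite invgK invg1.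
  exact: (sym_odd p_pr e_gt0 steinberg_xq).
- exact: local_Zq.
rewrite mxE; case: (word_mx s) s1 => [[[a b] c] d] /and4P[h1 h2 h3 h4].
have Z0 (z : int) : (q %| z)%Z -> z%:~R = 0 :> 'Z_q.
  by move=> qz; apply/eqP; rewrite (intr_eq_Zp z 0) ?pfactor_gt1 // subr0.
have Z1 (z : int) : (q %| z - 1)%Z -> z%:~R = 1 :> 'Z_q.
  by move=> qz; apply/eqP; rewrite (intr_eq_Zp z 1) ?pfactor_gt1.
by rewrite (Z1 a) // (Z0 b) // (Z0 c) // (Z1 d).
Qed.

End PrimePower.

(** * Splitting a periodic Steinberg family along a coprime factorization *)

Section Split.
Variables (gT : groupType) (x : 'I_3 -> 'I_3 -> int -> gT).
Hypothesis st : steinberg x.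
Variables (M1 M2 : nat) (u1 u2 : int).
Hypothesis u12 : u1 * M2%:Z + u2 * M1%:Z = 1.
Hypothesis stM : forall i j, i != j -> x i j (M1 * M2)%N%:Z = 1%g.
Implicit Types (i j k l : 'I_3) (a b : int).

(** u1 M2 and u2 M1 are the orthogonal idempotents of Z/(M1 M2); [x1] and [x2] are the resulting
    families over Z/M1 and Z/M2. *)
Let x1 i j a := x i j (u1 * M2%:Z * a).
Let x2 i j a := x i j (u2 * M1%:Z * a).

Lemma steinberg_split1 : steinberg x1.
Proof.
split=> [i j a b ij|i j k l a b ij kl jk il|i j k a b ij jk ik].
- by rewrite /x1 mulrDr (stD st).
- by rewrite /x1 (stC st).
rewrite /x1 (stS st) //; congr (_ * _)%g; apply: (st_cong st stM ik).
have -> : u1 * M2%:Z * a * (u1 * M2%:Z * b) - u1 * M2%:Z * (a * b) =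
   - (u1 * u2 * (a * b)) * (M1 * M2)%N%:Z.
  by rewrite PoszM -[X in _ - X]mulr1 -u12; ring.
exact: dvdz_mull.
Qed.

Lemma split1_period i j : i != j -> x1 i j M1%:Z = 1%g.
Proof.
move=> ij; rewrite /x1 (st_dvd st stM ij) //.
by rewrite -mulrA -PoszM mulnC; apply: dvdz_mull.
Qed.

Lemma split_mul i j a : i != j -> x i j a = (x1 i j a * x2 i j a)%g.
Proof. by move=> ij; rewrite /x1 /x2 -(stD st) // -mulrDl u12 mul1r. Qed.

Lemma split_comm_adj i j k a b : i != j -> j != k -> i != k ->
  commute (x1 i j a) (x2 j k b).
Proof.
move=> ij jk ik; apply/commgP/conjg_fixP; rewrite /x1 /x2 (stS st) //.
rewrite (st_dvd st stM ik) ?mulg1 //.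
have -> : u1 * M2%:Z * a * (u2 * M1%:Z * b) = u1 * u2 * a * b * (M1 * M2)%N%:Z.
  by rewrite PoszM; ring.
exact: dvdz_mull.
Qed.

Lemma split_comm_adj' i j k a b : i != j -> j != k -> i != k ->
  commute (x1 j k a) (x2 i j b).
Proof.
move=> ij jk ik; apply/commgP/conjg_fixP; rewrite /x1 /x2 (stS' st) //.
rewrite (st_dvd st stM ik) ?mulg1 //.
have -> : - (u2 * M1%:Z * b * (u1 * M2%:Z * a)) = - (u1 * u2 * a * b) * (M1 * M2)%N%:Z.
  by rewrite PoszM; ring.
exact: dvdz_mull.
Qed.

(** For adjacent positions the correction term has an argument divisible by M1 M2. For opposite
    positions [x1 i j a] is written as a commutator through the third index m, which leaves only
    adjacent positions. *)
Lemma split_commute i j k l a b : i != j -> k != l -> commute (x1 i j a) (x2 k l b).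
Proof.
move=> ij kl.
have [ejk|jk] := eqVneq j k; have [eil|il] := eqVneq i l.
- subst k l; have [m /andP[im jm]] := ord3_third i j.
  have -> : x1 i j a = ((x1 i m a)^-1 * ((x1 m j 1)^-1 * (x1 i m a * x1 m j 1)))%g.
    rewrite -conjgE (stS steinberg_split1) 1?eq_sym // ?mulr1 ?mulKg //.
    by rewrite eq_sym.
  apply/commute_sym; apply: commuteM; first apply: commuteV.
    by apply/commute_sym; apply: split_comm_adj'; rewrite // eq_sym.
  apply: commuteM; first by apply/commuteV/commute_sym/split_comm_adj; rewrite // eq_sym.
  apply: commuteM; apply/commute_sym.
    by apply: split_comm_adj'; rewrite // eq_sym.
  by apply: split_comm_adj; rewrite // eq_sym.
- by subst k; apply: split_comm_adj.
- by subst l; apply: split_comm_adj'; rewrite // eq_sym.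
by apply/commgP/conjg_fixP; apply: (stC st).
Qed.

Section Words.
Variables (i j : 'I_3).
Hypothesis ij : i != j.
Let ji : j != i. Proof. by rewrite eq_sym. Qed.

Lemma split_letter_commute (l l' : option int) :
  commute (if l is Some a then x1 i j a else weyl x1 i j 1)
          (if l' is Some a then x2 i j a else weyl x2 i j 1).
Proof.
rewrite !weylE invr1.
have c k m b : k != m -> commute (if l is Some a then x1 i j a else
    x1 i j 1 * x1 j i (-1)%R * x1 i j 1)%g (x2 k m b).
  move=> km; apply/commute_sym; case: l => [a|].
    exact/commute_sym/split_commute.
  by do !apply: commuteM; apply/commute_sym/split_commute.
by case: l' => [a|]; [|do !apply: commuteM]; apply: c.
Qed.

Lemma split_weyl1 : weyl x i j 1 = (weyl x1 i j 1 * weyl x2 i j 1)%g.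
Proof.
rewrite !weylE invr1 !split_mul // !mulgA.
have [c1 c2] := (split_commute (-1) 1 ji ij, split_commute 1 1 ij ij).
have c3 := split_commute 1 (-1) ij ji.
rewrite -(mulgA _ (x2 i j 1)) -c1 mulgA -(mulgA _ (x2 j i _)) -c3 mulgA.
by rewrite -(mulgA _ (x2 i j 1) (x1 i j 1)) -c2 !mulgA.
Qed.

Lemma split_word s : word_val x i j s = (word_val x1 i j s * word_val x2 i j s)%g.
Proof.
rewrite /word_val; elim: s => [|o s IHs] /=; first by rewrite mulg1.
rewrite {}IHs.
have c : commute (foldr (fun o g => (if o is Some a then x1 i j a else weyl x1 i j 1) * g)
    1 s)%g (if o is Some a then x2 i j a else weyl x2 i j 1).
  elim: s => [|o' s IHs] /=; first exact/commute_sym/commute1.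
  by apply/commute_sym/commuteM; apply/commute_sym; first exact: split_letter_commute.
rewrite -!mulgA; move: c; move: (foldr _ _ _) (foldr _ _ _) => f1 f2 c.
rewrite [X in _ = (_ * X)%g]mulgA c -!mulgA [RHS]mulgA; congr (_ * _)%g.
by case: o {c} => [a|]; [exact: split_mul | exact: split_weyl1].
Qed.
End Words.
End Split.

Section PeriodicWord.
Variables (i j k : 'I_3).
Hypotheses (ij : i != j) (ik : i != k) (jk : j != k).

Lemma split_bezout (M1 M2 : nat) : coprime M1 M2 ->
  exists u1 u2 : int, u1 * M2%:Z + u2 * M1%:Z = 1.
Proof.
rewrite coprime_sym /coprime => /eqP co; have [u [v e]] := Bezoutz M2 M1.
by exists u, v; rewrite e /gcdz /= co.
Qed.

(** The premise on the word of four [None] passes on the factorization w^4 = w1^4 w2^4, from which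
    w1^4 = 1 follows once w^4 = w2^4 = 1 is known. *)
Lemma word_val_split (gT : groupType) (x : 'I_3 -> 'I_3 -> int -> gT) M1 M2
    (s : seq (option int)) :
  steinberg x -> (forall i j, i != j -> x i j (M1 * M2)%N%:Z = 1%g) ->
  coprime M1 M2 -> eq1_mod (M1 * M2) (word_mx s) ->
  (forall x1, steinberg x1 -> (forall i j, i != j -> x1 i j M1%:Z = 1%g) ->
     (forall x2, steinberg x2 -> (forall i j, i != j -> x2 i j M2%:Z = 1%g) ->
       (word_val x i j [:: None; None; None; None] =
        word_val x1 i j [:: None; None; None; None] *
        word_val x2 i j [:: None; None; None; None])%g ->
     word_val x1 i j s = 1%g /\ word_val x2 i j s = 1%g)) ->
  word_val x i j s = 1%g.
Proof.
move=> st stM co s1 H; have [u1 [u2 u12]] := split_bezout co.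
have stM' a b : a != b -> x a b (M2 * M1)%N%:Z = 1%g by rewrite mulnC; apply: stM.
have u21 : u2 * M1%:Z + u1 * M2%:Z = 1 by rewrite addrC.
have [] := H _ (steinberg_split1 st u12 stM) (@split1_period _ _ st M1 M2 u1 stM)
  _ (steinberg_split1 st u21 stM') (@split1_period _ _ st M2 M1 u2 stM').
  exact: split_word.
by rewrite (split_word st u12 stM ij) => -> ->; rewrite mulg1.
Qed.

(** Strong induction on M, splitting off the full power of its smallest prime factor; the cofactor
    is odd and smaller. *)
Lemma word_val_odd M (gT : groupType) (x : 'I_3 -> 'I_3 -> int -> gT) s :
  odd M -> steinberg x -> (forall i j, i != j -> x i j M%:Z = 1%g) ->
  eq1_mod M (word_mx s) -> word_val x i j s = 1%g.
Proof.
elim/ltn_ind: M x s => M IHM x s Modd st stM s1.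
have [M1|M1] := leqP M 1.
  have {}M1 : M = 1%N by case: M M1 Modd {IHM stM s1} => [|[]].
  subst M; have x1 a b c : a != b -> x a b c = 1%g.
    by move=> ab; apply: (st_dvd st stM ab); rewrite dvd1z.
  elim: s {s1} => //= o s ->; rewrite weylE !x1 // 1?eq_sym //.
  by case: o => [a|]; rewrite ?x1 // !mulg1.
set p := pdiv M; have p_pr : prime p by apply: pdiv_prime.
have M0 : (0 < M)%N by apply: ltnW.
have e_gt0 : (0 < logn p M)%N by rewrite -pfactor_dvdn // expn1 pdiv_dvd.
have p_odd : odd p by apply: dvdn_odd Modd; apply: pdiv_dvd.
have M'odd : odd M`_p^'.
  by apply: dvdn_odd Modd; apply: dvdn_part.
have eM : M = (p ^ logn p M * M`_p^')%N by rewrite -p_part partnC.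
have co : coprime (p ^ logn p M) M`_p^'.
  by rewrite -p_part coprime_partC.
rewrite eM in stM s1.
apply: (word_val_split st stM co s1) => x1 st1 stM1 x2 st2 stM2 _; split.
  apply: (word_val_prime_power p_pr e_gt0 st1 stM1 ij ik jk).
    by move=> p2; rewrite p2 in p_odd.
  by apply: eq1_mod_dvd s1; apply: dvdn_mulr.
have ltM : (M`_p^' < M)%N.
  by rewrite {2}eM ltn_Pmull // ?part_gt0 // -(exp1n (logn p M)) ltn_exp2r // prime_gt1.
apply: (IHM _ ltM _ s M'odd st2 stM2).
by apply: eq1_mod_dvd s1; apply: dvdn_mull.
Qed.

Theorem word_val_periodic M (gT : groupType) (x : 'I_3 -> 'I_3 -> int -> gT) s :
  (0 < M)%N -> steinberg x -> (forall i j, i != j -> x i j M%:Z = 1%g) ->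
  (weyl x i j 1 ^+ 4 = 1)%g -> 
  eq1_mod M (word_mx s) -> word_val x i j s = 1%g.
Proof.
move=> M0 st stM w4 s1.
have [M_odd|M_even] := boolP (odd M); first exact: word_val_odd M_odd st stM s1.
have e_gt0 : (0 < logn 2 M)%N.
  by rewrite -pfactor_dvdn // expn1 dvdn2 M_even.
have M'odd : odd (M`_(2%N^'))%N.
  by rewrite -[odd _]negbK -dvdn2 -p'natE // part_pnat.
have eM : M = (2 ^ logn 2 M * (M`_(2%N^'))%N)%N by rewrite -p_part partnC.
have co : coprime (2 ^ logn 2 M) (M`_(2%N^'))%N.
  by rewrite -p_part coprime_partC.
rewrite eM in stM s1.
apply: (word_val_split st stM co s1) => x1 st1 stM1 x2 st2 stM2 w12.
have w2 s' : eq1_mod (M`_(2%N^'))%N (word_mx s') -> word_val x2 i j s' = 1%g.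
  exact: word_val_odd M'odd st2 stM2.
split; last by apply: w2; apply: eq1_mod_dvd s1; apply: dvdn_mull.
apply: (word_val_prime_power (isT : prime 2) e_gt0 st1 stM1 ij ik jk); last first.
  by apply: eq1_mod_dvd s1; apply: dvdn_mulr.
(* The word of four [None] has the identity matrix, so it is trivial over the odd factor and w^4 = 1
   is inherited by [x1]. *)
move=> _; move: w12; rewrite (w2 [:: None; None; None; None]); last first.
  by rewrite /= !opprK subrr !dvdz0.
by rewrite /= !mulg1 !mulgA => e; rewrite -[RHS]w4 !expgS !expg0 !mulg1 !mulgA.
Qed.

End PeriodicWord.

(** * The congruence subgroup theorem *)

Record normal_subgroup (G : groupType) (K : set G) : Prop := NormalSubgroup {
  nsub_subgroup : is_subgroup K;
  nsub_conj : forall g x, K x -> K (g * x * g^-1)%g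
}.

(** * The quotient of a group by a normal subgroup *)

Section QuotientGroup.
Local Open Scope group_scope.
Local Open Scope quotient_scope.
Variables (G : groupType) (K : set G).
Hypothesis nK : normal_subgroup K.

Lemma nsub1 : K 1. Proof. by case: (nsub_subgroup nK). Qed.
Lemma nsubM x y : K x -> K y -> K (x * y).
Proof. exact: is_subgroupM (nsub_subgroup nK). Qed.
Lemma nsubV x : K x -> K x^-1.
Proof. exact: is_subgroupV (nsub_subgroup nK). Qed.

Definition coset_rel (x y : G) : bool := `[< K (x^-1 * y) >].

Fact coset_rel_refl : reflexive coset_rel.
Proof. by move=> x; apply/asboolP; rewrite mulVg; apply: nsub1. Qed.
Fact coset_rel_sym : symmetric coset_rel.
Proof.
have H x y : coset_rel x y -> coset_rel y x.
  by move=> /asboolP/nsubV; rewrite invgM invgK => h; apply/asboolP.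
by move=> x y; apply/idP/idP; apply: H.
Qed.
Fact coset_rel_trans : transitive coset_rel.
Proof.
move=> y x z /asboolP xy /asboolP yz; apply/asboolP.
by have := nsubM xy yz; rewrite mulgA mulgK.
Qed.
Canonical coset_equiv :=
  EquivRel coset_rel coset_rel_refl coset_rel_sym coset_rel_trans.

Definition quot := {eq_quot coset_equiv}.
HB.instance Definition _ := Choice.on quot.
HB.instance Definition _ := EqQuotient.on quot.

Lemma quot_eq x y : \pi_quot x = \pi_quot y <-> K (x^-1 * y).
Proof. by split=> [/eqmodP/asboolP|h] //; apply/eqmodP/asboolP. Qed.

Definition quot_one : quot := \pi_quot 1.
Definition quot_mul (u v : quot) : quot := \pi_quot (repr u * repr v).
Definition quot_inv (u : quot) : quot := \pi_quot (repr u)^-1.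

Lemma repr_quot x : exists2 d, K d & repr (\pi_quot x) = x * d.
Proof.
exists (x^-1 * repr (\pi_quot x)); last by rewrite mulVKg.
by apply/quot_eq; rewrite reprK.
Qed.

Lemma quot_piM x y : \pi_quot (x * y) = quot_mul (\pi_quot x) (\pi_quot y).
Proof.
rewrite /quot_mul; have [d Kd ->] := repr_quot x; have [e Ke ->] := repr_quot y.
apply/quot_eq; have -> : (x * y)^-1 * (x * d * (y * e)) = y^-1 * d * y^-1^-1 * e.
  by rewrite !gnorm.
by apply: nsubM => //; apply: nsub_conj.
Qed.

Lemma quot_piV x : \pi_quot x^-1 = quot_inv (\pi_quot x).
Proof.
rewrite /quot_inv; have [d Kd ->] := repr_quot x.
apply/quot_eq; rewrite invgM invgK mulgA; apply: nsub_conj => //.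
exact: nsubV.
Qed.

Lemma quot_ex (u : quot) : exists x, u = \pi_quot x.
Proof. by exists (repr u); rewrite reprK. Qed.

Fact quot_mulA : associative quot_mul.
Proof.
move=> u v w; have [[x ->] [y ->] [z ->]] := And3 (quot_ex u) (quot_ex v) (quot_ex w).
by rewrite -!quot_piM mulgA.
Qed.
Fact quot_mul1 : left_id quot_one quot_mul.
Proof. by move=> u; have [x ->] := quot_ex u; rewrite -quot_piM mul1g. Qed.
Fact quot_mul1r : right_id quot_one quot_mul.
Proof. by move=> u; have [x ->] := quot_ex u; rewrite -quot_piM mulg1. Qed.
Fact quot_mulV : left_inverse quot_one quot_inv quot_mul.
Proof. by move=> u; have [x ->] := quot_ex u; rewrite -quot_piV -quot_piM mulVg. Qed.
Fact quot_mulVr : right_inverse quot_one quot_inv quot_mul.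
Proof. by move=> u; have [x ->] := quot_ex u; rewrite -quot_piV -quot_piM mulgV. Qed.
HB.instance Definition _ :=
  isGroup.Build quot quot_mulA quot_mul1 quot_mul1r quot_mulV quot_mulVr.

Definition quot_pi (x : G) : quot := \pi_quot x.

Lemma quot_morphM x y : quot_pi (x * y) = quot_pi x * quot_pi y.
Proof. exact: quot_piM. Qed.

Lemma quot_pi1 : quot_pi 1 = 1. Proof. by []. Qed.

Lemma quot_pi_eq1 x : quot_pi x = 1 <-> K x.
Proof.
rewrite -quot_pi1; split=> [/esym/quot_eq|Kx]; first by rewrite invg1 mul1g.
by apply/esym/quot_eq; rewrite invg1 mul1g.
Qed.

End QuotientGroup.

(** * Elementary matrices over the integers *)

Section Elementary.
Variable N : nat.
Implicit Types (i j k l : 'I_N) (a b : int).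

(* Junk value: the identity when i = j. *)
Definition elem_mx i j a : 'M[int]_N := 1%:M + (if i == j then 0 else a) *: delta_mx i j.

Lemma elem_mxD i j a b : elem_mx i j a *m elem_mx i j b = elem_mx i j (a + b).
Proof.
rewrite /elem_mx; case: eqP => [_|/eqP ij]; first by rewrite !scale0r addr0 mulmx1.
rewrite mulmxDl mul1mx mulmxDr mulmx1 -scalemxAl -scalemxAr mul_delta_mx_cond.
by rewrite eq_sym (negPf ij) mulr0n !scaler0 addr0 scalerDl addrA addrAC.
Qed.

Fact elem_subproof i j a : elem_mx i j a \in unitmx.
Proof.
have e : elem_mx i j a *m elem_mx i j (- a) = 1%:M.
  by rewrite elem_mxD subrr /elem_mx if_same scale0r addr0.
by case: (mulmx1_unit e).
Qed.
Definition elem i j a : GL int N := MkGL (elem_subproof i j a).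

Lemma elemE i j a : i != j -> GL_mx (elem i j a) = 1%:M + a *: delta_mx i j.
Proof. by rewrite /= /elem_mx => /negPf ->. Qed.

Lemma GL_mulE (A B : GL int N) : GL_mx (A * B)%g = A *m B. Proof. by []. Qed.
Lemma GL_oneE : GL_mx (1%g : GL int N) = 1%:M. Proof. by []. Qed.
Lemma GL_invE (A : GL int N) : GL_mx A^-1%g = invmx A. Proof. by []. Qed.

Lemma GL_inj (A B : GL int N) : GL_mx A = GL_mx B -> A = B.
Proof. by move=> AB; apply: val_inj. Qed.

Lemma elemD i j a b : elem i j (a + b) = (elem i j a * elem i j b)%g.
Proof. by apply: GL_inj; rewrite GL_mulE /= elem_mxD. Qed.

Lemma elem0 i j : elem i j 0 = 1%g.
Proof. by apply: GL_inj; rewrite /= /elem_mx if_same scale0r addr0. Qed.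

Lemma elemN i j a : elem i j (- a) = (elem i j a)^-1%g.
Proof. by apply: (mulgI (elem i j a)); rewrite -elemD subrr elem0 mulgV. Qed.

Lemma elem_mul i j k l a b : i != j -> k != l ->
  GL_mx (elem i j a * elem k l b)%g =
  1%:M + a *: delta_mx i j + b *: delta_mx k l + (a * b) *: (delta_mx i l *+ (j == k)).
Proof.
move=> ij kl; rewrite GL_mulE !elemE // mulmxDl mul1mx mulmxDr mulmx1.
rewrite -scalemxAl -scalemxAr mul_delta_mx_cond scalerA [a * b]mulrC.
by rewrite [LHS]addrACA addrA addrAC -!addrA; congr (_ + _); rewrite addrCA.
Qed.

Lemma elem_comm i j k l a b : i != j -> k != l -> j != k -> i != l ->
  (elem i j a ^ elem k l b = elem i j a)%g.
Proof.
move=> ij kl jk il; apply/conjg_fixP/commgP; apply: GL_inj.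
rewrite !elem_mul // (negPf jk) eq_sym (negPf il) !mulr0n !scaler0 !addr0.
by rewrite addrAC.
Qed.

Lemma elem_steinberg i j k a b : i != j -> j != k -> i != k ->
  (elem i j a ^ elem j k b = elem i j a * elem i k (a * b)%R)%g.
Proof.
move=> ij jk ik; apply: (mulgI (elem j k b)); rewrite conjgE mulVKg mulgA.
apply: GL_inj; rewrite elem_mul // eqxx [in RHS]GL_mulE elem_mul //.
rewrite (negPf (_ : k != i)) 1?eq_sym // mulr0n scaler0 addr0 elemE //.
rewrite !(mulmxDr, mulmxDl, mulmx1, mul1mx).
rewrite -!scalemxAl -!scalemxAr !mul_delta_mx_0 1?eq_sym // !scaler0 !addr0.
by rewrite mulr1n [_ + a *: _ + _]addrAC.
Qed.

End Elementary.

Lemma steinberg_elem : steinberg (@elem 3).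
Proof.
split=> [i j a b ij|i j k l a b|i j k a b]; first exact: elemD.
  exact: elem_comm.
exact: elem_steinberg.
Qed.

Section Morphism.
Variables (G H : groupType) (f : G -> H).
Hypothesis fM : forall x y, f (x * y)%g = (f x * f y)%g.

Lemma morph1g : f 1%g = 1%g.
Proof. by apply: (mulgI (f 1%g)); rewrite -fM !mulg1. Qed.

Lemma morphVg x : f x^-1%g = (f x)^-1%g.
Proof. by apply: (mulgI (f x)); rewrite -fM !mulgV morph1g. Qed.

Lemma steinberg_morph (R : comUnitRingType) (x : 'I_3 -> 'I_3 -> R -> G) :
  steinberg x -> steinberg (fun i j a => f (x i j a)).
Proof.
move=> st; split=> [i j a b ij|i j k l a b ij kl jk il|i j k a b ij jk ik].
- by rewrite (stD st) // fM.
- by rewrite conjgE -morphVg -!fM -conjgE (stC st).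
- by rewrite conjgE -morphVg -!fM -conjgE (stS st).
Qed.

Lemma word_val_morph (R : comUnitRingType) (x : 'I_3 -> 'I_3 -> R -> G) i j s :
  word_val (fun i j a => f (x i j a)) i j s = f (word_val x i j s).
Proof.
rewrite /word_val; elim: s => [|o s IHs] /=; first by rewrite morph1g.
by rewrite IHs fM; case: o => [a|] //; rewrite !weylE !fM.
Qed.
End Morphism.

(** Euclid's algorithm on the first column (p, r), by induction on a bound for the absolute value of
    r. *)
Lemma word_mx_surj (p q r t : int) : p * t - q * r = 1 ->
  exists s : seq (option int), word_mx s = (p, q, r, t).
Proof.
have [n] := ubnP `|r|%N; elim: n => // n IHn in p q r t *; rewrite ltnS => rn det1.
have [r0|r0] := eqVneq r 0.
  have pt : p * t = 1 by rewrite -det1 r0 mulr0 subr0.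
  have [p1|p1] : p = 1 \/ p = -1.
    by have /eqP := congr1 absz pt; rewrite abszM muln_eq1 => /andP[/eqP]; lia.
    exists [:: Some q]; rewrite /= r0 !(mulr0, mulr1, add0r, addr0) p1.
    by move: pt; rewrite p1 mul1r => ->.
  (* Two letters [None] give minus the identity, which accounts for p = -1. *)
  exists [:: None; None; Some (- q)] => /=; rewrite r0 !(mulr0, mulr1, add0r, addr0) p1 oppr0 opprK.
  by move: pt; rewrite p1 mulN1r => <-; rewrite opprK.
pose a := (p %/ r)%Z; pose p' := (p %% r)%Z.
have ep : p = a * r + p' by rewrite -divz_eq.
have lt : (`|p'| < n)%N.
  have : (`|p'| < `|r|)%N by rewrite /p'; have := ltz_mod p r0; have := modz_ge0 p r0; lia.
  by move=> h; apply: leq_trans h _; lia.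
have [||s es] := IHn (- r) (- t) p' (q - a * t).
- exact: lt.
- by rewrite -det1 ep; ring.
exists (Some a :: None :: s); rewrite /= es; congr (_, _, _, _).
- by rewrite opprK ep addrC.
- by rewrite opprK subrK.
- by rewrite opprK.
- by rewrite opprK.
Qed.

Section Block22.
Variables (N : nat) (i j : 'I_N).
Hypothesis ij : i != j.

Definition emb22 (m : int * int * int * int) : 'M[int]_N :=
  let: (p, q, r, t) := m in
  1%:M + (p - 1) *: delta_mx i i + q *: delta_mx i j
  + r *: delta_mx j i + (t - 1) *: delta_mx j j.

Lemma emb22_upper p q r t a :
  elem i j a *m emb22 (p, q, r, t) = emb22 (p + a * r, q + a * t, r, t).
Proof.
rewrite elemE // /emb22 mulmxDl mul1mx !mulmxDr mulmx1.
rewrite -!scalemxAl -!scalemxAr !mul_delta_mx_cond !eqxx.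
rewrite (eq_sym j i) (negPf ij) !mulr0n !mulr1n !scaler0 !addr0 !scalerA.
by apply/matrixP=> u v; rewrite !mxE; ring.
Qed.

Lemma emb22_lower p q r t a :
  elem j i a *m emb22 (p, q, r, t) = emb22 (p, q, r + a * p, t + a * q).
Proof.
rewrite elemE 1?eq_sym // /emb22 mulmxDl mul1mx !mulmxDr mulmx1.
rewrite -!scalemxAl -!scalemxAr !mul_delta_mx_cond !eqxx.
rewrite (negPf ij) !mulr0n !mulr1n !scaler0 !addr0 !scalerA.
by apply/matrixP=> u v; rewrite !mxE; ring.
Qed.

Lemma emb22_1 : emb22 (1, 0, 0, 1) = 1%:M.
Proof. by rewrite /emb22 subrr !scale0r !addr0. Qed.
End Block22.
Arguments emb22 : simpl never.

Lemma word_val_elem i j s : i != j ->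
  GL_mx (word_val (@elem 3) i j s) = emb22 i j (word_mx s).
Proof.
move=> ij; rewrite /word_val; elim: s => [|o s IHs] /=; first by rewrite emb22_1.
rewrite IHs; case: (word_mx s) => [[[p q] r] t]; case: o => [a|].
  exact: emb22_upper.
rewrite weylE invr1 !GL_mulE -!mulmxA emb22_upper // emb22_lower // emb22_upper //.
by congr (emb22 _ _ (_, _, _, _)); ring.
Qed.

Lemma weyl_elem_4 i j : i != j -> (weyl (@elem 3) i j 1 ^+ 4 = 1)%g.
Proof.
move=> ij; have := word_val_elem [:: None; None; None; None] ij.
rewrite (_ : word_mx _ = (1, 0, 0, 1)) // emb22_1 => e.
by apply: GL_inj; rewrite GL_oneE -e !expgS expg0.
Qed.

(** A permutation s other than 1 moves some i and also s i, so its term contains two off-diagonal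
    entries and hence t^2; the identity contributes 1 + t tr X modulo t^2. Both determinant one and
    trace zero for congruence matrices come from this. *)
Lemma det_1D n (t : int) (X : 'M[int]_n) :
  exists y, \det (1%:M + t *: X) = 1 + t * \tr X + t ^+ 2 * y.
Proof.
have prodP (I : finType) (F : I -> int) :
    exists y, \prod_i (1 + t * F i) = 1 + t * \sum_i F i + t ^+ 2 * y.
  rewrite -[index_enum I]/(index_enum I); elim: (index_enum I) => [|i r [y IHr]].
    by exists 0; rewrite !big_nil !mulr0 !addr0.
  rewrite !big_cons IHr; exists (y + F i * \sum_(i <- r) F i + t * (F i * y)).
  by ring.
have [y ey] := prodP _ (fun i => X i i).
have termP (s : 'S_n) : exists z, s != 1%g ->
    (-1) ^+ s * \prod_i (1%:M + t *: X) i (s i) = t ^+ 2 * z.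
  have [->|sN] := eqVneq s 1%g; first by exists 0.
  have [i si] : exists i, s i != i.
    by apply/existsP; apply: contraNT sN => /existsPn H; apply/eqP/permP=> i;
      rewrite perm1; apply/eqP; have := H i; rewrite negbK.
  have sj : s (s i) != s i by rewrite (inj_eq perm_inj).
  pose P := \prod_(k | (k != i) && (k != s i)) (1%:M + t *: X) k (s k).
  exists ((-1) ^+ s * (X i (s i) * (X (s i) (s (s i)) * P))) => _.
  rewrite (bigD1 i) //= (bigD1 (s i)) //= -/P !mxE.
  rewrite [i == _]eq_sym (negPf si) [s i == _]eq_sym (negPf sj) !add0r.
  move: P ((-1) ^+ s) (X i _) (X (s i) _) => P e u v; ring.
pose z s := sval (cid (termP s)).
exists (y + \sum_(s : 'S_n | s != 1%g) z s).
rewrite /determinant (bigD1 1%g) //= odd_perm1 expr0 mul1r mulrDr addrA.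
congr (_ + _); last by rewrite mulr_sumr; apply: eq_bigr => s sN; apply: (svalP (cid (termP s))).
by rewrite -ey; apply: eq_bigr => i _; rewrite perm1 !mxE eqxx.
Qed.

(** * Matrices congruent to 1 modulo m *)

Section CongruenceSubgroup.
Variable N : nat.

Definition congruent (m : nat) (A : GL int N) : Prop :=
  exists X : 'M[int]_N, GL_mx A = 1%:M + m%:Z *: X.

Lemma congruentM m A B : congruent m A -> congruent m B -> congruent m (A * B)%g.
Proof.
move=> [X eA] [Y eB]; exists (X + Y + m%:Z *: (X *m Y)); rewrite GL_mulE eA eB.
rewrite mulmxDl mul1mx mulmxDr mulmx1 -scalemxAl -scalemxAr.
by rewrite !scalerDr !scalerA -!addrA; congr (_ + _); rewrite addrCA.
Qed.

Lemma congruent_conj m g A : congruent m A -> congruent m (g * A * g^-1)%g.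
Proof.
move=> [X eA]; exists (g *m X *m invmx g); rewrite !GL_mulE GL_invE eA.
by rewrite mulmxDr mulmx1 -scalemxAr mulmxDl -scalemxAl (mulmxV (Defs.GL_unit g)).
Qed.

Lemma congruent_elem (m : nat) i j c : congruent m (elem i j (m%:Z * c) : GL int N).
Proof.
exists ((if i == j then 0 else c) *: delta_mx i j); rewrite /= /elem_mx scalerA.
by case: ifP => _; rewrite ?mulr0.
Qed.

Lemma congruentP m A :
  congruent m A <-> (forall i j, (m %| (GL_mx A - 1%:M) i j)%Z).
Proof.
split=> [[X ->] i j|H]; first by rewrite addrC addKr mxE dvdz_mulr.
exists (\matrix_(i, j) ((GL_mx A - 1%:M) i j %/ m%:Z)%Z).
rewrite -[LHS](addrNK 1%:M) addrC; congr (_ + _); apply/matrixP=> i j.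
by rewrite [RHS]mxE [X in _ * X]mxE mulrC divzK.
Qed.

Definition elementary_level (m : nat) (K : set (GL int N)) : Prop :=
  forall i j, i != j -> K (elem i j m%:Z).

Lemma elementary_levelM m K i j c : normal_subgroup K -> elementary_level m K ->
  i != j -> K (elem i j (m%:Z * c)).
Proof.
move=> nK Km ij; have pos n : K (elem i j (m%:Z * n%:Z)).
  elim: n => [|n IHn]; first by rewrite mulr0 elem0; apply: (nsub1 nK).
  by rewrite intS mulrDr mulr1 elemD; apply: (nsubM nK) => //; apply: Km.
case: c => n //; rewrite NegzE mulrN elemN; apply: (nsubV nK); exact: pos.
Qed.

Lemma congruent_det m A : (2 < m)%N -> congruent m A -> \det (GL_mx A) = 1.
Proof.
move=> m3 [X eA]; have [y ey] := det_1D m%:Z X; rewrite -eA in ey.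
have [//|dN1] : \det (GL_mx A) = 1 \/ \det (GL_mx A) = -1.
  have := Defs.GL_unit A; rewrite unitmxE => /unitrPr[b /(congr1 absz)/eqP].
  by rewrite abszM muln_eq1 => /andP[/eqP]; lia.
have /dvdzP[c /(congr1 absz)] : (m %| 2)%Z.
  apply/dvdzP; exists (- (\tr X + m%:Z * y)).
  have -> : 2 = - (-1 - 1) :> int by [].
  by rewrite -[X in - (X - _)]dN1 ey; ring.
by rewrite abszM => /eqP; case: (`|c|%N) m3 => [|[|c']] /=; lia.
Qed.

End CongruenceSubgroup.

(** Euclid writes A as a word. In GL_3(Z) / K the elementary matrices form an m-periodic Steinberg
    family, so [word_val_periodic] applies with third index [ord0]. *)
Lemma congr_base m (K : set (GL int 3)) (A : GL int 3) p q r t :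
  (2 < m)%N -> normal_subgroup K -> elementary_level m K ->
  congruent m A -> GL_mx A = emb22 (lift ord0 ord0) ord_max (p, q, r, t) ->
  p * t - q * r = 1 -> K A.
Proof.
move=> m3 nK Km cA eA det1; set i := lift ord0 ord0 in eA; set j := ord_max in eA.
have ij : i != j by [].
have [s es] := word_mx_surj det1.
have eAs : A = word_val (@elem 3) i j s.
  by apply: GL_inj; rewrite word_val_elem // es.
apply/(quot_pi_eq1 nK); rewrite eAs -(word_val_morph (quot_morphM nK)).
apply: (@word_val_periodic i j ord0 _ _ _ m) => //.
- exact: ltnW (ltnW m3).
- exact (@steinberg_morph _ _ (quot_pi nK) (quot_morphM nK) int (@elem 3) steinberg_elem).
- by move=> k l kl; apply/quot_pi_eq1/Km.
- have := weyl_elem_4 ij => /(congr1 (quot_pi nK)).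
  by rewrite !expgS !expg0 !quot_morphM quot_pi1 !weylE !quot_morphM.
have ji : j != i by [].
have E : [/\ GL_mx A i i = p, GL_mx A i j = q, GL_mx A j i = r & GL_mx A j j = t].
  by rewrite eA /emb22; split; rewrite !mxE !eqxx ?(negPf ij) ?(negPf ji) /=; ring.
rewrite es; have /congruentP H := cA; case: E => E1 E2 E3 E4.
have := And4 (H i i) (H i j) (H j i) (H j j); rewrite ![_ (_ - _) _ _]mxE ![_ (- _) _ _]mxE.
rewrite ![_ 1%:M _ _]mxE !eqxx (negPf ij) (negPf ji) /= !subr0 E1 E2 E3 E4.
by case=> h1 h2 h3 h4; apply/and4P.
Qed.

Local Ltac block_entries i j :=
  rewrite -[i]splitK -[j]splitK;
  case: (split i) => ?; case: (split j) => ?; rewrite /=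
    ?(block_mxEul, block_mxEur, block_mxEdl, block_mxEdr) !mxE
    ?(eq_lshift, eq_rshift, eq_lrshift, eq_rlshift).

(** * Lowering the matrix size by one, modulo K *)

Section BlockStep.
Variable N : nat.

Lemma unitmx_block (a : 'M[int]_1) v c (D : 'M[int]_N) :
  (v == 0) || (c == 0) -> a \in unitmx -> D \in unitmx ->
  block_mx a v c D \in unitmx.
Proof.
by rewrite !unitmxE => /orP[] /eqP-> aU DU; rewrite ?det_lblock ?det_ublock unitrM aU.
Qed.

Fact diag_block_subproof (B : GL int N) :
  block_mx (1%:M : 'M[int]_1) 0 0 (GL_mx B) \in unitmx.
Proof. by rewrite unitmx_block ?eqxx ?unitmx1 ?Defs.GL_unit. Qed.
Definition diag_block (B : GL int N) : GL int (1 + N) := MkGL (diag_block_subproof B).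

Fact row_block_subproof (w : 'rV[int]_N) :
  block_mx (1%:M : 'M[int]_1) w 0 1%:M \in unitmx.
Proof. by rewrite unitmx_block ?eqxx ?orbT ?unitmx1. Qed.
Definition row_block w : GL int (1 + N) := MkGL (row_block_subproof w).

Fact col_block_subproof (u : 'cV[int]_N) :
  block_mx (1%:M : 'M[int]_1) 0 u 1%:M \in unitmx.
Proof. by rewrite unitmx_block ?eqxx ?orbT ?unitmx1. Qed.
Definition col_block u : GL int (1 + N) := MkGL (col_block_subproof u).

Lemma diag_blockM B C : diag_block (B * C)%g = (diag_block B * diag_block C)%g.
Proof.
apply: GL_inj; rewrite !GL_mulE /= mulmx_block !mulmx0 !mul0mx mulmx1.
by rewrite !addr0 !add0r.
Qed.

Lemma row_blockD v w : row_block (v + w) = (row_block v * row_block w)%g.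
Proof.
apply: GL_inj; rewrite !GL_mulE /= mulmx_block !mulmx0 !mul0mx !mulmx1 !mul1mx.
by rewrite !addr0 !add0r addrC.
Qed.

Lemma col_blockD v w : col_block (v + w) = (col_block v * col_block w)%g.
Proof.
apply: GL_inj; rewrite !GL_mulE /= mulmx_block !mulmx0 !mul0mx !mulmx1 !mul1mx.
by rewrite !addr0 !add0r.
Qed.

Lemma row_block_delta k a :
  row_block (a *: delta_mx 0 k) = elem (lshift N 0) (rshift 1 k) a.
Proof.
apply: GL_inj; rewrite elemE ?eq_lrshift //=; apply/matrixP=> i j; block_entries i j.
all: rewrite ?ord1 ?eqxx /= ?andbF ?mulr0 ?addr0 ?add0r //.
Qed.

Lemma col_block_delta k a :
  col_block (a *: delta_mx k 0) = elem (rshift 1 k) (lshift N 0) a.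
Proof.
apply: GL_inj; rewrite elemE ?eq_rlshift //=; apply/matrixP=> i j; block_entries i j.
all: rewrite ?ord1 ?eqxx /= ?andbF ?mulr0 ?addr0 ?add0r //.
Qed.

Lemma diag_block_elem i j a : i != j ->
  diag_block (elem i j a) = elem (rshift 1 i) (rshift 1 j) a.
Proof.
move=> ij; apply: GL_inj; rewrite elemE ?eq_rshift //=.
apply/matrixP=> k l; block_entries k l.
all: rewrite ?(negPf ij) ?ord1 ?eqxx /= ?andbF ?mulr0 ?addr0 ?add0r //.
Qed.

Lemma diag_block1 : diag_block 1%g = 1%g.
Proof. exact: morph1g diag_blockM. Qed.

Lemma congruent_diag_block m B : congruent m (diag_block B) -> congruent m B.
Proof.
move=> /congruentP H; apply/congruentP => i j.
have := H (rshift 1 i) (rshift 1 j).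
by rewrite [_ (_ - _) _ _]mxE block_mxEdr !mxE eq_rshift.
Qed.

Lemma diag_block_congruent m B : congruent m B -> congruent m (diag_block B).
Proof.
move=> [X eB]; exists (block_mx 0 0 0 X) => /=.
by rewrite eB scale_block_mx scalar_mx_block add_block_mx !scaler0 !addr0.
Qed.

Variables (m : nat) (K : set (GL int (1 + N))).
Hypotheses (nK : normal_subgroup K) (Km : elementary_level m K).

Lemma sub_row_block w : K (row_block (m%:Z *: w)).
Proof.
rewrite [w]matrix_sum_delta big_ord1 scaler_sumr.
apply: (big_ind (fun w => K (row_block w))) => [|v w' Kv Kw|k _].
- rewrite (_ : row_block 0 = 1%g); first exact: nsub1.
  by apply: (mulgI (row_block 0)); rewrite -row_blockD addr0 mulg1.
- by rewrite row_blockD; apply: nsubM.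
by rewrite scalerA row_block_delta; apply: elementary_levelM; rewrite // eq_lrshift.
Qed.

Lemma sub_col_block u : K (col_block (m%:Z *: u)).
Proof.
rewrite [u]matrix_sum_delta scaler_sumr.
apply: (big_ind (fun u => K (col_block u))) => [|v w' Kv Kw|k _].
- rewrite (_ : col_block 0 = 1%g); first exact: nsub1.
  by apply: (mulgI (col_block 0)); rewrite -col_blockD addr0 mulg1.
- by rewrite col_blockD; apply: nsubM.
by rewrite big_ord1 scalerA col_block_delta; apply: elementary_levelM; rewrite // eq_rlshift.
Qed.

Lemma congruent_row_block w : congruent m (row_block (m%:Z *: w)).
Proof.
exists (block_mx 0 w 0 0) => /=.
by rewrite scale_block_mx scalar_mx_block add_block_mx !scaler0 !addr0 add0r.
Qed.

Lemma congruent_col_block u : congruent m (col_block (m%:Z *: u)).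
Proof.
exists (block_mx 0 0 u 0) => /=.
by rewrite scale_block_mx scalar_mx_block add_block_mx !scaler0 !addr0 add0r.
Qed.


Lemma sub_mulr x y : K y -> K (x * y)%g -> K x.
Proof. by move=> Ky Kxy; rewrite -[x](mulgK y); apply: nsubM => //; apply: nsubV. Qed.

Lemma sub_mull x y : K x -> K (x * y)%g -> K y.
Proof. by move=> Kx Kxy; rewrite -[y](mulKg x); apply: nsubM => //; apply: nsubV. Qed.

Lemma sub_conj g x : K (g * x * g^-1)%g -> K x.
Proof.
move=> Kx; rewrite (_ : x = g^-1 * (g * x * g^-1) * g^-1^-1)%g; first exact: nsub_conj.
by rewrite !gnorm.
Qed.

Lemma congruent_block A : congruent m A -> exists a v c D,
  GL_mx A = block_mx (1%:M + m%:Z *: a) (m%:Z *: v) (m%:Z *: c) D :> 'M_(1 + N).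
Proof.
move=> [X eA]; exists (ulsubmx X), (ursubmx X), (dlsubmx X), (1%:M + m%:Z *: drsubmx X).
rewrite eA -{1}(submxK X) scale_block_mx scalar_mx_block add_block_mx.
by rewrite !add0r.
Qed.

(* Clear the first row, then the first column. *)
Lemma block_step_unit (A : GL int (1 + N)) v c D : congruent m A ->
  GL_mx A = block_mx (1%:M : 'M_1) v c D ->
  exists2 B : GL int N, congruent m B & K (diag_block B) -> K A.
Proof.
move=> cA eA; have [a [v' [c' [D' eA']]]] := congruent_block cA.
have [_ ev ec _] := eq_block_mx (etrans (esym eA) eA').
pose A1 := (col_block (m%:Z *: - c') * (A * row_block (m%:Z *: - v')))%g.
have eA1 : GL_mx A1 = block_mx (1%:M : 'M_1) 0 0 (D - c *m v).
  rewrite !GL_mulE /= eA !mulmx_block !mulmx0 !mulmx1 !mul1mx !mul0mx !addr0.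
  rewrite !scalerN -ev -ec mulmx1 !addNr mulmx0 add0r mulmxN addrC.
  by [].
have DU : D - c *m v \in unitmx.
  by have := Defs.GL_unit A1; rewrite !unitmxE eA1 det_lblock det1 mul1r.
exists (MkGL DU).
  apply: congruent_diag_block; rewrite (_ : diag_block _ = A1); last exact: GL_inj.
  apply: congruentM; first exact: congruent_col_block.
  by apply: congruentM => //; apply: congruent_row_block.
rewrite (_ : diag_block _ = A1); last exact: GL_inj.
move=> KA1; apply: (sub_mulr (sub_row_block (- v'))).
exact: (sub_mull (sub_col_block (- c'))).
Qed.

(* Conjugation brings the first row to (a, b, 0, ..., 0).  As a s + b y = 1 and a
   is 1 modulo m, operations from K put 1 - a in the third place, and one more
   conjugation turns a into 1. *)
Lemma block_step (A : GL int (1 + N)) : (1 < N)%N -> congruent m A ->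
  exists2 B : GL int N, congruent m B & K (diag_block B) -> K A.
Proof.
move=> N1 cA; pose v : 'rV_N := ursubmx (GL_mx A).
(* In the Smith form of a single row, R alone clears every entry but the leading one; it supplies
   the conjugating matrix. *)
have [L LU [R RU [d _ ev]]] := int_Smith_normal_form v.
pose r0 := Ordinal (ltnW N1); pose r1 := Ordinal N1.
set dm := (\matrix_(i, j) _) in ev.
pose g := diag_block (MkGL RU).
pose A1 := (g * A * g^-1)%g.
have cA1 : congruent m A1 by apply: congruent_conj.
have KA1 : K A1 -> K A by apply: sub_conj.
have eA1g : (A1 * g = g * A)%g by rewrite mulgVK.
clearbody A1; have [x [v1 [c1 [D1 eA1]]]] := congruent_block cA1.
have ev1 : m%:Z *: v1 = L *m dm.
  have := congr1 (@GL_mx _ _) eA1g.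
  rewrite !GL_mulE eA1 -(submxK (GL_mx A)) /= !mulmx_block !mulmx0 !mul0mx !mul1mx !mulmx1.
  case/eq_block_mx => _ + _ _; rewrite !addr0 !add0r -/v ev.
  by move/(congr1 (mulmxr (invmx R))); rewrite /= -!mulmxA mulmxV // !mulmx1.
pose b := L 0 0 * d`_0.
have ev1' : m%:Z *: v1 = b *: delta_mx 0 r0.
  apply/rowP=> k; rewrite ev1 !mxE big_ord1 !mxE /b -mulrA; congr (_ * _).
  by rewrite eqxx eq_sym -[X in (X *+ _)]mulr1 mulrnAr.
pose x0 := x 0 0; pose a1 := 1 + m%:Z * x0.
have ea1 : 1%:M + m%:Z *: x = a1%:M :> 'M_1.
  by rewrite [LHS]mx11_scalar !mxE eqxx.
rewrite {}ea1 {}ev1' in eA1.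
(* The first row of [A1] is paired with the first column of its inverse. *)
have [s [y bez]] : exists s y, a1 * s + b * y = 1.
  pose Y := GL_mx A1^-1%g; exists (ulsubmx (Y : 'M_(1 + N)) 0 0), (dlsubmx (Y : 'M_(1 + N)) r0 0).
  have : GL_mx A1 *m Y = 1%:M by rewrite -GL_mulE mulgV.
  rewrite eA1 -(submxK (Y : 'M_(1 + N))) mulmx_block (scalar_mx_block 1 N).
  case/eq_block_mx => /matrixP/(_ 0 0) + _ _ _.
  by rewrite mul_scalar_mx -scalemxAl -rowE !block_mxKul !block_mxKdl !mxE.
(* The Bezout relation times -m x0 reads a1 (m S) + b (m T) = 1 - a1. The coefficients are multiples
   of m, so [k1] and [k2] lie in K. *)
pose T := - x0 * y; pose S := - x0 * s.
pose k1 := diag_block (elem r0 r1 (m%:Z * T)); pose k2 := row_block (m%:Z *: (S *: delta_mx 0 r1)).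
have r01 : r0 != r1 by [].
have Kk1 : K k1.
  by rewrite /k1 diag_block_elem //; apply: elementary_levelM; rewrite // eq_rshift.
pose A2 := (A1 * (k1 * k2))%g.
have cA2 : congruent m A2.
  apply: congruentM => //; apply: congruentM; last exact: congruent_row_block.
  by rewrite /k1 diag_block_elem //; apply: congruent_elem.
pose v2 := b *: delta_mx 0 r0 + (1 - a1) *: delta_mx 0 r1 : 'rV[int]_N.
have [c2 [D2 eA2]] : exists c2 D2, GL_mx A2 = block_mx (a1%:M : 'M_1) v2 c2 D2.
  rewrite !GL_mulE eA1 [GL_mx k1]/= [GL_mx k2]/= !mulmx_block.
  rewrite !mulmx0 !mul0mx !mulmx1 !mul1mx !addr0 !add0r.
  do 2 eexists; congr block_mx; first by rewrite mulmx1 mulmx0 addr0.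
  rewrite mul_scalar_mx /elem_mx (negPf r01) mulmxDr mulmx1 -scalemxAl -scalemxAr.
  rewrite mul_delta_mx /v2; apply/rowP=> k; rewrite !mxE.
  have -> : 1 - a1 = a1 * (m%:Z * S) + b * (m%:Z * T).
    transitivity (- (m%:Z * x0) * (a1 * s + b * y)); first by rewrite bez /a1; ring.
    by rewrite /S /T; ring.
  by ring.
have eA2' : A2 = (A1 * (k1 * k2))%g by [].
clearbody A2.
(* Right multiplication by [col_block u] adds the entry 1 - a1 in place [r1] to the corner a1; the
   left factor leaves the first row alone. *)
pose u : 'cV[int]_N := delta_mx r1 0.
pose A3 := (col_block (- u) * A2 * (col_block (- u))^-1)%g.
have cA3 : congruent m A3 by apply: congruent_conj.
have uV : (col_block (- u))^-1%g = col_block u.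
  by apply: (mulgI (col_block (- u))); rewrite mulgV -col_blockD addNr;
    apply: (mulgI (col_block 0)); rewrite -col_blockD addr0 mulg1.
have [c3 [D3 eA3]] : exists c3 D3, GL_mx A3 = block_mx (1%:M : 'M_1) v2 c3 D3.
  rewrite /A3 uV !GL_mulE eA2 /= !mulmx_block.
  rewrite !mulmx0 !mul0mx !mulmx1 !mul1mx !addr0 !add0r.
  do 2 eexists; congr block_mx; rewrite /v2 mulmxDl -!scalemxAl /u !mul_delta_mx_cond.
  rewrite (negPf r01) eqxx mulr0n mulr1n scaler0 add0r.
  by apply/matrixP=> k l; rewrite !ord1 !mxE eqxx; ring.
have [B cB KB] := block_step_unit cA3 eA3.
exists B => // /KB KA3; apply: KA1.
apply: (sub_mulr (y := (k1 * k2)%g)); first exact: nsubM (sub_row_block _).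
by rewrite -eA2'; apply: sub_conj KA3.
Qed.

End BlockStep.

Lemma ord2_cases (k : 'I_2) : k = 0 \/ k = 1.
Proof. by case: k => [[|[|//]] ?]; [left|right]; apply: val_inj. Qed.

Lemma diag_block_emb22 (B : GL int 2) :
  GL_mx (diag_block B) = emb22 (rshift 1 0) (rshift 1 1)
    (GL_mx B 0 0, GL_mx B 0 1, GL_mx B 1 0, GL_mx B 1 1) :> 'M_(1 + 2).
Proof.
rewrite /emb22 /=; apply/matrixP=> i j; block_entries i j.
all: rewrite ?ord1 ?eqxx ?andbF /= ?mulr0 ?addr0 //.
match goal with |- fun_of_matrix _ ?k ?l = _ =>
  have [->|->] := ord2_cases k; have [->|->] := ord2_cases l end.
all: by rewrite /= ?mulr0 ?mulr1 ?addr0 ?add0r // addrC subrK.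
Qed.

(** Descent on N: the B with [diag_block B] in K form a normal subgroup of the same level one size
    down. At N = 3 a last block step leaves a 2 x 2 block inside GL_3, with the third index still
    available. *)
Theorem congruence_subgroup N m (K : set (GL int N)) (A : GL int N) :
  (2 < N)%N -> (2 < m)%N -> normal_subgroup K -> elementary_level m K ->
  congruent m A -> K A.
Proof.
move=> N3 m3; have [n eN] : exists n, N = n.+3 by exists (N - 3)%N; lia.
subst N; elim: n K A {N3} => [|n IHn] K A nK Km cA.
  have [//|B cB] := @block_step 2 m K nK Km A _ cA; apply.
  have [i1 j1] : lift ord0 ord0 = rshift 1 0 :> 'I_(1 + 2) /\
      ord_max = rshift 1 1 :> 'I_(1 + 2) by split; apply: val_inj.
  apply: (@congr_base m K _ (GL_mx B 0 0) (GL_mx B 0 1) (GL_mx B 1 0) (GL_mx B 1 1)) => //.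
  - exact: diag_block_congruent.
  - by rewrite i1 j1 diag_block_emb22.
  - rewrite -(congruent_det m3 cB) (expand_det_row _ ord0) !big_ord_recl big_ord0.
    rewrite /cofactor !det_mx11 !mxE /= addr0 mulN1r expr0 mul1r mulrN.
    by congr (GL_mx B _ _ * GL_mx B _ _ - GL_mx B _ _ * GL_mx B _ _); apply: val_inj.
have [//|B cB] := @block_step n.+3 m K nK Km A _ cA; apply.
apply: (IHn (fun B => K (diag_block B))) => //; last first.
  move=> i j ij; rewrite diag_block_elem //.
  apply: Km; apply/eqP => e; case/eqP: ij.
  by apply: ord_inj; case: (congr1 (@nat_of_ord _) e).
split=> [|g C KC]; last by rewrite !diag_blockM (morphVg (@diag_blockM _)); apply: nsub_conj.
split=> [|C D KC KD]; first by rewrite diag_block1; apply: nsub1.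
by rewrite diag_blockM (morphVg (@diag_blockM _)); apply: nsubM => //; apply: nsubV.
Qed.

(** * The lower central series *)

Lemma lcs_morph (G H : groupType) (f : G -> H) k x :
  (forall x y, f (x * y)%g = (f x * f y)%g) -> lcs k x -> lcs k (f x).
Proof.
move=> fM; elim: k x => [|[|k] IHk] // x; move: x.
suff S : (lcs k.+2 `<=` [set x : G | lcs k.+2 (f x)])%classic by exact: S.
apply: comm_subgroup_sub => [|x y _ ky].
  split=> [|x y hx hy] /=; first by rewrite (morph1g fM); apply: (lcs1 H k.+2).
  rewrite fM (morphVg fM); exact: lcsM hx (lcsV hy).
change (lcs k.+2 (f (comm x y))).
by rewrite /comm !fM !(morphVg fM); apply: mem_comm_subgroup => //; apply: IHk.
Qed.

Section LowerCentralCongruence.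
Variables (N q : nat).
Hypotheses (N3 : (2 < N)%N) (q3 : (2 < q)%N).
Local Notation G := (congr_GL N q).

Let q1 : (1 < q)%N. Proof. exact: ltnW. Qed.

Lemma red_modE (A : 'M[int]_N) i j : red_mod q A i j = (A i j)%:~R.
Proof. by rewrite mxE. Qed.

Lemma red_mod_eq0 (X : 'M[int]_N) : red_mod q X = 0 <-> exists Y, X = q%:Z *: Y.
Proof.
split=> [X0|[Y ->]]; last first.
  apply/matrixP=> i j; rewrite red_modE !mxE; apply/eqP.
  by rewrite (intr_eq_Zp _ 0) // subr0 dvdz_mulr.
exists (\matrix_(i, j) (X i j %/ q%:Z)%Z); apply/matrixP=> i j; rewrite !mxE.
have := congr1 (fun M : 'M_N => M i j) X0; rewrite red_modE mxE => /eqP.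
by rewrite (intr_eq_Zp _ 0) // subr0 => qX; rewrite mulrC divzK.
Qed.

Lemma red_modD (X Y : 'M[int]_N) : red_mod q (X + Y) = red_mod q X + red_mod q Y.
Proof. exact: map_mxD. Qed.
Lemma red_modM (X Y : 'M[int]_N) : red_mod q (X *m Y) = red_mod q X *m red_mod q Y.
Proof. exact: map_mxM. Qed.
Lemma red_modN (X : 'M[int]_N) : red_mod q (- X) = - red_mod q X.
Proof. exact: map_mxN. Qed.
Lemma red_mod1 : red_mod q (1%:M : 'M[int]_N) = 1%:M.
Proof. exact: map_mx1. Qed.
Lemma red_modZ (X : 'M[int]_N) : red_mod q (q%:Z *: X) = 0.
Proof. by apply/red_mod_eq0; exists X. Qed.

Lemma in_congrP (A : GL int N) : in_congr q A <-> congruent q A.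
Proof.
rewrite /in_congr; split=> [/eqP e|[X ->]]; last first.
  by rewrite red_modD red_mod1 red_modZ addr0.
have /red_mod_eq0[Y eY] : red_mod q (GL_mx A - 1%:M) = 0.
  by rewrite red_modD e red_modN red_mod1 subrr.
by exists Y; rewrite -eY addrC subrK.
Qed.

Lemma congr_valP (A : G) : congruent q (congr_val A).
Proof. by apply/in_congrP; apply: (valP A). Qed.

(** A B - B A is exactly a b (X Y - Y X), and the commutator is 1 + (A B - B A)(B A)^-1. Being an
    identity, it serves both the filtration and the bracket. *)
Lemma congruent_comm a b (A B : GL int N) X Y :
  GL_mx A = 1%:M + a%:Z *: X -> GL_mx B = 1%:M + b%:Z *: Y ->
  GL_mx (comm A B) =
    1%:M + (a * b)%N%:Z *: ((X *m Y - Y *m X) *m GL_mx (B * A)^-1%g).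
Proof.
move=> eA eB.
have -> : comm A B = (A * B * (B * A)^-1)%g by rewrite /comm invgM !mulgA.
have e : GL_mx (A * B)%g = GL_mx (B * A)%g + (a * b)%N%:Z *: (X *m Y - Y *m X).
  rewrite !GL_mulE eA eB !(mulmxDl, mulmxDr) !mul1mx !mulmx1 -!scalemxAl -!scalemxAr.
  by apply/matrixP=> i j; rewrite !mxE PoszM; ring.
have V : GL_mx (B * A)%g *m GL_mx (B * A)^-1%g = 1%:M.
  by have := congr1 (@GL_mx int N) (mulgV (B * A)%g).
transitivity (GL_mx (A * B)%g *m GL_mx (B * A)^-1%g); first by [].
by rewrite e [LHS]mulmxDl V -scalemxAl.
Qed.

Lemma congruent_dvd m m' (A : GL int N) : (m' %| m)%N -> congruent m A -> congruent m' A.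
Proof.
move=> /dvdnP[c ->] [X eA]; exists (c%:Z *: X).
by rewrite eA scalerA PoszM mulrC.
Qed.

Lemma congruentV m (A : GL int N) : congruent m A -> congruent m A^-1%g.
Proof.
move=> [X eA]; exists (- (X *m GL_mx A^-1%g)).
have e := congr1 (@GL_mx _ _) (mulgV A); rewrite GL_mulE eA mulmxDl mul1mx in e.
rewrite scalerN scalemxAl; apply/eqP; rewrite eq_sym subr_eq eq_sym.
by apply/eqP; apply: e.
Qed.

Lemma lcs_congruent k (A : G) : (0 < k)%N -> lcs k A -> congruent (q ^ k) (congr_val A).
Proof.
case: k => // k _; elim: k A => [|k IHk] A; first by rewrite expn1 => _; apply: congr_valP.
move: A; suff S : (lcs k.+2 `<=` [set A : G | congruent (q ^ k.+2) (congr_val A)])%classic.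
  by exact: S.
apply: comm_subgroup_sub => [|A B _ /IHk[Y eY]].
  split=> [|A B cA cB]; first by exists 0; rewrite scaler0 addr0.
  change (congruent (q ^ k.+2) (congr_val A * (congr_val B)^-1)%g).
  by apply: congruentM => //; apply: congruentV.
have [X eX] := congr_valP A.
have e := congruent_comm eX eY; rewrite -expnS in e.
by eexists; apply: e.
Qed.

Lemma elem_commE i j l a b : i != l -> l != j -> i != j ->
  comm (elem i l a) (elem l j b) = elem i j (a * b) :> GL int N.
Proof.
move=> il lj ij; have := elem_steinberg a (- b) il lj ij.
rewrite elemN conjgE invgK mulrN elemN => e.
have -> : comm (elem i l a) (elem l j b) =
  (elem i l a * (elem l j b * (elem i l a * (elem l j b)^-1))^-1)%g.
  by rewrite /comm !invgM !invgK !mulgA.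
have ji : j != i by rewrite eq_sym.
have /conjg_fixP/commgP c := elem_comm (a * b) a ij il ji il.
by rewrite e invgM invgK mulgA -c mulgK.
Qed.

(** [congruence_subgroup] asks for normality in all of GL_N(Z), so Gamma_k is transported there.
    Conjugation by any g in GL_N(Z) is an automorphism of the congruence subgroup and therefore
    preserves Gamma_k. *)
Definition lcs_image k : set (GL int N) :=
  fun A => exists2 B : G, congr_val B = A & lcs k B.

Lemma lcs_image_normal k : normal_subgroup (lcs_image k).
Proof.
split=> [|g _ [B <- kB]].
  split=> [|_ _ [A <- kA] [B <- kB]]; first by exists 1%g => //; apply: lcs1.
  by exists (A * B^-1)%g => //; apply: lcsM => //; apply: lcsV.
have cP (A : G) : in_congr q (g * congr_val A * g^-1)%g.
  by apply/in_congrP/congruent_conj/congr_valP.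
pose f A := MkCongr (cP A).
exists (f B) => //; apply: lcs_morph kB => x y; apply: val_inj => /=.
by rewrite !mulgA mulgVK.
Qed.

(** For an index l other than i and j, x_ij(q^(k+1)) is the commutator of x_il(q) and x_lj(q^k). *)
Lemma lcs_image_elem k : (0 < k)%N -> elementary_level (q ^ k) (lcs_image k).
Proof.
case: k => // k _; elim: k => [|k IHk] i j ij.
  have cE : in_congr q (elem i j q%:Z).
    by apply/in_congrP; rewrite -[q%:Z]mulr1; apply: congruent_elem.
  by rewrite expn1; exists (MkCongr cE).
have [l /andP[il lj]] : exists l, (i != l) && (l != j).
  have : (0 < #|~: [set i; j]|)%N by rewrite cardsCs finset.setCK card_ord cards2 ij; lia.
  by case/card_gt0P => l; rewrite !inE negb_or => /andP[li lj]; exists l; rewrite eq_sym li.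
have jl : l != j by [].
have cE : in_congr q (elem i l q%:Z).
  by apply/in_congrP; rewrite -[q%:Z]mulr1; apply: congruent_elem.
have [B eB kB] := IHk _ _ jl; exists (comm (MkCongr cE) B).
  rewrite expnS PoszM -(elem_commE _ _ il jl ij) -eB.
  by [].
exact: lcs_comm1.
Qed.

Theorem lcs_congruentP k (A : G) : (0 < k)%N ->
  lcs k A <-> congruent (q ^ k) (congr_val A).
Proof.
move=> k0; split=> [|cA]; first exact: lcs_congruent.
have qk : (2 < q ^ k)%N by apply: leq_trans q3 _; rewrite -{1}[q]expn1 leq_exp2l.
have [B eB kB] := congruence_subgroup N3 qk (lcs_image_normal k) (lcs_image_elem k0) cA.
by rewrite (_ : A = B) //; apply: val_inj.
Qed.
End LowerCentralCongruence.

(** * Leading coefficients modulo q *)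

Section LeadingCoefficient.
Variables (N q : nat).
Hypotheses (N3 : (2 < N)%N) (q3 : (2 < q)%N).
Local Notation G := (congr_GL N q).

Let q1 : (1 < q)%N. Proof. exact: ltnW. Qed.
Let qk_neq0 k : ((q ^ k)%N%:Z != 0)%R. Proof. by rewrite -lt0n expn_gt0 (ltnW q1). Qed.

(** Junk value unless A is 1 modulo q^k, when the division is exact. *)
Definition lead_mx k (A : GL int N) : 'M[int]_N :=
  \matrix_(i, j) ((GL_mx A - 1%:M) i j %/ (q ^ k)%N%:Z)%Z.

Lemma lead_mxE k (A : GL int N) X :
  GL_mx A = 1%:M + (q ^ k)%N%:Z *: X -> lead_mx k A = X.
Proof.
move=> eA; apply/matrixP=> i j; rewrite mxE eA addrC addKr mxE mulrC mulzK //.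
Qed.

Lemma lead_mxK k (A : GL int N) : congruent (q ^ k) A ->
  GL_mx A = 1%:M + (q ^ k)%N%:Z *: lead_mx k A.
Proof. by case=> X eA; rewrite (lead_mxE eA). Qed.

(* 1 + q^k M |-> M mod q. *)
Definition lead_coef_mod k (A : GL int N) : 'M['Z_q]_N := red_mod q (lead_mx k A).
Local Notation theta := lead_coef_mod.

(** The cross term q^k X Y vanishes modulo q because k > 0. *)
Lemma thetaM k A B : (0 < k)%N -> congruent (q ^ k) A -> congruent (q ^ k) B ->
  theta k (A * B)%g = theta k A + theta k B.
Proof.
case: k => // k _ [X eA] [Y eB]; rewrite /theta (lead_mxE eA) (lead_mxE eB).
rewrite (_ : lead_mx _ _ = X + Y + q%:Z *: ((q ^ k)%N%:Z *: (X *m Y))).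
  by rewrite !(red_modD q) (red_modZ q3) addr0.
apply: lead_mxE; rewrite GL_mulE eA eB.
rewrite mulmxDl mul1mx mulmxDr mulmx1 -scalemxAl -scalemxAr.
rewrite !scalerDr !scalerA -!addrA; congr (_ + _); rewrite addrCA; congr (_ + (_ + _)).
by rewrite expnS PoszM; congr (_ *: _); ring.
Qed.

Lemma theta_eq0 k A : congruent (q ^ k) A ->
  theta k A = 0 <-> congruent (q ^ k.+1) A.
Proof.
move=> cA; split=> [/(red_mod_eq0 q3)[Y eY]|[X eA]].
  by exists Y; rewrite (lead_mxK cA) eY scalerA -PoszM -expnSr.
rewrite /theta (@lead_mxE k A (q%:Z *: X)) ?(red_modZ q3) //.
by rewrite scalerA -PoszM -expnSr.
Qed.

Lemma theta_comm i j A B : (0 < i)%N -> (0 < j)%N ->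
  congruent (q ^ i) A -> congruent (q ^ j) B ->
  theta (i + j) (comm A B) = theta i A *m theta j B - theta j B *m theta i A.
Proof.
move=> i0 j0 cA cB; have [X eA] := cA; have [Y eB] := cB.
have e := congruent_comm eA eB; rewrite -expnD in e.
rewrite /theta (lead_mxE e) (lead_mxE eA) (lead_mxE eB).
rewrite (red_modM q) (red_modD q) (red_modN q) !(red_modM q).
suff -> : red_mod q (GL_mx (B * A)^-1%g) = 1%:M by rewrite mulmx1.
have [Z ->] : congruent q (B * A)^-1%g.
  apply/congruentV/congruentM; first by apply: congruent_dvd cB; apply: dvdn_exp.
  by apply: congruent_dvd cA; apply: dvdn_exp.
by rewrite (red_modD q) red_mod1 (red_modZ q3) addr0.
Qed.

(** Expanding the determinant 1 gives q^k tr X = -q^(2k) y, so tr X is divisible by q. *)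
Lemma theta_trace k A : (0 < k)%N -> congruent (q ^ k) A -> \tr (theta k A) = 0.
Proof.
move=> k0 cA; have qk : (2 < q ^ k)%N by apply: leq_trans q3 _; rewrite -{1}[q]expn1 leq_exp2l.
have d1 := congruent_det qk cA; have [X eA] := cA.
rewrite /theta (lead_mxE eA).
have [y] := det_1D (q ^ k)%N%:Z X; rewrite -eA d1 => e.
have tX : \tr X = q%:Z * - ((q ^ k.-1)%N%:Z * y).
  apply: (mulfI (qk_neq0 k)); rewrite mulrN mulrA -PoszM -expnS prednK //.
  have {}e : (q ^ k)%N%:Z * \tr X + (q ^ k)%N%:Z ^+ 2 * y = 0.
    by apply: (addrI 1); rewrite addrA -e addr0.
  by apply/eqP; rewrite mulrN -subr_eq0 opprK mulrA -expr2 e.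
have -> : \tr (red_mod q X) = (\tr X)%:~R.
  by rewrite /mxtrace rmorph_sum; apply: eq_bigr => i _; rewrite mxE.
by apply/eqP; rewrite tX (intr_eq_Zp _ 0) // subr0 dvdz_mulr.
Qed.

Lemma theta_elem k i j a : (0 < k)%N -> i != j ->
  exists2 A : GL int N, congruent (q ^ k) A & theta k A = a *: delta_mx i j.
Proof.
move=> k0 ij; exists (elem i j ((q ^ k)%N%:Z * (a : nat)%:Z)); first exact: congruent_elem.
rewrite /theta (@lead_mxE _ _ ((a : nat)%:Z *: delta_mx i j)); last by rewrite elemE // scalerA.
apply/matrixP=> r s; rewrite !mxE rmorphM /= -pmulrn natr_Zp.
by case: (_ && _).
Qed.

Lemma theta_conj k g A : congruent (q ^ k) A ->
  theta k (g * A * g^-1)%g = red_mod q (GL_mx g) *m theta k A *m red_mod q (GL_mx g^-1%g).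
Proof.
move=> [X eA]; rewrite /theta (lead_mxE eA) -!(red_modM q); congr red_mod.
apply: lead_mxE; rewrite !GL_mulE eA.
have V : GL_mx g *m GL_mx g^-1%g = 1%:M by have := congr1 (@GL_mx int N) (mulgV g).
by rewrite mulmxDr mulmx1 [LHS]mulmxDl V -scalemxAr -scalemxAl.
Qed.

(** Conjugating a e_ij by 1 + e_ji gives a (e_ij + e_jj - e_ii - e_ji); the factors B and C remove
    the off-diagonal terms. *)
Lemma theta_diag k i j a : (0 < k)%N -> i != j ->
  exists2 A : GL int N, congruent (q ^ k) A &
    theta k A = a *: (delta_mx j j - delta_mx i i).
Proof.
move=> k0 ij; have ji : j != i by rewrite eq_sym.
have [A cA eA] := theta_elem a k0 ij; have [B cB eB] := theta_elem (- a) k0 ij.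
have [C cC eC] := theta_elem a k0 ji.
pose g : GL int N := elem j i 1.
exists (g * A * g^-1 * B * C)%g.
  exact: congruentM (congruentM (congruent_conj g cA) cB) cC.
have cJ := congruent_conj g cA.
rewrite thetaM //; last exact: congruentM.
rewrite thetaM // theta_conj // eA eB eC -elemN !elemE //.
rewrite !(red_modD q) red_mod1.
have rd b : red_mod q (b *: delta_mx j i : 'M_N) = b%:~R *: delta_mx j i.
  apply/matrixP=> r s; rewrite !mxE rmorphM /=; by case: (_ && _).
rewrite !rd !rmorphN /= scale1r scaleN1r.
rewrite mulmxDl mul1mx -scalemxAr mul_delta_mx mulmxDr mulmx1 mulmxN mulmxDl.
rewrite -!scalemxAl !mul_delta_mx scaleNr scalerBr opprD.
by apply/matrixP=> r s; rewrite !mxE; ring.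
Qed.

Lemma theta_surj k (M : 'M['Z_q]_N) : (0 < k)%N -> \tr M = 0 ->
  exists A : G, lcs k A /\ theta k (congr_val A) = M.
Proof.
move=> k0 trM.
pose P (M : 'M['Z_q]_N) := exists2 A : GL int N, congruent (q ^ k) A & theta k A = M.
suff [A cA eA] : P M.
  have cqA : in_congr q A.
    by apply/in_congrP => //; apply: congruent_dvd cA; apply: dvdn_exp.
  by exists (MkCongr cqA); split=> //; apply/(lcs_congruentP N3 q3 _ k0).
have P0 : P 0.
  exists 1%g; first by exists 0; rewrite scaler0 addr0.
  by rewrite theta_eq0 //; exists 0; rewrite scaler0 addr0.
have PD X Y : P X -> P Y -> P (X + Y).
  move=> [A cA <-] [B cB <-]; exists (A * B)%g; first exact: congruentM.
  exact: thetaM.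
have Psum (I : finType) (F : I -> 'M['Z_q]_N) : (forall i, P (F i)) -> P (\sum_i F i).
  by move=> PF; apply: (big_ind P) => // i _; apply: PF.
pose i0 : 'I_N := Ordinal (ltnW (ltnW N3)).
(* The subtracted terms at [i0] add up to tr M = 0, and every remaining summand is realized by
   [theta_diag] or [theta_elem]. *)
have -> : M = \sum_i \sum_j (if i == j then M i i *: (delta_mx i i - delta_mx i0 i0)
                             else M i j *: delta_mx i j).
  transitivity (\sum_i (\sum_j M i j *: delta_mx i j - M i i *: delta_mx i0 i0)).
    rewrite sumrB -matrix_sum_delta -scaler_suml.
    by rewrite (_ : \sum_i M i i = 0) // scale0r subr0.
  apply: eq_bigr => i _; rewrite (bigD1 i) //= [RHS](bigD1 i) //= eqxx scalerBr addrAC.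
  congr (_ + _); apply: eq_bigr => j ji; by rewrite eq_sym (negPf ji).
apply: (Psum) => i; apply: (Psum) => j; case: eqVneq => [_|ij].
  have [->|ii0] := eqVneq i0 i; first by rewrite subrr scaler0.
  exact: theta_diag.
exact: theta_elem.
Qed.

End LeadingCoefficient.

(** * Assembly of the graded isomorphism *)

Section Isomorphism.
Variables (n q : nat).
Hypotheses (n3 : (2 < n.+1)%N) (q3 : (2 < q)%N).
Local Notation G := (congr_GL n.+1 q).
Local Notation M := 'M['Z_q]_n.+1.
Local Notation theta k A := (lead_coef_mod q k (congr_val A)).

(** Degree 0 is sent to 0, in accordance with the trivial group [gr G 0] and with the zero constant
    coefficient on the polynomial side; additivity of the leading coefficient is available for k >
    0. *)
Definition gr_mx k (u : gr G k) : M := if k is 0 then 0 else theta k (of_gr u).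

Let lcsP k (A : G) : (0 < k)%N -> lcs k A -> congruent (q ^ k) (congr_val A).
Proof. by move=> k0 /(lcs_congruentP n3 q3 A k0). Qed.

Lemma gr_mx_to_gr k A : (0 < k)%N -> lcs k A -> gr_mx (to_gr k A) = theta k A.
Proof.
move=> k0 kA; rewrite /gr_mx; have [d kd ->] := of_to_gr kA.
have cd : congruent (q ^ k.+1) (congr_val d) by apply: lcsP.
have cA := lcsP k0 kA.
have cd' : congruent (q ^ k) (congr_val d) by apply: lcsP (lcsS kd).
transitivity (theta k A + theta k d); first by case: k k0 {kA kd cd} cA cd' => // k k0; exact: thetaM.
by have [_ ->] := theta_eq0 q3 cd'; rewrite ?addr0.
Qed.

Lemma gr_mxD k (u v : gr G k) : gr_mx (u + v) = gr_mx u + gr_mx v.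
Proof.
case: k u v => [|k] u v; first by rewrite addr0.
have [A kA ->] := gr_ex u; have [B kB ->] := gr_ex v.
rewrite -to_grM // !gr_mx_to_gr //; last exact: (lcsM (k := k.+1)).
by apply: thetaM => //; apply: lcsP.
Qed.

Lemma gr_mx0 k : gr_mx (0 : gr G k) = 0.
Proof. by apply: (addrI (gr_mx (0 : gr G k))); rewrite -gr_mxD !addr0. Qed.

Lemma gr_mxN k (u : gr G k) : gr_mx (- u) = - gr_mx u.
Proof. by apply: (addrI (gr_mx u)); rewrite -gr_mxD !subrr gr_mx0. Qed.

(** A vanishing leading coefficient puts the matrix in H_(k+1); the hard inclusion of H_(k+1) in
    Gamma_(k+1) then makes its class zero. *)
Lemma gr_mx_eq0 k (u : gr G k) : gr_mx u = 0 -> u = 0.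
Proof.
case: k u => [|k] u; first by move=> _; apply: gr0_trivial.
have [A kA ->] := gr_ex u; rewrite gr_mx_to_gr // => /(theta_eq0 q3 (lcsP _ kA)).
move=> /(_ isT) cA; apply: to_gr_lcsS.
by apply/(lcs_congruentP n3 q3).
Qed.

Lemma gr_mx_inj k : injective (@gr_mx k).
Proof. by move=> u v e; apply/subr0_eq/gr_mx_eq0; rewrite gr_mxD gr_mxN e subrr. Qed.

Lemma gr_mx_lie i j k (u : gr G i) (v : gr G j) : (i + j = k)%N ->
  gr_mx (gr_lie k u v) = gr_mx u * gr_mx v - gr_mx v * gr_mx u.
Proof.
move=> ijk; case: i u ijk => [|i] u ijk.
  by rewrite (gr0_trivial u) (br0l (@gr_lieDl G)) // !gr_mx0 mul0r mulr0 subrr.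
case: j v ijk => [|j] v ijk.
  by rewrite (gr0_trivial v) (br0r (@gr_lieDr G)) // !gr_mx0 mul0r mulr0 subrr.
have [A kA ->] := gr_ex u; have [B kB ->] := gr_ex v; rewrite gr_lieE //; subst k.
rewrite !gr_mx_to_gr //; last exact: lcs_comm.
by apply: theta_comm => //; apply: lcsP.
Qed.

Lemma gr_mx_trace k (u : gr G k) : \tr (gr_mx u) = 0.
Proof.
case: k u => [|k] u; first by rewrite mxtrace0.
have [A kA ->] := gr_ex u; rewrite gr_mx_to_gr //.
by apply: theta_trace => //; apply: lcsP.
Qed.

Lemma gr_mx_surj k (X : M) : (0 < k)%N -> \tr X = 0 -> exists u : gr G k, gr_mx u = X.
Proof.
move=> k0 trX; have [A [kA <-]] := theta_surj n3 q3 k0 trX.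
by exists (to_gr k A); rewrite gr_mx_to_gr.
Qed.

(** The length is an arbitrarily chosen bound on the support; by [coef_lcs_poly] the polynomial does
    not depend on that choice. *)
Definition lcs_poly (f : lcs_lie G) : {poly M} :=
  \poly_(k < sval (cid (finsuppP f))) gr_mx (dsum_val f k).

Lemma coef_lcs_poly f k : (lcs_poly f)`_k = gr_mx (dsum_val f k).
Proof.
rewrite coef_poly; case: ltnP => // le_k.
by rewrite (svalP (cid (finsuppP f))) // gr_mx0.
Qed.

Fact lcs_poly_subproof f : in_sl_poly_pos (lcs_poly f).
Proof.
apply/asboolP; split=> [i|]; rewrite coef_lcs_poly //; exact: gr_mx_trace.
Qed.
Definition lcs_to_sl f : sl_poly_pos n q := MkSlPoly (lcs_poly_subproof f).

Lemma coef_lcs_to_sl f k : (sl_poly_val (lcs_to_sl f))`_k = gr_mx (dsum_val f k).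
Proof. exact: coef_lcs_poly. Qed.

Lemma sl_polyE (p r : sl_poly_pos n q) :
  (forall k, (sl_poly_val p)`_k = (sl_poly_val r)`_k) -> p = r.
Proof. by move=> pr; apply/val_inj/polyP. Qed.

Lemma lcs_to_sl_inj : injective lcs_to_sl.
Proof.
by move=> f g e; apply: dsumP => k; apply: gr_mx_inj; rewrite -!coef_lcs_to_sl e.
Qed.

Lemma lcs_to_sl_surj p : exists f, lcs_to_sl f = p.
Proof.
have [trp p0] := sl_polyP p.
have ex k : exists u : gr G k, gr_mx u = (sl_poly_val p)`_k.
  case: k => [|k]; last exact: gr_mx_surj.
  by exists 0; rewrite p0.
pose F k : gr G k := sval (cid (ex k)).
have FE k : gr_mx (F k) = (sl_poly_val p)`_k by apply: (svalP (cid (ex k))).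
(* The chosen preimages vanish beyond the size of the polynomial because [gr_mx] has trivial
   kernel. *)
have fF : finsupp F.
  apply/asboolP; exists (size (sl_poly_val p)) => k le_k.
  by apply: gr_mx_eq0; rewrite FE nth_default.
by exists (DSum fF); apply: sl_polyE => k; rewrite coef_lcs_to_sl FE.
Qed.

Lemma lcs_to_sl_iso : graded_lie_iso lcs_to_sl.
Proof.
split.
- pose g p := sval (cid (lcs_to_sl_surj p)).
  have gK : cancel g lcs_to_sl by move=> p; apply: (svalP (cid (lcs_to_sl_surj p))).
  by exists g => // f; apply: lcs_to_sl_inj; rewrite gK.
- move=> f g; apply: sl_polyE => k.
  by rewrite coefD !coef_lcs_to_sl dsumDE gr_mxD.
- move=> f g; apply: sl_polyE => k; rewrite coef_lcs_to_sl.
  rewrite coefB coefM coefMr -sumrB /=.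
  transitivity (\sum_(i < k.+1) gr_mx (gr_lie k (dsum_val f i) (dsum_val g (k - i)%N))).
    by apply: (big_morph (@gr_mx k)) => [u v|]; rewrite ?gr_mxD ?gr_mx0.
  apply: eq_bigr => i _; rewrite !coef_lcs_poly gr_mx_lie //.
  by rewrite subnKC // -ltnS.
move=> d f; split=> h k kd; last by rewrite coef_lcs_to_sl h // gr_mx0.
by apply: gr_mx_eq0; rewrite -coef_lcs_to_sl h.
Qed.

Lemma lcs_to_sl_class k A : (0 < k)%N -> lcs k A ->
  sl_poly_val (lcs_to_sl (lcs_class k A)) = theta k A *: 'X^k.
Proof.
move=> k0 kA; apply/polyP => l; rewrite coef_lcs_to_sl coefZ coefXn /=.
have [->|lk] := eqVneq l k; first by rewrite inj_fun_eq gr_mx_to_gr // mulr1.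
by rewrite inj_fun_neq 1?eq_sym // gr_mx0 mulr0.
Qed.

End Isomorphism.

(* The isomorphism is the canonical one: it sends the class of
   1 + q^k M in Gamma_k / Gamma_(k+1) to (M mod q) t^k. *)
Theorem corollary1p46 (n q : nat) (hn : (5 <= n.+1)%N) (hq : (3 <= q)%N) :
  exists phi : lcs_lie (congr_GL n.+1 q) -> sl_poly_pos n q,
    graded_lie_iso phi /\
    forall (k : nat) (A : congr_GL n.+1 q), (0 < k)%N -> lcs k A ->
      exists M : 'M[int]_n.+1,
        GL_mx (congr_val A) = 1%:M + (q%:Z ^+ k) *: M /\
        sl_poly_val (phi (lcs_class k A)) = red_mod q M *: 'X^k.
Proof.
have n3 : (2 < n.+1)%N by apply: leq_trans hn.
exists (lcs_to_sl n3 hq); split; first exact: lcs_to_sl_iso.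
move=> k A k0 kA; exists (lead_mx q k (congr_val A)); split.
  have -> : q%:Z ^+ k = (q ^ k)%N by rewrite -!natz natrX.
  apply: lead_mxK => //.
  by apply/(lcs_congruentP n3 hq).
exact: lcs_to_sl_class.
Qed.
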